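(* Let $n\ge 2$ be an integer and let $\widetilde\psi,\theta\in C_0^\infty(\mathbb{R}^n)$ satisfy $$\operatorname{supp}\widetilde\psi\subset\{1/3\le|\xi|\le3\},\quad \widetilde\psi(\xi)=1\ \text{for}\ 1/2\le|\xi|\le2,$$ $$\operatorname{supp}\theta\subset\{|\xi|\le10\},\quad \theta(\xi)=1\ \text{for}\ |\xi|\le6.$$ Let $m\in\mathbb{R}$ and suppose that there is a constant $c\in(0,\infty)$, independent of $j$, such that $$2^{jm}\Big\|e^{i|D|}\widetilde\psi(2^{-j}D)f\cdot e^{i|D|}\widetilde\psi(2^{-j}D)g\cdot e^{i|D|}\theta(2^{-j}D)h\Big\|_{L^1(\mathbb{R}^n)}\le c\,\|f\|_{L^\infty}\|g\|_{L^\infty}\|h\|_{H^1}$$ for all $j\in\mathbb{N}$, all $f,g\in\mathcal{S}(\mathbb{R}^n)$ and all $h\in\mathcal{S}(\mathbb{R}^n)\cap H^1(\mathbb{R}^n)$. Then $m\le-(n+1)/2$.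
   Context: $\mathbb{N}$ is the set of positive integers, $\mathcal{S}(\mathbb{R}^n)$ is the Schwartz class, and $H^1(\mathbb{R}^n)$ is the usual (real) Hardy space. The Fourier transform is $\widehat f(\xi)=\int_{\mathbb{R}^n}e^{-i\xi\cdot x}f(x)\,dx$. For a function $\kappa$ on $\mathbb{R}^n$ (measurable, locally integrable, of at most polynomial growth), $\kappa(D)f(x)=\frac{1}{(2\pi)^n}\int_{\mathbb{R}^n}e^{ix\cdot\xi}\kappa(\xi)\widehat f(\xi)\,d\xi$ for $f\in\mathcal{S}(\mathbb{R}^n)$; thus $e^{i|D|}\kappa(2^{-j}D)$ is the operator with multiplier $e^{i|\xi|}\kappa(2^{-j}\xi)$. *)

(* Defs.v *)
From HB Require Import structures.
From mathcomp Require Import all_boot all_order all_algebra.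
From mathcomp Require Import complex.
From mathcomp Require Import all_classical all_reals all_analysis.

Set Implicit Arguments.
Unset Strict Implicit.
Unset Printing Implicit Defensive.

Import Order.TTheory GRing.Theory Num.Theory.
Import numFieldNormedType.Exports.

Local Open Scope classical_set_scope.
Local Open Scope ring_scope.
Local Open Scope complex_scope.

(* R^n is 'rV[R]_n, with the product topology. Beware that the
   library norm `|x| on 'rV[R]_n is the sup norm; the Euclidean norm is enorm. *)

(* The sigma-algebra on R^n generated by the coordinates, as the library does
   for n.-tuple R; it is the Borel sigma-algebra. *)
Section measurable_rV.
Context {R : realType} {n : nat}.

Definition rV_coord (i : 'I_n) (x : 'rV[R]_n) : R := x ord0 i.

Let rV_set0 : g_sigma_preimage rV_coord set0.
Proof. exact: sigma_algebra0. Qed.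

Let rV_setC A : g_sigma_preimage rV_coord A -> g_sigma_preimage rV_coord (~` A).
Proof. exact: sigma_algebraC. Qed.

Let rV_bigcup (F : (set 'rV[R]_n)^nat) :
  (forall i, g_sigma_preimage rV_coord (F i)) ->
  g_sigma_preimage rV_coord (\bigcup_i (F i)).
Proof. exact: sigma_algebra_bigcup. Qed.

HB.instance Definition _ := @isMeasurable.Build default_measure_display
  'rV[R]_n (g_sigma_preimage rV_coord) rV_set0 rV_setC rV_bigcup.

Lemma measurable_rV_coord (i : 'I_n) : measurable_fun setT (rV_coord i).
Proof.
move=> _ Y mY; rewrite setTI; apply: sub_sigma_algebra => /=.
rewrite -bigcup_seq/=; exists i => /=; first by rewrite mem_index_enum.
by exists Y => //; rewrite setTI.
Qed.

Lemma measurable_fun_rVP d (T : measurableType d) (f : T -> 'rV[R]_n) :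
  (forall i, measurable_fun setT (rV_coord i \o f)) -> measurable_fun setT f.
Proof.
move=> mf _ A mA; rewrite setTI.
pose G := [set B : set 'rV[R]_n | measurable (f @^-1` B)].
suff : g_sigma_preimage rV_coord `<=` G by apply; exact: mA.
apply: smallest_sub.
  split => [|B|F] /=; rewrite /G/=.
  - by rewrite preimage_set0.
  - by move=> mB; rewrite setTD -preimage_setC; exact: measurableC.
  - by move=> mF; rewrite preimage_bigcup; exact: bigcup_measurable.
rewrite -bigcup_seq => B [i _ [Y mY <-]]; rewrite /G/= setTI.
by have := mf i measurableT Y mY; rewrite setTI.
Qed.

End measurable_rV.

Section lebesgue_rV.
Context {R : realType}.

Definition rV_cons n (p : 'rV[R]_n * R) : 'rV[R]_n.+1 :=
  row_mx (const_mx p.2 : 'rV_1) p.1.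

Lemma measurable_rV_cons n : measurable_fun setT (@rV_cons n).
Proof.
apply: measurable_fun_rVP => i.
case: (@split_ordP 1 n i) => j ->.
  rewrite [X in measurable_fun _ X](_ : _ = snd)//.
  by apply/funext => p; exact: etrans (row_mxEl _ _ _ _) (mxE _ _ _ _).
rewrite [X in measurable_fun _ X](_ : _ = rV_coord j \o fst).
  by apply: measurableT_comp => //; exact: measurable_rV_coord.
by apply/funext => p; exact: row_mxEr.
Qed.

Definition lebesgue_rVS n (mu : {sigma_finite_measure set 'rV[R]_n -> \bar R}) :
    set 'rV[R]_n.+1 -> \bar R :=
  pushforward (mu \x lebesgue_measure)%E (@rV_cons n).

Section lebesgue_rVS_measure.
Variables (n : nat) (mu : {sigma_finite_measure set 'rV[R]_n -> \bar R}).
Let mcons := @measurable_rV_cons n.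

Let lebesgue_rVS0 : lebesgue_rVS mu set0 = 0%E.
Proof. exact: measure0. Qed.

Let lebesgue_rVS_ge0 A : (0 <= lebesgue_rVS mu A)%E.
Proof. exact: measure_ge0. Qed.

Let lebesgue_rVS_sigma_additive : semi_sigma_additive (lebesgue_rVS mu).
Proof. exact: measure_semi_sigma_additive. Qed.

HB.instance Definition _ := isMeasure.Build _ _ _ (lebesgue_rVS mu)
  lebesgue_rVS0 lebesgue_rVS_ge0 lebesgue_rVS_sigma_additive.

Let lebesgue_rVS_sigma_finite : sigma_finite setT (lebesgue_rVS mu).
Proof.
have /sigma_finiteP[F [FT ndF mF]] := sigma_finiteT mu.
have /sigma_finiteP[G [GT ndG mG]] := sigma_finiteT (@lebesgue_measure R).
pose uncons (x : 'rV[R]_n.+1) : 'rV[R]_n * R :=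
  (rsubmx (x : 'rV_(1 + n)), x ord0 ord0).
have consK : cancel (@rV_cons n) uncons.
  move=> [x a]; congr (_, _); first exact: row_mxKr.
  rewrite (_ : ord0 = @lshift 1 n ord0); last exact/val_inj.
  exact: etrans (row_mxEl _ _ _ _) (mxE _ _ _ _).
have muncons : measurable_fun setT uncons.
  apply/measurable_fun_pairP; split.
    apply: measurable_fun_rVP => i; rewrite [X in measurable_fun _ X](_ : _ =
      rV_coord (@rshift 1 n i)); first exact: measurable_rV_coord.
    by apply/funext => x; exact: mxE.
  exact: (measurable_rV_coord (ord0 : 'I_n.+1)).
exists (fun k => uncons @^-1` (F k `*` G k)).
  rewrite -preimage_bigcup; apply/esym; rewrite -subTset => x _ /=.
  have [k _ Fk] : (\bigcup_k F k) (uncons x).1 by rewrite -FT.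
  have [l _ Gl] : (\bigcup_k G k) (uncons x).2 by rewrite -GT.
  exists (maxn k l) => //; split.
    by apply: (subsetPset _ _ (ndF _ _ (leq_maxl k l))).
  by apply: (subsetPset _ _ (ndG _ _ (leq_maxr k l))).
move=> k; have [mFk Fkoo] := mF k; have [mGk Gkoo] := mG k; split.
  by rewrite -[X in measurable X]setTI; apply: muncons => //; exact: measurableX.
rewrite /lebesgue_rVS /pushforward -comp_preimage.
rewrite [X in X @^-1` _](_ : _ = id); last exact/funext.
by rewrite preimage_id product_measure1E// lte_mul_pinfty// ge0_fin_numE.
Qed.

HB.instance Definition _ := Measure_isSigmaFinite.Build _ _ _ (lebesgue_rVS mu)
  lebesgue_rVS_sigma_finite.

End lebesgue_rVS_measure.

Fixpoint lebesgue_rV_rec n : {sigma_finite_measure set 'rV[R]_n -> \bar R} :=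
  if n is n'.+1 then lebesgue_rVS (lebesgue_rV_rec n') else \d_(0 : 'rV[R]_0).

Definition lebesgue_rV {n} : set 'rV[R]_n -> \bar R := lebesgue_rV_rec n.
HB.instance Definition _ n := SigmaFiniteMeasure.on (@lebesgue_rV n).

End lebesgue_rV.

Section euclidean.
Context {R : realType} {n : nat}.
Implicit Types (x y xi : 'rV[R]_n) (f g : 'rV[R]_n -> R[i]).

Definition dotp x y : R := \sum_i x ord0 i * y ord0 i.

Definition enorm x : R := Num.sqrt (dotp x x).

Definition partials (s : seq 'I_n) (u : 'rV[R]_n -> R) : 'rV[R]_n -> R :=
  foldr (fun i v x => 'D_(delta_mx ord0 i) v x) u s.

(* 'D_v is total, hence the explicit derivability requirement. *)
Definition smooth_real (u : 'rV[R]_n -> R) :=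
  forall s, continuous (partials s u) /\
    forall i x, derivable (partials s u) x (delta_mx ord0 i).

Definition smooth f := smooth_real (@complex.Re R \o f) /\ smooth_real (@complex.Im R \o f).

Definition cpartials (s : seq 'I_n) f x : R[i] :=
  partials s (@complex.Re R \o f) x +i* partials s (@complex.Im R \o f) x.

Definition supp f : set 'rV[R]_n := closure [set x | f x != 0].

Definition test_function f := smooth f /\ compact (supp f).

Definition schwartz f := smooth f /\
  forall (k : nat) (s : seq 'I_n), exists C : R,
    forall x, (1 + enorm x) ^+ k * Normc.normc (cpartials s f x) <= C.

Definition cintegral f : R[i] :=
  (\int[lebesgue_rV]_x complex.Re (f x)) +i* (\int[lebesgue_rV]_x complex.Im (f x)).

Definition cnorm_Lp (p : \bar R) f : \bar R :=
  Lnorm lebesgue_rV p (fun x => (Normc.normc (f x))%:E).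

Definition expi (t : R) : R[i] := cos t +i* sin t.

Definition fourier f xi : R[i] :=
  cintegral (fun x => expi (- dotp xi x) * f x).

(* kappa(D); the factor (2 pi)^-n comes from the unnormalised transform above. *)
Definition multiplier (kappa : 'rV[R]_n -> R[i]) f x : R[i] :=
  ((2 * pi) ^- n)%:C *
  cintegral (fun xi => expi (dotp x xi) * kappa xi * fourier f xi).

Definition wave_multiplier (kappa : 'rV[R]_n -> R[i]) (j : nat) f :=
  multiplier (fun xi => expi (enorm xi) * kappa (2 ^- j *: xi)) f.

Definition dilation (t : R) f x : R[i] := (t ^- n)%:C * f (t^-1 *: x).

Definition convolution f g x : R[i] := cintegral (fun y => f (x - y) * g y).

Definition maximal_function (Phi h : 'rV[R]_n -> R[i]) x : \bar R :=
  ereal_sup [set (Normc.normc (convolution (dilation t Phi) h x))%:E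
            | t in [set t : R | 0 < t]].

(* The maximal-function norm of the real Hardy space H^1 relative to an
   auxiliary Schwartz function Phi of nonzero integral; any two such Phi give
   equivalent norms. *)
Definition hardy_norm (Phi h : 'rV[R]_n -> R[i]) : \bar R :=
  Lnorm lebesgue_rV 1%E (maximal_function Phi h).

End euclidean.

(* Main.v *)
(* The inequality is tested on a Knapp-type family at frequency L = 2^j. Let x run over a
   grid, of spacing comparable to L^(-1/2), in a small cap of the unit sphere, and let s, s'
   run over a grid of small numbers with the same spacing. Gaussian packets of spatial width
   L^(-1/2) and of frequencies L (e + s x) and L (-e + s' x), for a fixed unit vector e, are
   placed so that the half-wave flow brings all of them to the point x. The initial centres
   are L^(-1/2)-separated, so that the sum f of the first packets and the sum g of the second
   ones, with a sign attached to each x, are bounded independently of L. For h take a Gaussian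
   atom of width 1/L, whose Hardy norm is bounded too, and whose wave lives near the unit
   sphere. The frequencies of a pair of packets attached to the same x add up to L (s + s') x,
   normal to the sphere at x, so that the product of the two waves and of the wave of h has a
   nonoscillating part, of integral bounded below against a wide Gaussian. With a suitable
   choice of the signs the contributions of packets attached to different points do no harm.
   There are about (L^(1/2))^(n+1) triples (x, s, s'), whence 2^(j m) 2^(j (n+1)/2) is
   bounded. *)
Require Import Defs.
From mathcomp Require Import all_boot all_order all_algebra.
From mathcomp Require Import complex.
From mathcomp Require Import all_classical all_reals all_analysis.
From mathcomp Require Import measurable_realfun ess_sup_inf ring lra.
Import Order.TTheory GRing.Theory Num.Theory.
Import numFieldNormedType.Exports.
Local Open Scope classical_set_scope.
Local Open Scope ring_scope.
Set Implicit Arguments.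
Unset Strict Implicit.
Unset Printing Implicit Defensive.

(** The Euclidean norm differs from its linearisation at [xi0] by at most [dotp (xi - xi0) (xi -
    xi0) / (2 * enorm xi0)]. So on a ball of radius [mu] around a frequency of size [L] the
    half-wave flow is a translation up to a phase error of order [mu ^+ 2 / L], and [mu] can be a
    small multiple of L^(1/2). Every loss is brought to the form [(1 + quad) / L], and the
    polynomial [quad] is absorbed by half of the Gaussian exponents. The vector e is what separates
    the centres: a centre depends only on the direction of its frequency, and for frequencies
    parallel to x a change of s would alter nothing but the length. In a pair the two copies of e
    cancel. No stationary phase is used. By duality the tested product becomes an absolutely
    convergent integral over three frequencies with a Gaussian in their sum, where the integrand is
    compared pointwise with explicit Gaussians. The atom is a second difference because its
    transform is then nonnegative, zero at the origin as H^1 requires, and bounded below at the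
    frequencies that matter. *)

Section complex_basics.
Context {R : realType}.
Implicit Types (z w : R[i]).
Local Notation normc := (@Normc.normc R).

Lemma complex_eta z : z = (complex.Re z +i* complex.Im z)%C.
Proof. by case: z. Qed.

Lemma ReD z w : complex.Re (z + w) = complex.Re z + complex.Re w.
Proof. by case: z; case: w. Qed.

Lemma ImD z w : complex.Im (z + w) = complex.Im z + complex.Im w.
Proof. by case: z; case: w. Qed.

Lemma ReM z w :
  complex.Re (z * w) = complex.Re z * complex.Re w - complex.Im z * complex.Im w.
Proof. by case: z; case: w. Qed.

Lemma ImM z w :
  complex.Im (z * w) = complex.Re z * complex.Im w + complex.Im z * complex.Re w.
Proof. by case: z; case: w. Qed.

Lemma normc_sqr z : normc z ^+ 2 = complex.Re z ^+ 2 + complex.Im z ^+ 2.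
Proof. by case: z => a b; rewrite /Normc.normc sqr_sqrtr// addr_ge0 ?sqr_ge0. Qed.

Lemma normc_ge0 z : 0 <= normc z.
Proof. by case: z => a b; exact: sqrtr_ge0. Qed.

Lemma normc_real (a : R) : normc a%:C%C = `|a|.
Proof. by rewrite /Normc.normc/= expr0n/= addr0 sqrtr_sqr. Qed.

Lemma le_Re_normc z : `|complex.Re z| <= normc z.
Proof.
case: z => a b; rewrite /Normc.normc/= -sqrtr_sqr ler_sqrt ?lerDl ?sqr_ge0//.
by rewrite addr_ge0// sqr_ge0.
Qed.

Lemma le_Im_normc z : `|complex.Im z| <= normc z.
Proof.
case: z => a b; rewrite /Normc.normc/= -sqrtr_sqr ler_sqrt ?lerDr ?sqr_ge0//.
by rewrite addr_ge0// sqr_ge0.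
Qed.

Lemma normc_le_ReIm z : normc z <= `|complex.Re z| + `|complex.Im z|.
Proof.
rewrite -(@ler_pXn2r _ 2)// ?nnegrE ?normc_ge0 ?addr_ge0// normc_sqr.
rewrite sqrrD !real_normK ?num_real// addrAC lerDl.
by rewrite mulrn_wge0// mulr_ge0.
Qed.

Lemma normcD z w : normc (z + w) <= normc z + normc w.
Proof. exact: le_normcD. Qed.

Lemma normcB z w : normc (z - w) <= normc z + normc w.
Proof. by rewrite -(normcN w); exact: le_normcD. Qed.

Lemma normc_sum I (r : seq I) (P : pred I) (F : I -> R[i]) :
  normc (\sum_(i <- r | P i) F i) <= \sum_(i <- r | P i) normc (F i).
Proof.
elim/big_rec2 : _ => [|i y1 y2 _ h]; first by rewrite Normc.normc0.
by rewrite (le_trans (normcD _ _))// lerD2l.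
Qed.

Lemma normc_prod I (r : seq I) (P : pred I) (F : I -> R[i]) :
  normc (\prod_(i <- r | P i) F i) = \prod_(i <- r | P i) normc (F i).
Proof. exact: (big_morph _ (@Normc.normcM R) (@Normc.normc1 R)). Qed.

Lemma Re_sum I (r : seq I) (P : pred I) (F : I -> R[i]) :
  complex.Re (\sum_(i <- r | P i) F i) = \sum_(i <- r | P i) complex.Re (F i).
Proof. exact: (big_morph _ ReD). Qed.

Lemma normc_expi (t : R) : normc (expi t) = 1.
Proof. by rewrite /Normc.normc/= cos2Dsin2 sqrtr1. Qed.

Lemma expiD (s t : R) : expi (s + t) = expi s * expi t.
Proof.
rewrite /expi cosD sinD; apply/eqP; rewrite eq_complex/= eqxx/=.
by rewrite addrC (mulrC (sin s)) (mulrC (cos s) (sin t)) (mulrC (sin t)).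
Qed.

Lemma expi0 : expi (0 : R) = 1.
Proof. by rewrite /expi cos0 sin0. Qed.

Lemma expi_sum I (r : seq I) (F : I -> R) :
  expi (\sum_(i <- r) F i) = \prod_(i <- r) expi (F i).
Proof. exact: (big_morph _ expiD expi0). Qed.

Lemma normsin_le (t : R) : `|sin t| <= `|t|.
Proof.
wlog t0 : t / 0 <= t.
  move=> h; have [/h//|t0] := leP 0 t.
  by rewrite -normrN -sinN -(normrN t); apply: h; rewrite oppr_ge0 ltW.
have [->|tn0] := eqVneq t 0; first by rewrite sin0.
have {tn0}t0' : 0 < t by rewrite lt_neqAle eq_sym tn0.
have cs : {within `[0, t], continuous (@sin R)}.
  by apply: continuous_subspaceT => x; exact: continuous_sin.
have [c _] := MVT t0' (fun x _ => is_derive_sin x) cs.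
rewrite sin0 !subr0 => ->; rewrite normrM ler_piMl//.
by rewrite ler_norml cos_geN1 cos_le1.
Qed.

(** Half-angle formula: with [t = 2 * s] the left side is twice the square of [sin s]; one factor is
    bounded by 1, the other by [|s|]. *)
Lemma cos_dist_le (t : R) : 1 - cos t <= `|t|.
Proof.
rewrite [t]splitr; move: (t / 2) => {}t; rewrite cosD.
have : cos t * cos t = 1 - sin t * sin t by rewrite -!expr2 cos2sin2.
have : `|sin t| ^+ 2 = sin t * sin t by rewrite real_normK ?num_real// expr2.
have : `|sin t| <= 1 by rewrite ler_norml sin_geN1 sin_le1.
have := normsin_le t; rewrite -mulr2n normrMn.
have := normr_ge0 (sin t).
move: `|sin t| `|t| (sin t * sin t) (cos t * cos t) => a b u v.
nra.
Qed.

Lemma expi_dist (t : R) : normc (expi t - 1) <= 2 * `|t|.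
Proof.
rewrite (le_trans (normc_le_ReIm _))//= mulr_natl mulr2n lerD//=; last first.
  by rewrite subr0 normsin_le.
by rewrite distrC ger0_norm ?cos_dist_le// subr_ge0 cos_le1.
Qed.

End complex_basics.

(** Has the body of [cintegral] for an arbitrary measure: results on it apply to [cintegral] and
    [ext] by conversion, and they also cover the integrals over the line and over products. *)
Definition cint d (T : measurableType d) {R : realType} (mu : {measure set T -> \bar R})
    (f : T -> R[i]) : R[i] :=
  (Rintegral mu setT (fun x => complex.Re (f x)) +i*
   Rintegral mu setT (fun x => complex.Im (f x)))%C.

(** * Measurability, integrability and linearity for complex-valued functions *)

Section cint.
Context d (T : measurableType d) {R : realType}.
Variable mu : {measure set T -> \bar R}.
Local Notation normc := (@Normc.normc R).
Implicit Types (f g : T -> R[i]).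

Definition cmeas f :=
  measurable_fun setT (fun x => complex.Re (f x)) /\
  measurable_fun setT (fun x => complex.Im (f x)).

Definition cintegrable f :=
  mu.-integrable setT (fun x => (complex.Re (f x))%:E) /\
  mu.-integrable setT (fun x => (complex.Im (f x))%:E).

Lemma cmeasD f g : cmeas f -> cmeas g -> cmeas (fun x => f x + g x).
Proof.
move=> [f1 f2] [g1 g2]; split.
- by under eq_fun do rewrite ReD; exact: measurable_funD.
- by under eq_fun do rewrite ImD; exact: measurable_funD.
Qed.

Lemma cmeasM f g : cmeas f -> cmeas g -> cmeas (fun x => f x * g x).
Proof.
move=> [f1 f2] [g1 g2]; split.
- by under eq_fun do rewrite ReM; apply: measurable_funB; exact: measurable_funM.
- by under eq_fun do rewrite ImM; apply: measurable_funD; exact: measurable_funM.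
Qed.

Lemma cmeas_cst z : cmeas (cst z).
Proof. by split; exact: measurable_cst. Qed.

Lemma cmeas_sum I (r : seq I) (F : I -> T -> R[i]) :
  (forall i, cmeas (F i)) -> cmeas (fun x => \sum_(i <- r) F i x).
Proof.
move=> mF; elim: r => [|i r ih].
  by under eq_fun do rewrite big_nil; exact: cmeas_cst.
by under eq_fun do rewrite big_cons; exact: cmeasD.
Qed.

Lemma cmeas_real (f : T -> R) : measurable_fun setT f -> cmeas (fun x => (f x)%:C%C).
Proof. by move=> mf; split => //=; exact: measurable_cst. Qed.

Lemma cmeas_expi (f : T -> R) : measurable_fun setT f -> cmeas (fun x => expi (f x)).
Proof.
move=> mf; split => /=.
- by apply: measurableT_comp => //; apply: continuous_measurable_fun; exact: continuous_cos.
- by apply: measurableT_comp => //; apply: continuous_measurable_fun; exact: continuous_sin.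
Qed.

Lemma cmeas_normc f : cmeas f -> measurable_fun setT (fun x => normc (f x)).
Proof.
move=> [f1 f2].
rewrite (_ : (fun x => _) = (fun x => Num.sqrt (complex.Re (f x) ^+ 2 + complex.Im (f x) ^+ 2))).
  apply: measurableT_comp => //.
    by apply: continuous_measurable_fun; exact: sqrt_continuous.
  by apply: measurable_funD; exact: measurable_funX.
by apply/funext => x; case: (f x).
Qed.

Lemma cintegrable_cmeas f : cintegrable f -> cmeas f.
Proof. by move=> [/measurable_int/measurable_EFinP ? /measurable_int/measurable_EFinP ?]. Qed.

Lemma cintegrable_le f (g : T -> R) : cmeas f -> (forall x, normc (f x) <= g x) ->
  mu.-integrable setT (EFin \o g) -> cintegrable f.
Proof.
move=> [f1 f2] fg ig; split; apply: le_integrable ig => //; try exact/measurable_EFinP.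
- move=> x _; rewrite lee_fin (le_trans (le_Re_normc _))// (le_trans (fg x))//.
  exact: ler_norm.
- move=> x _; rewrite lee_fin (le_trans (le_Im_normc _))// (le_trans (fg x))//.
  exact: ler_norm.
Qed.

Lemma cintegrable_normc f : cintegrable f ->
  mu.-integrable setT (fun x => (normc (f x))%:E).
Proof.
move=> cf; have [f1 f2] := cf; have mf := cintegrable_cmeas cf.
apply: (@le_integrable _ _ _ _ _ measurableT _
  (fun x => (`|complex.Re (f x)| + `|complex.Im (f x)|)%:E)).
- exact/measurable_EFinP/cmeas_normc.
- move=> x _; rewrite lee_fin ger0_norm ?normc_ge0//.
  by rewrite (le_trans (normc_le_ReIm _))// ler_norm.
- have := integrableD measurableT (integrable_norm f1) (integrable_norm f2).
  by apply: eq_integrable.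
Qed.

Lemma cintegrableD f g : cintegrable f -> cintegrable g ->
  cintegrable (fun x => f x + g x).
Proof.
move=> cf cg; apply: (@cintegrable_le _ (fun x => normc (f x) + normc (g x))).
- by apply: cmeasD; exact: cintegrable_cmeas.
- by move=> x; exact: normcD.
- exact: (integrableD measurableT (cintegrable_normc cf) (cintegrable_normc cg)).
Qed.

Lemma cintegrableZ z f : cintegrable f -> cintegrable (fun x => z * f x).
Proof.
move=> cf; apply: (@cintegrable_le _ (fun x => normc z * normc (f x))).
- by apply: cmeasM; [exact: cmeas_cst|exact: cintegrable_cmeas].
- by move=> x; rewrite Normc.normcM.
- exact: (integrableZl measurableT (normc z) (cintegrable_normc cf)).
Qed.

Lemma cintegrable_sum I (r : seq I) (F : I -> T -> R[i]) :
  (forall i, cintegrable (F i)) -> cintegrable (fun x => \sum_(i <- r) F i x).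
Proof.
move=> mF; elim: r => [|i r ih].
  under eq_fun do rewrite big_nil.
  by split; exact: integrable0.
by under eq_fun do rewrite big_cons; exact: cintegrableD.
Qed.

Lemma cintD f g : cintegrable f -> cintegrable g ->
  cint mu (fun x => f x + g x) = cint mu f + cint mu g.
Proof.
move=> [f1 f2] [g1 g2]; rewrite /cint.
under [in LHS]eq_Rintegral do rewrite ReD.
under [X in (_ +i* X)%C = _]eq_Rintegral do rewrite ImD.
by rewrite !RintegralD.
Qed.

Lemma cintZ z f : cintegrable f -> cint mu (fun x => z * f x) = z * cint mu f.
Proof.
move=> [f1 f2]; case: z => a b; rewrite /cint.
under [in LHS]eq_Rintegral do rewrite ReM.
under [X in (_ +i* X)%C = _]eq_Rintegral do rewrite ImM.
have h1 k := integrableZl measurableT k f1.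
have h2 k := integrableZl measurableT k f2.
by rewrite RintegralB ?RintegralD ?RintegralZl//=; (exact: h1 || exact: h2).
Qed.

Lemma cint_sum I (r : seq I) (F : I -> T -> R[i]) :
  (forall i, cintegrable (F i)) ->
  cint mu (fun x => \sum_(i <- r) F i x) = \sum_(i <- r) cint mu (F i).
Proof.
move=> mF; elim: r => [|i r ih].
  rewrite big_nil /cint.
  under [in LHS]eq_Rintegral do rewrite big_nil.
  under [X in (_ +i* X)%C = _]eq_Rintegral do rewrite big_nil.
  by rewrite /Rintegral integral0/=.
rewrite big_cons -ih -cintD//; last exact: cintegrable_sum.
by congr cint; apply/funext => x; rewrite big_cons.
Qed.

(** The integral is rotated onto the real axis: multiplied by its conjugate [z] it becomes its
    squared modulus, which is the real part of an integral. Treating real and imaginary parts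
    separately would lose a factor. *)
Lemma normc_cint_le f (g : T -> R) : cmeas f -> (forall x, normc (f x) <= g x) ->
  mu.-integrable setT (EFin \o g) -> normc (cint mu f) <= Rintegral mu setT g.
Proof.
move=> mf fg ig; have cf := cintegrable_le mf fg ig.
have [->|n0] := eqVneq (cint mu f) 0.
  rewrite Normc.normc0; apply: Rintegral_ge0 => x _.
  by rewrite (le_trans _ (fg x))// normc_ge0.
have N0 : 0 < normc (cint mu f).
  by rewrite lt_neqAle normc_ge0 andbT eq_sym; apply: contra n0 => /eqP/Normc.eq0_normc ->.
set z := (complex.Re (cint mu f) -i* complex.Im (cint mu f))%C.
have zE : normc z = normc (cint mu f) by rewrite /z; case: (cint mu f) => a b/=; rewrite sqrrN.
have : normc (cint mu f) ^+ 2 = complex.Re (cint mu (fun x => z * f x)).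
  rewrite cintZ// normc_sqr /z; case: (cint mu f) => a b/=; ring.
move=> /esym e.
rewrite -(@ler_pM2l _ (normc (cint mu f)))// -expr2 -e /= -RintegralZl//.
apply: le_Rintegral => //.
- by have [] := cintegrableZ z cf.
- exact: (integrableZl measurableT (normc (cint mu f)) ig).
move=> x _; rewrite (le_trans (ler_norm _))// (le_trans (le_Re_normc _))//.
by rewrite Normc.normcM zE ler_wpM2l// ltW.
Qed.

End cint.

(** * Fubini for kernels dominated by a product of integrable functions *)

Section cfubini.
Context d1 d2 (T1 : measurableType d1) (T2 : measurableType d2) {R : realType}.
Variable m1 : {sigma_finite_measure set T1 -> \bar R}.
Variable m2 : {sigma_finite_measure set T2 -> \bar R}.
Local Notation normc := (@Normc.normc R).

Section real.
Variables (f : T1 -> T2 -> R) (A : T1 -> R) (B : T2 -> R).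
Hypothesis mf : measurable_fun setT (fun p : T1 * T2 => f p.1 p.2).
Hypothesis fAB : forall x y, `|f x y| <= A x * B y.
Hypothesis iA : m1.-integrable setT (EFin \o A).
Hypothesis iB : m2.-integrable setT (EFin \o B).

Lemma dominated_section x : m2.-integrable setT (fun y => (f x y)%:E).
Proof.
have iAB := integrableZl measurableT (A x) iB.
apply: le_integrable iAB => //.
- apply/measurable_EFinP; have := measurableT_comp mf (pair1_measurable x).
  exact.
- by move=> y _; rewrite lee_fin (le_trans (fAB x y))// ler_norm.
Qed.

(** Tonelli: the absolute value integrates to at most the product of the L^1 norms of [A] and
    [B]. *)
Lemma dominated_prod : (m1 \x m2)%E.-integrable setT (fun p => (f p.1 p.2)%:E).
Proof.
apply/integrable12ltyP; first exact/measurable_EFinP.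
have mB : measurable_fun setT (fun y => `|B y|%:E).
  by apply/measurable_EFinP/measurableT_comp => //; exact/measurable_EFinP/(measurable_int _ iB).
have /integrableP[_ iB'] := iB; have /integrableP[mA' iA'] := iA.
apply: (@le_lt_trans _ _ (\int[m1]_x (`|A x|%:E * \int[m2]_y `|B y|%:E))%E).
  apply: ge0_le_integral => //.
  - by move=> x _; exact: integral_ge0.
  - apply: (measurable_fun_fubini_tonelli_F (fun p => `|(f p.1 p.2)%:E|%E)) => //.
    by apply: measurableT_comp => //; exact/measurable_EFinP.
  - apply: emeasurable_funM; last exact: measurable_cst.
    by apply/measurable_EFinP/measurableT_comp => //; exact/measurable_EFinP.
  move=> x _; rewrite -ge0_integralZl//.
  apply: ge0_le_integral => //=.
  - apply/measurable_EFinP; apply: measurableT_comp => //.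
    exact: (measurableT_comp mf (pair1_measurable x)).
  - by apply: measurable_funeM.
  by move=> y _; rewrite lee_fin (le_trans (fAB x y))// (le_trans (ler_norm _))// normrM.
have mA : measurable_fun setT (fun x => `|A x|%:E).
  by apply/measurable_EFinP/measurableT_comp => //; exact/measurable_EFinP.
have B0 : (0 <= \int[m2]_y `|B y|%:E)%E by exact: integral_ge0.
rewrite ge0_integralZr// lte_mul_pinfty//; first exact: integral_ge0.
by rewrite ge0_fin_numE//; exact: integral_ge0.
Qed.

Lemma dominated_Rintegral_meas : measurable_fun setT (fun x => \int[m2]_y f x y).
Proof.
apply/measurable_EFinP; have := measurable_fubini_F dominated_prod.
apply: eq_measurable_fun => x _ /=; rewrite fineK//; apply: integrable_fin_num => //.
exact: dominated_section.
Qed.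

End real.

Lemma dominated_Rfubini (f : T1 -> T2 -> R) (A : T1 -> R) (B : T2 -> R) :
  measurable_fun setT (fun p : T1 * T2 => f p.1 p.2) ->
  (forall x y, `|f x y| <= A x * B y) ->
  m1.-integrable setT (EFin \o A) -> m2.-integrable setT (EFin \o B) ->
  \int[m1]_x \int[m2]_y f x y = \int[m2]_y \int[m1]_x f x y.
Proof.
move=> mf fAB iA iB.
have e1 x : ((\int[m2]_y f x y)%:E = \int[m2]_y (f x y)%:E)%E.
  rewrite /Rintegral fineK//; apply: integrable_fin_num => //.
  exact: (dominated_section mf fAB).
have e2 y : ((\int[m1]_x f x y)%:E = \int[m1]_x (f x y)%:E)%E.
  rewrite /Rintegral fineK//; apply: integrable_fin_num => //.
  have iAB := integrableZr measurableT (B y) iA.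
  apply: le_integrable iAB => //.
  - apply/measurable_EFinP.
    exact: (measurableT_comp mf (pair2_measurable y)).
  - by move=> x _; rewrite lee_fin (le_trans (fAB x y))// ler_norm.
congr fine.
under eq_integral do rewrite e1.
under [RHS]eq_integral do rewrite e2.
exact: (@Fubini _ _ _ _ _ m1 m2 _ (dominated_prod mf fAB iA iB)).
Qed.

Variables (f : T1 -> T2 -> R[i]) (A : T1 -> R) (B : T2 -> R).
Hypothesis mf : cmeas (fun p : T1 * T2 => f p.1 p.2).
Hypothesis fAB : forall x y, normc (f x y) <= A x * B y.
Hypothesis iA : m1.-integrable setT (EFin \o A).
Hypothesis iB : m2.-integrable setT (EFin \o B).

Let reAB x y : `|complex.Re (f x y)| <= A x * B y.
Proof. exact: le_trans (le_Re_normc _) (fAB x y). Qed.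
Let imAB x y : `|complex.Im (f x y)| <= A x * B y.
Proof. exact: le_trans (le_Im_normc _) (fAB x y). Qed.

Lemma cint_fubini :
  cint m1 (fun x => cint m2 (f x)) = cint m2 (fun y => cint m1 (f^~ y)).
Proof.
by have [f1 f2] := mf; congr (_ +i* _)%C => /=;
  [exact: (dominated_Rfubini f1 reAB iA iB)|exact: (dominated_Rfubini f2 imAB iA iB)].
Qed.

Lemma cmeas_cint : cmeas (fun x => cint m2 (f x)).
Proof.
have [f1 f2] := mf; split => /=.
- exact: (dominated_Rintegral_meas f1 reAB).
- exact: (dominated_Rintegral_meas f2 imAB).
Qed.

Lemma cint_prod :
  cint (m1 \x m2)%E (fun p => f p.1 p.2) = cint m1 (fun x => cint m2 (f x)).
Proof.
have [f1 f2] := mf; congr (_ +i* _)%C => /=; rewrite /Rintegral.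
- rewrite -integral12_prod_meas1; last exact: (dominated_prod f1 reAB).
  congr fine; apply: eq_integral => x _ /=; rewrite fineK//.
  by apply: integrable_fin_num => //; exact: (dominated_section f1 reAB).
- rewrite -integral12_prod_meas1; last exact: (dominated_prod f2 imAB).
  congr fine; apply: eq_integral => x _ /=; rewrite fineK//.
  by apply: integrable_fin_num => //; exact: (dominated_section f2 imAB).
Qed.

End cfubini.

(** * Integrals against pushforwards, and changes of variables *)

Section push.
Context d1 d2 d3 (T1 : measurableType d1) (T2 : measurableType d2)
  (T3 : measurableType d3) {R : realType}.
Variables (m1 : {sigma_finite_measure set T1 -> \bar R})
  (m2 : {sigma_finite_measure set T2 -> \bar R}) (phi : T1 * T2 -> T3).
Hypothesis mphi : measurable_fun setT phi.

(** In dimension [n.+1] Lebesgue measure is by construction such a pushforward, of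
    [lebesgue_rV_rec n] and the measure of the line under [rV_cons]. The abstract form keeps row
    vectors out of the measure theory. *)
Lemma ge0_integral_push_prod (f : T3 -> \bar R) :
  measurable_fun setT f -> (forall x, 0 <= f x)%E ->
  (\int[pushforward (m1 \x m2) phi]_z f z = \int[m1]_x \int[m2]_y f (phi (x, y)))%E.
Proof.
move=> mf f0; rewrite ge0_integral_pushforward//= preimage_setT fubini_tonelli1//.
exact: measurableT_comp mphi.
Qed.

Lemma measurable_push_prod (f : T3 -> \bar R) :
  measurable_fun setT f -> (forall x, 0 <= f x)%E ->
  measurable_fun setT (fun x => \int[m2]_y f (phi (x, y)))%E.
Proof.
move=> mf f0; apply: (measurable_fun_fubini_tonelli_F (f \o phi)).
- exact: measurableT_comp mphi.
- by move=> x; exact: f0.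
Qed.

Lemma cint_push_prod (f : T3 -> R[i]) (A : T1 -> R) (B : T2 -> R) :
  cmeas f -> (forall x y, Normc.normc (f (phi (x, y))) <= A x * B y) ->
  m1.-integrable setT (EFin \o A) -> m2.-integrable setT (EFin \o B) ->
  (fine (\int[pushforward (m1 \x m2)%E phi]_z (complex.Re (f z))%:E) +i*
   fine (\int[pushforward (m1 \x m2)%E phi]_z (complex.Im (f z))%:E))%C =
  cint m1 (fun x => cint m2 (fun y => f (phi (x, y)))).
Proof.
move=> [f1 f2] fAB iA iB.
pose g x y := f (phi (x, y)).
have phiE (p : T1 * T2) : phi (p.1, p.2) = phi p by case: p.
have mg1 : measurable_fun setT (fun p : T1 * T2 => complex.Re (g p.1 p.2)).
  rewrite /g; under eq_fun do rewrite phiE.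
  exact: (measurableT_comp f1 mphi).
have mg2 : measurable_fun setT (fun p : T1 * T2 => complex.Im (g p.1 p.2)).
  rewrite /g; under eq_fun do rewrite phiE.
  exact: (measurableT_comp f2 mphi).
rewrite -(@cint_prod _ _ _ _ _ m1 m2 g A B (conj mg1 mg2) fAB iA iB).
have g1 x y : `|complex.Re (g x y)| <= A x * B y by exact: le_trans (le_Re_normc _) (fAB x y).
have g2 x y : `|complex.Im (g x y)| <= A x * B y by exact: le_trans (le_Im_normc _) (fAB x y).
have i1 := dominated_prod mg1 g1 iA iB.
have i2 := dominated_prod mg2 g2 iA iB.
rewrite /cint /Rintegral; congr (fine _ +i* fine _)%C.
- rewrite integral_pushforward//=.
  + by rewrite preimage_setT; apply: eq_integral => p _; rewrite /= -phiE.
  + exact/measurable_EFinP.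
  + by rewrite preimage_setT; apply: eq_integrable i1 => // p _ /=; rewrite -phiE.
- rewrite integral_pushforward//=.
  + by rewrite preimage_setT; apply: eq_integral => p _; rewrite /= -phiE.
  + exact/measurable_EFinP.
  + by rewrite preimage_setT; apply: eq_integrable i2 => // p _ /=; rewrite -phiE.
Qed.

End push.

Section comp_scaled.
Context d (T : measurableType d) {R : realType}.
Variables (mu : {measure set T -> \bar R}) (phi : T -> T) (k : R).
Hypothesis k0 : 0 <= k.
Hypothesis kphi : forall f, measurable_fun setT f -> (forall x, 0 <= f x)%E ->
  (\int[mu]_x f (phi x) = k%:E * \int[mu]_x f x)%E.

(** [kphi] speaks of nonnegative functions only; it is applied to the positive and the negative
    part, whose integrals are finite. *)
Lemma Rintegral_comp_scaled (g : T -> R) : mu.-integrable setT (EFin \o g) ->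
  \int[mu]_x g (phi x) = k * \int[mu]_x g x.
Proof.
move=> ig; have mg := measurable_int _ ig.
rewrite /Rintegral integralE [in RHS]integralE.
set gp := (fun x => (g x)%:E)^\+%E; set gm := (fun x => (g x)%:E)^\-%E.
transitivity (fine (\int[mu]_x gp (phi x) - \int[mu]_x gm (phi x))%E).
  by congr (fine (_ - _)%E); apply: eq_integral => x _; rewrite /gp /gm ?funeposE ?funenegE.
have mgp : measurable_fun setT gp by exact: measurable_funepos.
have mgm : measurable_fun setT gm by exact: measurable_funeneg.
have gp0 x : (0 <= gp x)%E by exact: funepos_ge0.
have gm0 x : (0 <= gm x)%E by exact: funeneg_ge0.
rewrite !kphi//.
have f_p := integrable_pos_fin_num measurableT ig.
have f_m := integrable_neg_fin_num measurableT ig.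
rewrite -muleBr//; last exact: fin_num_adde_defr.
by rewrite fineM//= fin_numB f_p f_m.
Qed.

Lemma integrable_comp_scaled (g : T -> R) : measurable_fun setT phi ->
  mu.-integrable setT (EFin \o g) -> mu.-integrable setT (fun x => (g (phi x))%:E).
Proof.
move=> mphi /integrableP[mg ig]; apply/integrableP; split.
  exact: (measurableT_comp mg mphi).
rewrite (kphi (f := fun x => `|(g x)%:E|%E))//; last exact: measurableT_comp.
by rewrite lte_mul_pinfty.
Qed.

End comp_scaled.

(** * Lebesgue integration on R^n: slicing, affine substitutions, product functions *)

Section rV_integral.
Context {R : realType}.
Local Notation normc := (@Normc.normc R).
Local Notation leb := (@lebesgue_measure R).

Lemma rV_cons0 n (p : 'rV[R]_n * R) : rV_cons p ord0 ord0 = p.2.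
Proof.
rewrite (_ : ord0 = @lshift 1 n ord0 :> 'I_n.+1); last exact/val_inj.
exact: etrans (row_mxEl _ _ _ _) (mxE _ _ _ _).
Qed.

Lemma rV_consS n (p : 'rV[R]_n * R) i : rV_cons p ord0 (lift ord0 i) = p.1 ord0 i.
Proof.
rewrite (_ : lift ord0 i = @rshift 1 n i :> 'I_n.+1); last exact/val_inj.
exact: row_mxEr.
Qed.

Lemma measurable_rV_consR n :
  measurable_fun (setT : set ('rV[R]_n * measurableTypeR R)) (@rV_cons R n).
Proof. exact: measurable_rV_cons. Qed.

Lemma ge0_integral_rVS n (f : 'rV[R]_n.+1 -> \bar R) :
  measurable_fun setT f -> (forall x, 0 <= f x)%E ->
  (\int[lebesgue_rV]_x f x = \int[lebesgue_rV]_y \int[leb]_r f (rV_cons (y, r)))%E.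
Proof.
exact (@ge0_integral_push_prod _ _ _ _ (measurableTypeR R) _ R
  (lebesgue_rV_rec n) leb _ (@measurable_rV_consR n) f).
Qed.

Lemma measurable_rV_affine n (a : R) (b : 'rV[R]_n) :
  measurable_fun setT (fun x : 'rV[R]_n => a *: x + b).
Proof.
apply: measurable_fun_rVP => i.
rewrite (_ : _ \o _ = fun x => a * rV_coord i x + rV_coord i b); last first.
  by apply/funext => x; rewrite /rV_coord/= !mxE.
apply: measurable_funD; last exact: measurable_cst.
apply: measurable_funM; [exact: measurable_cst|exact: measurable_rV_coord].
Qed.

(** Uniqueness of Lebesgue measure: [|a|] times its image under the affine map gives every half-open
    interval its length. For [a < 0] the preimage of []x, y]] is closed at the other end, which does
    not change its measure. *)
Lemma ge0_integral_affine1 (a b : R) (f : R -> \bar R) : a != 0 ->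
  measurable_fun setT f -> (forall x, 0 <= f x)%E ->
  (\int[leb]_r f (a * r + b)%R = (`|a|^-1)%:E * \int[leb]_r f r)%E.
Proof.
move=> a0 mf f0.
pose phi (r : R) : measurableTypeR R := a * r + b.
have mphi : measurable_fun [set: measurableTypeR R] phi.
  by apply: measurable_funD => //; apply: measurable_funM.
have ka : 0 <= `|a| by [].
pose nu : {measure set (measurableTypeR R) -> \bar R} :=
  measure_function_pushforward__canonical__measure_function_Measure leb mphi.
pose mu := mscale (NngNum ka) nu.
have E A : measurable A -> leb A = mu A.
  apply: lebesgue_measure_unique => _ [[x y] /= xy <-].
  rewrite /mu/= /mscale/= /pushforward/= lebesgue_measure_itv/=.
  have [a_gt0|a_le0] := ltP 0 a.
    have -> : phi @^-1` `]x, y]%classic = `]((x - b) / a), ((y - b) / a)]%classic.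
      apply/seteqP; split => r /=; rewrite /phi !in_itv/= ltr_pdivrMr// ler_pdivlMr//;
        rewrite ltrBlDr lerBrDr (mulrC r); lra.
    rewrite lebesgue_measure_itv/= !lte_fin ltr_pM2r ?invr_gt0// ltrD2r.
    case: ifPn => h; last by rewrite mule0.
    rewrite -!EFinB -EFinM gtr0_norm//; congr EFin; field; lra.
  have a_lt0 : a < 0 by rewrite lt_neqAle a0.
  have -> : phi @^-1` `]x, y]%classic = `[((y - b) / a), ((x - b) / a)[%classic.
    apply/seteqP; split => r /=; rewrite /phi !in_itv/= ltr_ndivlMr// ler_ndivrMr//;
      rewrite ltrBlDr lerBrDr (mulrC r); lra.
  rewrite lebesgue_measure_itv/= !lte_fin ltr_nM2r ?invr_lt0// ltrD2r.
  case: ifPn => h; last by rewrite mule0.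
  rewrite -!EFinB -EFinM ltr0_norm//; congr EFin; field; lra.
rewrite [in RHS](eq_measure_integral mu); last by move=> A mA _; exact: E.
rewrite ge0_integral_mscale// ge0_integral_pushforward// muleA -EFinM/=.
by rewrite mulVf ?normr_eq0// mul1e.
Qed.

Lemma ge0_integral_affine n (a : R) (b : 'rV[R]_n) (f : 'rV[R]_n -> \bar R) : a != 0 ->
  measurable_fun setT f -> (forall x, 0 <= f x)%E ->
  (\int[lebesgue_rV]_x f (a *: x + b)%R = (`|a| ^- n)%:E * \int[lebesgue_rV]_x f x)%E.
Proof.
move=> a0; elim: n b f => [|n ih] b f mf f0.
  rewrite expr0 invr1 mul1e; apply: eq_integral => x _.
  by rewrite [x]thinmx0 [b]thinmx0 scaler0 addr0.
rewrite ge0_integral_rVS//; last first.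
  exact: (measurableT_comp mf (measurable_rV_affine a b)).
pose b' : 'rV[R]_n := \row_i b ord0 (lift ord0 i).
have e y r : a *: rV_cons (y, r) + b = rV_cons (a *: y + b', a * r + b ord0 ord0).
  apply/rowP => i; case: (unliftP ord0 i) => [j|] ->.
    by rewrite [LHS]mxE [X in X + _]mxE !rV_consS !mxE.
  by rewrite [LHS]mxE [X in X + _]mxE !rV_cons0.
under eq_integral do under eq_integral do rewrite e.
have mc := @measurable_rV_cons R n.
have mfc := measurableT_comp mf mc.
under eq_integral => y _.
  rewrite (@ge0_integral_affine1 a (b ord0 ord0) (fun r => f (rV_cons (a *: y + b', r))))//.
    over.
  exact: (measurableT_comp mfc (pair1_measurable _)).
have mF : measurable_fun setT (fun y => \int[leb]_r f (rV_cons (y, r)))%E.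
  exact (@measurable_push_prod _ _ _ _ (measurableTypeR R) _ R leb _
    (@measurable_rV_consR n) f mf f0).
have F0 y : (0 <= \int[leb]_r f (rV_cons (y, r)))%E by exact: integral_ge0.
rewrite ge0_integralZl//; last first.
  exact: (measurableT_comp mF (measurable_rV_affine a b')).
rewrite (ih b' (fun y => \int[leb]_r f (rV_cons (y, r)))%E)//.
by rewrite muleA -EFinM -ge0_integral_rVS// exprS invfM.
Qed.

Lemma cint_affine n (a : R) (b : 'rV[R]_n) (f : 'rV[R]_n -> R[i]) : a != 0 ->
  cintegrable lebesgue_rV f ->
  cintegral (fun x => f (a *: x + b)) = (`|a| ^- n)%:C%C * cintegral f.
Proof.
move=> a0 [f1 f2].
have H (g : 'rV[R]_n -> R) := @Rintegral_comp_scaled _ _ _ lebesgue_rV (fun x => a *: x + b)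
  (`|a| ^- n) (fun f mf f0 => @ge0_integral_affine n a b f a0 mf f0) g.
rewrite /cintegral (H (fun x => complex.Re (f x)))// (H (fun x => complex.Im (f x)))//.
by apply/eqP; rewrite eq_complex/= !mul0r subr0 addr0 !eqxx.
Qed.

Lemma Rintegral_affine1 (a b : R) (g : R -> R) : a != 0 ->
  leb.-integrable setT (EFin \o g) ->
  \int[leb]_x g (a * x + b) = `|a|^-1 * \int[leb]_x g x.
Proof.
move=> a0; apply: (@Rintegral_comp_scaled _ (measurableTypeR R) _ leb (fun x => a * x + b)) => f mf f0.
exact: ge0_integral_affine1.
Qed.

Lemma integrable_affine1 (a b : R) (g : R -> R) : a != 0 ->
  leb.-integrable setT (EFin \o g) ->
  leb.-integrable setT (fun x => (g (a * x + b))%:E).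
Proof.
move=> a0; apply: (@integrable_comp_scaled _ (measurableTypeR R) _ leb (fun x => a * x + b) (`|a|^-1)) => //.
  move=> f mf f0.
  exact: ge0_integral_affine1.
by apply: measurable_funD => //; exact: measurable_funM.
Qed.

Lemma integrable_affine n (a : R) (b : 'rV[R]_n) (g : 'rV[R]_n -> R) : a != 0 ->
  lebesgue_rV.-integrable setT (EFin \o g) ->
  lebesgue_rV.-integrable setT (fun x => (g (a *: x + b))%:E).
Proof.
move=> a0; apply: (@integrable_comp_scaled _ _ _ lebesgue_rV (fun x => a *: x + b) (`|a| ^- n)).
  by rewrite invr_ge0 exprn_ge0.
  move=> f mf f0.
  exact: ge0_integral_affine.
exact: measurable_rV_affine.
Qed.

Lemma lebesgue_rV0T : lebesgue_rV (setT : set 'rV[R]_0) = 1%E.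
Proof. by rewrite /lebesgue_rV/= diracT. Qed.

Lemma ge0_integral_prod n (F : 'I_n -> R -> R) (c : 'I_n -> R) :
  (forall i, measurable_fun setT (F i)) -> (forall i r, 0 <= F i r) ->
  (forall i, \int[leb]_r (F i r)%:E = (c i)%:E)%E ->
  (\int[lebesgue_rV]_x (\prod_(i < n) F i (x ord0 i))%R%:E = (\prod_(i < n) c i)%:E)%E.
Proof.
elim: n F c => [|n ih] F c mF F0 Fc.
  under eq_integral do rewrite big_ord0.
  rewrite big_ord0 integral_cst// mul1e.
  exact: lebesgue_rV0T.
have mprod m (G : 'I_m -> R -> R) : (forall i, measurable_fun setT (G i)) ->
    measurable_fun setT (fun x : 'rV[R]_m => \prod_(i < m) G i (x ord0 i)).
  move=> mG; apply: measurable_prod => i _.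
  exact: (measurableT_comp (mG i) (@measurable_rV_coord R m i)).
rewrite ge0_integral_rVS//; last 2 first.
- by apply/measurable_EFinP; exact: mprod.
- by move=> x; rewrite lee_fin prodr_ge0.
pose P (y : 'rV[R]_n) := \prod_(i < n) F (lift ord0 i) (y ord0 i).
have mP : measurable_fun setT P by exact: (mprod n (fun i => F (lift ord0 i))).
have P0 y : 0 <= P y by rewrite prodr_ge0.
have c0 : 0 <= c ord0 by rewrite -lee_fin -Fc integral_ge0// => r _; rewrite lee_fin.
have key y : (\int[leb]_r (\prod_(i < n.+1) F i (rV_cons (y, r) ord0 i))%:E =
    (c ord0)%:E * (P y)%:E)%E.
  under eq_integral => r _.
    rewrite big_ord_recl rV_cons0/=.
    under eq_bigr do rewrite rV_consS/=.
    rewrite EFinM; over.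
  have mF0 : measurable_fun setT (fun r => (F ord0 r)%:E) by exact/measurable_EFinP.
  have F00 r : setT r -> (0 <= (F ord0 r)%:E)%E by rewrite lee_fin.
  have P0' : (0 <= (P y)%:E)%E by rewrite lee_fin.
  by rewrite [LHS](ge0_integralZr leb measurableT mF0 F00 P0') Fc.
under eq_integral do rewrite key.
have mP' : measurable_fun setT (fun y => (P y)%:E) by exact/measurable_EFinP.
rewrite ge0_integralZl//.
- rewrite (ih (fun i => F (lift ord0 i)) (fun i => c (lift ord0 i)))//.
  by rewrite big_ord_recl.
- by move=> y _; rewrite lee_fin.
Qed.

Lemma lebesgue_integrable_measurable (F : R -> R) :
  leb.-integrable setT (EFin \o F) -> measurable_fun setT F.
Proof. by move=> /measurable_int/measurable_EFinP. Qed.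

Lemma integrable_prod n (F : 'I_n -> R -> R) :
  (forall i r, 0 <= F i r) -> (forall i, leb.-integrable setT (EFin \o F i)) ->
  lebesgue_rV.-integrable setT
    (EFin \o (fun x : 'rV[R]_n => \prod_(i < n) F i (x ord0 i))).
Proof.
move=> F0 iF.
have mF i : measurable_fun setT (F i) by exact: lebesgue_integrable_measurable (iF i).
apply/integrableP; split.
  apply/measurable_EFinP/measurable_prod => i _.
  exact: (measurableT_comp (mF i) (@measurable_rV_coord R n i)).
under eq_integral do rewrite /= ger0_norm ?prodr_ge0//.
rewrite (ge0_integral_prod (c := fun i => \int[leb]_r F i r)) ?ltry// => i.
by rewrite /Rintegral fineK//; exact: (integrable_fin_num measurableT (iF i)).
Qed.

Lemma cmeas_prod d (T : measurableType d) I (r : seq I) (F : I -> T -> R[i]) :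
  (forall i, cmeas (F i)) -> cmeas (fun x => \prod_(i <- r) F i x).
Proof.
move=> mF; elim: r => [|i r ih].
  by under eq_fun do rewrite big_nil; exact: cmeas_cst.
by under eq_fun do rewrite big_cons; exact: cmeasM.
Qed.

Lemma cmeas_comp d d' (T : measurableType d) (T' : measurableType d') (f : T' -> R[i])
  (g : T -> T') : cmeas f -> measurable_fun setT g -> cmeas (fun x => f (g x)).
Proof. by move=> [f1 f2] mg; split; [exact: (measurableT_comp f1 mg)|exact: (measurableT_comp f2 mg)]. Qed.

Lemma cintegral_prod n (F : 'I_n -> R -> R[i]) :
  (forall i, cintegrable leb (F i)) ->
  cintegral (fun x : 'rV[R]_n => \prod_(i < n) F i (x ord0 i)) =
  \prod_(i < n) cint leb (F i).
Proof.
elim: n F => [|n ih] F cF.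
  rewrite big_ord0 /cintegral.
  under [X in (X +i* _)%C = _]eq_Rintegral do rewrite big_ord0/=.
  under [X in (_ +i* X)%C = _]eq_Rintegral do rewrite big_ord0/=.
  rewrite !Rintegral_cst// mul1r mul0r.
  by rewrite [X in fine X](lebesgue_rV0T).
have mF i : cmeas (F i) by have [? ?] := cF i; split; exact: lebesgue_integrable_measurable.
have mprod m (G : 'I_m -> R -> R[i]) : (forall i, cmeas (G i)) ->
    cmeas (fun x : 'rV[R]_m => \prod_(i < m) G i (x ord0 i)).
  move=> mG; apply: cmeas_prod => i.
  exact: (cmeas_comp (mG i) (@measurable_rV_coord R m i)).
pose f (y : 'rV[R]_n) (r : R) := F ord0 r * \prod_(i < n) F (lift ord0 i) (y ord0 i).
pose A (y : 'rV[R]_n) := \prod_(i < n) normc (F (lift ord0 i) (y ord0 i)).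
pose B r := normc (F ord0 r).
have iA : lebesgue_rV.-integrable setT (EFin \o A).
  apply: (@integrable_prod n (fun i r => normc (F (lift ord0 i) r))) => i.
    by move=> r; exact: normc_ge0.
  exact: cintegrable_normc.
have iB : leb.-integrable setT (EFin \o B) by exact: cintegrable_normc.
have mf : cmeas (fun p : 'rV[R]_n * R => f p.1 p.2).
  apply: cmeasM; first exact: (cmeas_comp (mF ord0) measurable_snd).
  have := @mprod n (fun i => F (lift ord0 i)) (fun i => mF (lift ord0 i)).
  by move=> /cmeas_comp; apply; exact: measurable_fst.
have fAB y r : normc (f y r) <= A y * B r.
  by rewrite /f Normc.normcM normc_prod mulrC.
have fE y r : \prod_(i < n.+1) F i (rV_cons (y, r) ord0 i) = f y r.
  rewrite big_ord_recl rV_cons0; congr (_ * _).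
  by apply: eq_bigr => i _; rewrite rV_consS.
have fAB' y r : normc (\prod_(i < n.+1) F i (rV_cons (y, r) ord0 i)) <= A y * B r.
  by rewrite fE.
apply: etrans (@cint_push_prod _ _ _ _ (measurableTypeR R) _ R (lebesgue_rV_rec n) leb _
  (@measurable_rV_consR n) _ A B (@mprod n.+1 F mF) fAB' iA iB) _.
rewrite big_ord_recl -ih//.
rewrite -(cintZ (mu := lebesgue_rV)); last first.
  apply: (cintegrable_le (mprod n _ (fun i => mF (lift ord0 i))) _ iA) => y.
  by rewrite normc_prod.
congr cint; apply/funext => y.
rewrite mulrC -(cintZ (mu := leb))//.
by congr cint; apply/funext => r; rewrite fE /f mulrC.
Qed.

End rV_integral.

(** * The Fourier transform of the Gaussian on the line *)

Section gauss1.
Context {R : realType}.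
Local Notation leb := (@lebesgue_measure R).

Lemma is_derive_affine (a b x : R) : is_derive x 1 (fun t => a * t + b) a.
Proof.
have h1 := is_deriveZ a (is_derive_id x (1 : R)).
have h2 := is_deriveD h1 (is_derive_cst b x (1 : R)).
by apply: (is_derive_eq h2); rewrite /= addr0 [LHS]mulr1.
Qed.

Lemma is_derive_quadratic (p q r x : R) :
  is_derive x 1 (fun t => p * t ^+ 2 + q * t + r) (2 * p * x + q).
Proof.
have h1 := is_deriveZ p (is_deriveX 2 (is_derive_id x (1 : R))).
have h2 := is_deriveD h1 (is_derive_affine q r x).
have -> : (fun t => p * t ^+ 2 + q * t + r) = (fun t => p * t ^+ 2 + (q * t + r)).
  by apply/funext => t; rewrite addrA.
apply: (is_derive_eq h2) => /=; rewrite /GRing.scale/=.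
by rewrite mulr1 expr1; ring.
Qed.

(** Sines being shifted cosines, this one formula serves [K], [S] and, along coordinate lines,
    [osc_gaussian]. *)
Lemma is_derive_cosgauss (a c p q r x : R) :
  is_derive x 1 (fun t => cos (a * t + c) * expR (p * t ^+ 2 + q * t + r))
    (cos (a * x + c) * expR (p * x ^+ 2 + q * x + r) * (2 * p * x + q) -
     sin (a * x + c) * expR (p * x ^+ 2 + q * x + r) * a).
Proof.
have h1 := @is_derive1_comp R cos (fun t => a * t + c) x _ _
  (is_derive_cos (a * x + c)) (is_derive_affine a c x).
have h2 := @is_derive1_comp R expR (fun t => p * t ^+ 2 + q * t + r) x _ _
  (is_derive_expR (p * x ^+ 2 + q * x + r)) (is_derive_quadratic p q r x).
apply: (is_derive_eq (is_deriveM h1 h2)) => /=; rewrite /GRing.scale/=; ring.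
Qed.

Lemma integral_gauss_scaled (c : R) : 0 < c ->
  (\int[leb]_x (expR (- (c * x ^+ 2)))%:E = (Num.sqrt pi / Num.sqrt c)%:E)%E.
Proof.
move=> c0; have s0 : 0 < Num.sqrt c by rewrite sqrtr_gt0.
transitivity (\int[leb]_x (gauss_fun (Num.sqrt c * x + 0))%:E)%E.
  apply: eq_integral => x _; rewrite /gauss_fun addr0 exprMn sqr_sqrtr//.
  exact: ltW.
rewrite (ge0_integral_affine1 (a := Num.sqrt c) 0 (f := fun x => (gauss_fun x)%:E)).
- by rewrite integralT_gauss gtr0_norm// -EFinM mulrC.
- by rewrite gt_eqF.
- by apply/measurable_EFinP; exact: measurable_gauss_fun.
- by move=> x; rewrite lee_fin gauss_fun_ge0.
Qed.

Lemma measurable_gauss_scaled (c : R) :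
  measurable_fun setT (fun x : R => expR (- (c * x ^+ 2))).
Proof.
apply: measurableT_comp; first exact: measurable_expR.
by apply: measurable_funN; apply: measurable_funM => //; exact: measurable_funX.
Qed.

Lemma integrable_gauss_scaled (c : R) : 0 < c ->
  leb.-integrable setT (fun x => (expR (- (c * x ^+ 2)))%:E).
Proof.
move=> c0; apply/integrableP; split.
  by apply/measurable_EFinP; exact: measurable_gauss_scaled.
under eq_integral do rewrite /= ger0_norm ?expR_ge0//.
by rewrite integral_gauss_scaled// ltry.
Qed.

(** The factor [expR (t ^+ 2 / 2)] is there to make the integral of [K t] independent of [t]. Indeed
    the derivative of [K] in [t] is the derivative in [x] of [S t 0]. In [S] the variable [h] is a
    translation, so that the integral of this derivative is the derivative in [h] of a constant; no
    boundary term at infinity has to be discussed. *)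
Let K (t x : R) := cos (t * x) * expR ((t ^+ 2 - x ^+ 2) / 2).
Let S (t h x : R) := sin (t * (x + h)) * expR ((t ^+ 2 - (x + h) ^+ 2) / 2).

Let dK (t x : R) : is_derive t 1 (K ^~ x)
  (t * cos (t * x) * expR ((t ^+ 2 - x ^+ 2) / 2) -
   x * sin (t * x) * expR ((t ^+ 2 - x ^+ 2) / 2)).
Proof.
have -> : K ^~ x = fun t => cos (x * t + 0) * expR (2^-1 * t ^+ 2 + 0 * t + - (x ^+ 2 / 2)).
  apply/funext => s; rewrite /K; congr (cos _ * expR _); first by ring.
  by field.
apply: (is_derive_eq (is_derive_cosgauss x 0 2^-1 0 (- (x ^+ 2 / 2)) t)).
have -> : x * t + 0 = t * x by ring.
have -> : 2^-1 * t ^+ 2 + 0 * t + - (x ^+ 2 / 2) = (t ^+ 2 - x ^+ 2) / 2 by field.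
by field.
Qed.

Let dS (t h x : R) : is_derive h 1 (fun h => S t h x)
  (t * cos (t * (x + h)) * expR ((t ^+ 2 - (x + h) ^+ 2) / 2) -
   (x + h) * sin (t * (x + h)) * expR ((t ^+ 2 - (x + h) ^+ 2) / 2)).
Proof.
(* The sine is a cosine shifted by a quarter turn, as [is_derive_cosgauss] needs. *)
have -> : (fun h => S t h x) = fun h => cos (t * h + (t * x - pi / 2)) *
    expR (- 2^-1 * h ^+ 2 + - x * h + (t ^+ 2 - x ^+ 2) / 2).
  apply/funext => s; rewrite /S addrA cosBpihalf; congr (sin _ * expR _); first by ring.
  by field.
apply: (is_derive_eq (is_derive_cosgauss t (t * x - pi / 2) (- 2^-1) (- x)
  ((t ^+ 2 - x ^+ 2) / 2) h)).
rewrite addrA cosBpihalf sinBpihalf.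
have -> : t * h + t * x = t * (x + h) by ring.
have -> : - 2^-1 * h ^+ 2 + - x * h + (t ^+ 2 - x ^+ 2) / 2 =
  (t ^+ 2 - (x + h) ^+ 2) / 2 by field.
by field.
Qed.

Let absx_le (x : R) : `|x| <= expR (x ^+ 2 / 4).
Proof.
apply: le_trans (expR_ge1Dx _); rewrite -(real_normK (num_real x)).
by have := sqr_ge0 (1 - `|x| / 2); move: `|x| => y; rewrite sqrrB; lra.
Qed.

(** Half of the Gaussian exponent absorbs the factor [|x|], by [absx_le]. The bound is uniform in
    [|t| <= T], as differentiation under the integral sign requires. *)
Let bound (T t x : R) : `|t| <= T ->
  `|t * cos (t * x) * expR ((t ^+ 2 - x ^+ 2) / 2) -
    x * sin (t * x) * expR ((t ^+ 2 - x ^+ 2) / 2)| <=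
  (T + 1) * expR (T ^+ 2 / 2) * expR (- (4^-1 * x ^+ 2)).
Proof.
move=> tT; have T0 : 0 <= T by rewrite (le_trans _ tT).
have e1 : expR ((t ^+ 2 - x ^+ 2) / 2) <= expR (T ^+ 2 / 2) * expR (- (2^-1 * x ^+ 2)).
  rewrite -expRD ler_expR -(real_normK (num_real t)).
  have : `|t| ^+ 2 <= T ^+ 2 by rewrite ler_sqr ?nnegrE.
  lra.
have e2 : `|x| * expR (- (2^-1 * x ^+ 2)) <= expR (- (4^-1 * x ^+ 2)).
  rewrite (_ : - (4^-1 * x ^+ 2) = x ^+ 2 / 4 + - (2^-1 * x ^+ 2)); last by field.
  by rewrite expRD ler_wpM2r// expR_ge0.
have e3 : expR (- (2^-1 * x ^+ 2)) <= expR (- (4^-1 * x ^+ 2)).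
  by rewrite ler_expR; have := sqr_ge0 x; lra.
rewrite -mulrBl normrM (ger0_norm (expR_ge0 _)).
apply: (@le_trans _ _ ((T + `|x|) * (expR (T ^+ 2 / 2) * expR (- (2^-1 * x ^+ 2))))).
  apply: ler_pM => //; try exact: expR_ge0.
  apply: (le_trans (ler_normB _ _)); apply: lerD.
    by rewrite normrM -[leRHS]mulr1 ler_pM// ler_norml cos_geN1 cos_le1.
  by rewrite normrM ler_piMr// ler_norml sin_geN1 sin_le1.
rewrite [leLHS]mulrCA mulrC [leRHS]mulrAC ler_wpM2r ?expR_ge0//.
by rewrite !mulrDl mul1r lerD// ler_wpM2l.
Qed.

Let intK (t : R) : leb.-integrable setT (EFin \o K t).
Proof.
apply: (le_integrable measurableT _ _
  (integrableZl measurableT (expR (t ^+ 2 / 2)) (integrable_gauss_scaled (c := 2^-1) _))) => //.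
  apply/measurable_EFinP/measurable_funM.
    apply: measurableT_comp; last exact: measurable_funM.
    by apply: continuous_measurable_fun; exact: continuous_cos.
  rewrite (_ : (fun x => _) = fun x => expR (t ^+ 2 / 2) * expR (- (2^-1 * x ^+ 2))).
    by apply: measurable_funM => //; exact: measurable_gauss_scaled.
  by apply/funext => x; rewrite -expRD; congr expR; field.
move=> x _; rewrite lee_fin [leRHS]ger0_norm; last by rewrite mulr_ge0// expR_ge0.
rewrite -expRD (_ : t ^+ 2 / 2 + _ = (t ^+ 2 - x ^+ 2) / 2); last by field.
rewrite /K normrM (ger0_norm (expR_ge0 _)) ler_piMl ?expR_ge0//.
by rewrite ler_norml cos_geN1 cos_le1.
Qed.

Let intS0 (t : R) : leb.-integrable setT (EFin \o S t 0).
Proof.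
apply: (le_integrable measurableT _ _
  (integrableZl measurableT (expR (t ^+ 2 / 2)) (integrable_gauss_scaled (c := 2^-1) _))) => //.
  apply/measurable_EFinP/measurable_funM.
    apply: measurableT_comp; last by apply: measurable_funM => //; exact: measurable_funD.
    by apply: continuous_measurable_fun; exact: continuous_sin.
  rewrite (_ : (fun x => _) = fun x => expR (t ^+ 2 / 2) * expR (- (2^-1 * x ^+ 2))).
    by apply: measurable_funM => //; exact: measurable_gauss_scaled.
  by apply/funext => x; rewrite -expRD addr0; congr expR; field.
move=> x _; rewrite lee_fin [leRHS]ger0_norm; last by rewrite mulr_ge0// expR_ge0.
rewrite -expRD (_ : t ^+ 2 / 2 + _ = (t ^+ 2 - (x + 0) ^+ 2) / 2); last by field.
rewrite /S normrM (ger0_norm (expR_ge0 _)) ler_piMl ?expR_ge0//.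
by rewrite ler_norml sin_geN1 sin_le1.
Qed.

Let Fder0 (t : R) : is_derive t 1 (fun t => \int[leb]_x K t x) 0.
Proof.
pose T := `|t| + 1.
have int4 := integrable_gauss_scaled (c := 4^-1 : R) ltac:(by rewrite invr_gt0).
have int8 := integrable_gauss_scaled (c := 8^-1 : R) ltac:(by rewrite invr_gt0).
pose G1 (x : R) := (T + 1) * expR (T ^+ 2 / 2) * expR (- (4^-1 * x ^+ 2)).
(* Majorant for all translates by [|h| < 1]: since [(y + h)^2 >= y^2 / 2 - h^2], the coefficient 1/4
   becomes 1/8 at the cost of a factor [expR (1 / 4)]. *)
pose G2 (x : R) := (`|t| + 1) * expR (`|t| ^+ 2 / 2) * expR (1 / 4) * expR (- (8^-1 * x ^+ 2)).
have G10 x : 0 <= G1 x by rewrite /G1 /T !mulr_ge0 ?expR_ge0// !addr_ge0.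
have G20 x : 0 <= G2 x by rewrite /G2 !mulr_ge0 ?expR_ge0// !addr_ge0.
have iG1 : leb.-integrable setT (EFin \o G1) by exact: (integrableZl measurableT _ int4).
have iG2 : leb.-integrable setT (EFin \o G2) by exact: (integrableZl measurableT _ int8).
have iS h : leb.-integrable setT (EFin \o S t h).
  have := @integrable_affine1 R 1 h _ (oner_neq0 _) (intS0 t).
  by apply: eq_integrable => // x _ /=; rewrite /S mul1r addr0.
have I1 : `]t - 1, t + 1[%classic t by rewrite /= in_itv/=; lra.
have I0 : `](-1), 1[%classic (0 : R) by rewrite /= in_itv/=; lra.
have derK x y : `]t - 1, t + 1[%classic x -> setT y -> derivable (K ^~ y) x 1.
  by move=> _ _; have [] := dK x y.
have derS x y : `](-1), 1[%classic x -> setT y -> derivable ((S t) ^~ y) x 1.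
  by move=> _ _; have [] := dS t x y.
have bK x y : `]t - 1, t + 1[%classic x -> setT y -> `|partial1of2 K x y| <= G1 y.
  rewrite /= in_itv/= => xt _; rewrite partial1of2E (@derive_val _ _ _ _ _ _ _ (dK x y)).
  apply: bound; rewrite /T; have := ler_norm t; have := ler_norm (- t).
  by rewrite normrN ler_norml; lra.
have bS x y : `](-1), 1[%classic x -> setT y -> `|partial1of2 (S t) x y| <= G2 y.
  rewrite /= in_itv/= => xt _; rewrite partial1of2E (@derive_val _ _ _ _ _ _ _ (dS t x y)).
  apply: (le_trans (bound (y + x) (lexx `|t|))); rewrite /G2 -[leRHS]mulrA.
  apply: ler_wpM2l; first by rewrite mulr_ge0 ?expR_ge0// addr_ge0.
  rewrite -expRD ler_expR.
  have : x ^+ 2 <= 1 by case/andP: xt; nra.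
  by have := sqr_ge0 (y + 2 * x); rewrite !sqrrD exprMn; lra.
have e1 := differentiation_under_integral measurableT I1 (fun x _ => intK x) derK G10 iG1 bK.
have d1 := derivable_under_integral measurableT I1 (fun x _ => intK x) derK G10 iG1 bK.
have e2 := differentiation_under_integral measurableT I0 (fun x _ => iS x) derS G20 iG2 bS.
apply: DeriveDef => //; rewrite -derive1E e1.
transitivity (\int[leb]_y partial1of2 (S t) 0 y).
  apply: eq_Rintegral => y _; rewrite !partial1of2E.
  by rewrite (@derive_val _ _ _ _ _ _ _ (dK t y)) (@derive_val _ _ _ _ _ _ _ (dS t 0 y)) !addr0.
(* By translation invariance this function of [h] is constant. *)
rewrite -e2 (_ : (fun h => _) = cst (\int[leb]_y S t 0 y)) ?derive1_cst//.
apply/funext => h /=; have := @Rintegral_affine1 R 1 h _ (oner_neq0 _) (intS0 t).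
rewrite normr1 invr1 mul1r => <-.
by apply: eq_Rintegral => y _; rewrite /S mul1r addr0.
Qed.

Lemma Rintegral_cos_gauss (t : R) :
  \int[leb]_x (cos (t * x) * expR (- (x ^+ 2 / 2))) =
  Num.sqrt (2 * pi) * expR (- (t ^+ 2 / 2)).
Proof.
have E : \int[leb]_x K t x = Num.sqrt (2 * pi).
  rewrite (is_derive_0_is_cst t 0 Fder0).
  rewrite (@eq_Rintegral _ _ _ leb _ (fun x => expR (- (2^-1 * x ^+ 2)))); last first.
    by move=> x _; rewrite /K mul0r cos0 mul1r; congr expR; field.
  rewrite /Rintegral integral_gauss_scaled ?invr_gt0//=.
  by rewrite sqrtrV// invrK mulrC sqrtrM.
have Z := @RintegralZr _ _ _ leb setT (K t) (expR (- (t ^+ 2 / 2))) measurableT (intK t).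
rewrite -E -[RHS]Z.
by apply: eq_Rintegral => x _; rewrite /K -mulrA -expRD; congr (_ * expR _); field.
Qed.

Lemma Rintegral_sin_gauss (t : R) :
  \int[leb]_x (sin (t * x) * expR (- (x ^+ 2 / 2))) = 0.
Proof.
pose g (x : R) := sin (t * x) * expR (- (x ^+ 2 / 2)).
have ig : leb.-integrable setT (EFin \o g).
  have := integrableZl measurableT (expR (- (t ^+ 2 / 2))) (intS0 t).
  apply: eq_integrable => // x _ /=; rewrite -EFinM /S /g; congr EFin.
  by rewrite mulrCA -expRD addr0; congr (_ * expR _); field.
have N1 : -1 != 0 :> R by rewrite oppr_eq0 oner_eq0.
have := @Rintegral_affine1 R (-1) 0 _ N1 ig.
rewrite normrN1 invr1 mul1r.
rewrite (@eq_Rintegral _ _ _ leb _ (fun x => -1 * g x)); last first.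
  by move=> x _; rewrite /g addr0 !mulN1r mulrN sinN mulNr sqrrN.
rewrite (@RintegralZl _ _ _ leb setT g (-1) measurableT ig) mulN1r => e.
by rewrite -/g; lra.
Qed.

Lemma cint_gauss (t : R) :
  cint leb (fun x => expi (- (t * x)) * (expR (- (x ^+ 2 / 2)))%:C%C) =
  (Num.sqrt (2 * pi) * expR (- (t ^+ 2 / 2)))%:C%C.
Proof.
rewrite /cint.
rewrite (@eq_Rintegral _ _ _ leb _ (fun x => cos (t * x) * expR (- (x ^+ 2 / 2)))); last first.
  by move=> x _; rewrite ReM/= mulr0 subr0 cosN.
rewrite Rintegral_cos_gauss.
rewrite (@eq_Rintegral _ _ _ leb _ (fun x => sin (- t * x) * expR (- (x ^+ 2 / 2)))).
  by rewrite Rintegral_sin_gauss.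
by move=> x _; rewrite ImM/= mulr0 add0r mulNr.
Qed.

End gauss1.

(** * The Euclidean inner product and norm *)

Section dotp_theory.
Context {R : realType} {n : nat}.
Implicit Types x y z : 'rV[R]_n.

Lemma dotpC x y : dotp x y = dotp y x.
Proof. by apply: eq_bigr => i _; rewrite mulrC. Qed.

Lemma dotpDl x y z : dotp (x + y) z = dotp x z + dotp y z.
Proof. by rewrite -big_split/=; apply: eq_bigr => i _; rewrite mxE mulrDl. Qed.

Lemma dotpZl a x y : dotp (a *: x) y = a * dotp x y.
Proof. by rewrite big_distrr/=; apply: eq_bigr => i _; rewrite mxE mulrA. Qed.

Lemma dotpNl x y : dotp (- x) y = - dotp x y.
Proof. by rewrite -scaleN1r dotpZl mulN1r. Qed.

Lemma dotpDr x y z : dotp x (y + z) = dotp x y + dotp x z.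
Proof. by rewrite dotpC dotpDl !(dotpC _ x). Qed.

Lemma dotpZr a x y : dotp x (a *: y) = a * dotp x y.
Proof. by rewrite dotpC dotpZl dotpC. Qed.

Lemma dotpNr x y : dotp x (- y) = - dotp x y.
Proof. by rewrite dotpC dotpNl dotpC. Qed.

Lemma dotp_ge0 x : 0 <= dotp x x.
Proof. by apply: sumr_ge0 => i _; rewrite -expr2 sqr_ge0. Qed.

Lemma dotpBB x y : dotp (x - y) (x - y) = dotp x x - 2 * dotp x y + dotp y y.
Proof. by rewrite !dotpDl !dotpDr !dotpNl !dotpNr (dotpC y x); ring. Qed.

Lemma dotpDD x y : dotp (x + y) (x + y) = dotp x x + 2 * dotp x y + dotp y y.
Proof. by rewrite !dotpDl !dotpDr (dotpC y x); ring. Qed.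

Lemma enorm_sqr x : enorm x ^+ 2 = dotp x x.
Proof. by rewrite sqr_sqrtr// dotp_ge0. Qed.

Lemma enorm_ge0 x : 0 <= enorm x.
Proof. exact: sqrtr_ge0. Qed.

Lemma dotp_coord x i : x ord0 i ^+ 2 <= dotp x x.
Proof.
rewrite /dotp (bigD1 i)//= expr2 lerDl sumr_ge0// => j _.
by rewrite -expr2 sqr_ge0.
Qed.

Lemma enorm_coord x i : `|x ord0 i| <= enorm x.
Proof.
by rewrite -(@ler_pXn2r _ 2)// ?nnegrE ?enorm_ge0// enorm_sqr real_normK ?num_real// dotp_coord.
Qed.

Lemma dotp_le x y : dotp x y <= enorm x * enorm y.
Proof.
have [x0|x0] := eqVneq (enorm x) 0.
  have xi0 i : x ord0 i = 0.
    by apply/eqP; rewrite -normr_eq0 eq_le normr_ge0 andbT -x0 enorm_coord.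
  by rewrite x0 mul0r /dotp big1// => i _; rewrite xi0 mul0r.
have {}x0 : 0 < enorm x by rewrite lt_neqAle eq_sym x0 enorm_ge0.
have := dotp_ge0 (enorm x ^+ 2 *: y - dotp x y *: x).
rewrite dotpBB !dotpZl !dotpZr -!enorm_sqr (dotpC y x).
move: (dotp x y) (enorm y) (enorm_ge0 y) => d e e0 h.
have {}h : d ^+ 2 <= (enorm x * e) ^+ 2.
  rewrite -(@ler_pM2l _ (enorm x ^+ 2)) ?exprn_gt0// exprMn.
  by move: h; rewrite -subr_ge0; congr (0 <= _); ring.
rewrite (le_trans (ler_norm _))// -(@ler_pXn2r _ 2)// ?nnegrE//.
  by rewrite real_normK ?num_real.
by rewrite mulr_ge0// ltW.
Qed.

Lemma enormN x : enorm (- x) = enorm x.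
Proof. by rewrite /enorm dotpNl dotpNr opprK. Qed.

Lemma enormD x y : enorm (x + y) <= enorm x + enorm y.
Proof.
rewrite -(@ler_pXn2r _ 2)// ?nnegrE ?enorm_ge0 ?addr_ge0 ?enorm_ge0//.
rewrite enorm_sqr dotpDD sqrrD !enorm_sqr lerD2r lerD2l mulr2n mulrDl mul1r.
by rewrite lerD ?dotp_le.
Qed.

Lemma enormZ a x : enorm (a *: x) = `|a| * enorm x.
Proof. by rewrite /enorm dotpZl dotpZr mulrA -expr2 sqrtrM ?sqr_ge0// sqrtr_sqr. Qed.

Lemma measurable_dotp d (T : measurableType d) (f g : T -> 'rV[R]_n) :
  measurable_fun setT f -> measurable_fun setT g ->
  measurable_fun setT (fun t => dotp (f t) (g t)).
Proof.
move=> mf mg; apply: measurable_sum => i; apply: measurable_funM.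
- exact: (measurableT_comp (measurable_rV_coord i) mf).
- exact: (measurableT_comp (measurable_rV_coord i) mg).
Qed.

Lemma measurable_rVD d (T : measurableType d) (f g : T -> 'rV[R]_n) :
  measurable_fun setT f -> measurable_fun setT g ->
  measurable_fun setT (fun t => f t + g t).
Proof.
move=> mf mg; apply: measurable_fun_rVP => i.
rewrite (_ : _ \o _ = fun t => rV_coord i (f t) + rV_coord i (g t)); last first.
  by apply/funext => x; rewrite /rV_coord/= !mxE.
apply: measurable_funD.
- exact: (measurableT_comp (measurable_rV_coord i) mf).
- exact: (measurableT_comp (measurable_rV_coord i) mg).
Qed.

Lemma measurable_rVZ d (T : measurableType d) (a : R) (f : T -> 'rV[R]_n) :
  measurable_fun setT f -> measurable_fun setT (fun t => a *: f t).
Proof.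
move=> mf; apply: measurable_fun_rVP => i.
rewrite (_ : _ \o _ = fun t => a * rV_coord i (f t)); last first.
  by apply/funext => x; rewrite /rV_coord/= !mxE.
apply: measurable_funM => //.
exact: (measurableT_comp (measurable_rV_coord i) mf).
Qed.

Lemma measurable_enorm d (T : measurableType d) (f : T -> 'rV[R]_n) :
  measurable_fun setT f -> measurable_fun setT (fun t => enorm (f t)).
Proof.
move=> mf; have ms : measurable_fun setT (@Num.sqrt R).
  by apply: continuous_measurable_fun; exact: sqrt_continuous.
exact: (measurableT_comp ms (measurable_dotp mf mf)).
Qed.

End dotp_theory.

(** * Gaussians and wave packets on R^n, with their Fourier transforms *)

Section gaussian.
Context {R : realType} {n : nat}.
Local Notation leb := (@lebesgue_measure R).
Implicit Types (x y xi : 'rV[R]_n).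

Definition gaussian (a : R) x : R := expR (- (a * dotp x x)).

Lemma gaussian_prod a x : gaussian a x = \prod_(i < n) expR (- (a * x ord0 i ^+ 2)).
Proof.
rewrite /gaussian /dotp big_distrr/= -sumrN expR_sum.
by apply: eq_bigr => i _; rewrite expr2.
Qed.

Lemma gaussian_ge0 a x : 0 <= gaussian a x.
Proof. exact: expR_ge0. Qed.

Lemma gaussianN a x : gaussian a (- x) = gaussian a x.
Proof. by rewrite /gaussian dotpNl dotpNr opprK. Qed.

Lemma measurable_gaussian d (T : measurableType d) (a : R) (f : T -> 'rV[R]_n) :
  measurable_fun setT f -> measurable_fun setT (fun t => gaussian a (f t)).
Proof.
move=> mf; have mg : measurable_fun setT (fun t => - (a * dotp (f t) (f t))).
  by apply: measurable_funN; apply: measurable_funM => //; exact: measurable_dotp.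
have me : measurable_fun setT (@expR R) by exact: measurable_expR.
exact: (measurableT_comp me mg).
Qed.

Lemma integral_gaussian a : 0 < a ->
  (\int[lebesgue_rV]_x (gaussian a x)%:E = ((Num.sqrt pi / Num.sqrt a) ^+ n)%:E)%E.
Proof.
move=> a0; under eq_integral do rewrite gaussian_prod.
rewrite (@ge0_integral_prod R n (fun _ r => expR (- (a * r ^+ 2)))
  (fun=> Num.sqrt pi / Num.sqrt a)).
- by rewrite prodr_const card_ord.
- by move=> i; exact: measurable_gauss_scaled.
- by move=> i r; exact: expR_ge0.
- by move=> i; exact: integral_gauss_scaled.
Qed.

Lemma integrable_gaussian a y : 0 < a ->
  lebesgue_rV.-integrable setT (EFin \o (fun x => gaussian a (x - y))).
Proof.
move=> a0.
have h : lebesgue_rV.-integrable setT (EFin \o gaussian a).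
  apply/integrableP; split; first by apply/measurable_EFinP; exact: measurable_gaussian.
  under eq_integral do rewrite /= ger0_norm ?gaussian_ge0//.
  by rewrite integral_gaussian// ltry.
have := integrable_affine (- y) (oner_neq0 R) h.
by apply: eq_integrable => // x _ /=; rewrite scale1r.
Qed.

Lemma Rintegral_gaussian a y : 0 < a ->
  \int[lebesgue_rV]_x gaussian a (x - y) = (Num.sqrt pi / Num.sqrt a) ^+ n.
Proof.
move=> a0; rewrite /Rintegral.
rewrite (eq_integral (fun x => (gaussian a (1 *: x + - y))%:E)); last first.
  by move=> x _; rewrite scale1r.
rewrite (ge0_integral_affine (- y) (f := fun x => (gaussian a x)%:E)) ?oner_neq0//.
- by rewrite integral_gaussian// normr1 expr1n invr1 mul1e.
- by apply/measurable_EFinP; exact: measurable_gaussian.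
- by move=> x; rewrite lee_fin gaussian_ge0.
Qed.

Lemma cint_gaussian1 xi :
  cintegral (fun x => expi (- dotp xi x) * (gaussian 2^-1 x)%:C%C) =
  (Num.sqrt (2 * pi) ^+ n * gaussian 2^-1 xi)%:C%C.
Proof.
pose F (i : 'I_n) (r : R) := expi (- (xi ord0 i * r)) * (expR (- (r ^+ 2 / 2)))%:C%C.
have cF i : cintegrable leb (F i).
  apply: (@cintegrable_le _ (measurableTypeR R) _ leb _ (fun r => expR (- (2^-1 * r ^+ 2)))).
  - apply: cmeasM.
      apply: cmeas_expi; apply: measurable_funN; exact: measurable_funM.
    apply: cmeas_real; have := measurable_gauss_scaled (2^-1 : R).
    by under eq_fun do rewrite mulrC.
  - by move=> r; rewrite Normc.normcM normc_expi mul1r normc_real ger0_norm ?expR_ge0// mulrC.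
  - by apply: integrable_gauss_scaled; rewrite invr_gt0.
transitivity (cintegral (fun x : 'rV[R]_n => \prod_(i < n) F i (x ord0 i))).
  congr cintegral; apply/funext => x; rewrite gaussian_prod /dotp -sumrN expi_sum.
  rewrite rmorph_prod/= -big_split/=; apply: eq_bigr => i _.
  by rewrite /F (mulrC 2^-1).
rewrite cintegral_prod//.
under eq_bigr do rewrite [cint _ _]cint_gauss.
rewrite -rmorph_prod/= big_split/= prodr_const card_ord gaussian_prod.
by congr ((_ * _)%:C)%C; apply: eq_bigr => i _; rewrite mulrC.
Qed.

Lemma cmeas_gaussian_wave a xi y : cmeas (fun x =>
  expi (- dotp xi x) * (gaussian a (x - y))%:C%C).
Proof.
apply: cmeasM.
  by apply: cmeas_expi; apply: measurable_funN; exact: measurable_dotp.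
by apply: cmeas_real; apply: measurable_gaussian; exact: measurable_rVD.
Qed.

Lemma cintegrable_gaussian a xi y : 0 < a -> cintegrable lebesgue_rV (fun x =>
  expi (- dotp xi x) * (gaussian a (x - y))%:C%C).
Proof.
move=> a0; apply: (cintegrable_le (cmeas_gaussian_wave a xi y) _ (integrable_gaussian y a0)) => x.
by rewrite Normc.normcM normc_expi mul1r normc_real ger0_norm// gaussian_ge0.
Qed.

Lemma cint_gaussian (mu : R) xi y : 0 < mu ->
  cintegral (fun x => expi (- dotp xi x) * (gaussian (mu ^+ 2 / 2) (x - y))%:C%C) =
  expi (- dotp xi y) * ((Num.sqrt (2 * pi) / mu) ^+ n * gaussian ((2 * mu ^+ 2)^-1) xi)%:C%C.
Proof.
move=> mu0.
pose f x := expi (- dotp (mu^-1 *: xi) x) * (gaussian 2^-1 x)%:C%C.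
have cf : cintegrable lebesgue_rV f.
  have := @cintegrable_gaussian 2^-1 (mu^-1 *: xi) 0.
  under eq_fun do rewrite subr0.
  by apply; rewrite invr_gt0.
transitivity (expi (- dotp xi y) * cintegral (fun x => f (mu *: x + - (mu *: y)))).
  rewrite /cintegral -[in RHS]/(cint _ _) -cintZ; last first.
    have := @cintegrable_gaussian (mu ^+ 2 / 2) xi y.
    move=> /(_ ltac:(by rewrite divr_gt0// exprn_gt0)) /(cintegrableZ (expi (dotp xi y))).
    congr cintegrable; apply/funext => x.
    rewrite /f mulrA -expiD -scalerBr dotpZl dotpZr mulrA mulVf ?gt_eqF// mul1r dotpDr dotpNr.
    congr (expi _ * (expR _)%:C%C); first by ring.
    by rewrite dotpZl dotpZr; ring.
  congr cint; apply/funext => x.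
  rewrite /f mulrA -expiD -scalerBr dotpZl dotpZr mulrA mulVf ?gt_eqF// mul1r dotpDr dotpNr.
  congr (expi _ * (expR _)%:C%C); first by ring.
  by rewrite dotpZl dotpZr; ring.
congr (_ * _); rewrite cint_affine ?gt_eqF// cint_gaussian1 -rmorphM/=; congr (_%:C)%C.
rewrite gtr0_norm// expr_div_n mulrA (mulrC (mu ^- n)); congr (_ * expR (- _)).
by rewrite dotpZl dotpZr; field; rewrite gt_eqF.
Qed.

(** A wave packet of frequency [xi0], centre [y0] and spatial width [mu^-1]. Its phase vanishes at
    [y0], so that the transform carries no other phase than that of the translation by [y0]; the
    cancellation of phases in [interaction_pointwise] relies on this. *)
Definition packet (mu : R) (xi0 y0 : 'rV[R]_n) x : R[i] :=
  expi (dotp xi0 (x - y0)) * (gaussian (mu ^+ 2 / 2) (x - y0))%:C%C.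

Lemma packetE mu xi0 y0 xi x : expi (- dotp xi x) * packet mu xi0 y0 x =
  expi (- dotp xi0 y0) * (expi (- dotp (xi - xi0) x) * (gaussian (mu ^+ 2 / 2) (x - y0))%:C%C).
Proof.
rewrite /packet !mulrA -!expiD; congr (expi _ * _).
by rewrite dotpDr dotpNr dotpDl dotpNl; ring.
Qed.

Lemma cintegrable_packet mu xi0 y0 xi : 0 < mu ->
  cintegrable lebesgue_rV (fun x => expi (- dotp xi x) * packet mu xi0 y0 x).
Proof.
move=> mu0; under eq_fun do rewrite packetE.
by apply: cintegrableZ; apply: cintegrable_gaussian; rewrite divr_gt0// exprn_gt0.
Qed.

Lemma fourier_packet mu xi0 y0 xi : 0 < mu ->
  fourier (packet mu xi0 y0) xi = expi (- dotp xi y0) *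
    ((Num.sqrt (2 * pi) / mu) ^+ n * gaussian ((2 * mu ^+ 2)^-1) (xi - xi0))%:C%C.
Proof.
move=> mu0; rewrite /fourier.
rewrite (_ : (fun x => _) = fun x => expi (- dotp xi0 y0) *
  (expi (- dotp (xi - xi0) x) * (gaussian (mu ^+ 2 / 2) (x - y0))%:C%C)); last first.
  by apply/funext => x; exact: packetE.
rewrite -[LHS]/(cint _ _) cintZ; last first.
  by apply: cintegrable_gaussian; rewrite divr_gt0// exprn_gt0.
rewrite -[cint _ _]/(cintegral _) cint_gaussian// mulrA -expiD; congr (expi _ * _).
by rewrite dotpDl dotpNl; ring.
Qed.

Lemma normc_packet mu xi0 y0 x : Normc.normc (packet mu xi0 y0 x) =
  gaussian (mu ^+ 2 / 2) (x - y0).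
Proof. by rewrite Normc.normcM normc_expi mul1r normc_real ger0_norm// gaussian_ge0. Qed.

End gaussian.

(** * Continuous functions are measurable for the coordinate sigma-algebra *)

Section continuous_rV.
Context {R : realType} {n : nat}.

(** The topology is that of the sup norm, whose balls are boxes, and an open set is the union of the
    countably many rational boxes that it contains. *)
Lemma open_rV_measurable (U : set 'rV[R]_n) : open U -> measurable U.
Proof.
move=> oU.
pose box (p : 'rV[rat]_n * 'rV[rat]_n) : set 'rV[R]_n :=
  [set x | forall i, ratr (p.1 ord0 i) < x ord0 i < ratr (p.2 ord0 i)].
have mbox p : measurable (box p).
  rewrite (_ : box p = \bigcap_(i in [set: 'I_n])
      (rV_coord i @^-1` `](ratr (p.1 ord0 i)), (ratr (p.2 ord0 i))[%classic)).
    apply: fin_bigcap_measurable; first exact: finite_finset.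
    by move=> i _; rewrite -[X in measurable X]setTI; exact: measurable_rV_coord.
  apply/seteqP; split => x; first by move=> h i _; rewrite /= in_itv/=; exact: h.
  by move=> h i; have := h i Logic.I; rewrite /= in_itv/=.
pose F p := if `[< box p `<=` U >] then box p else set0.
have -> : U = \bigcup_p F p.
  apply/seteqP; split => [x Ux|x [p _]]; last first.
    by rewrite /F; case: asboolP => // + px; apply.
  have /nbhs_ballP[e /= e0 eU] : nbhs x U by exact: open_nbhs_nbhs.
  have h1 i : exists q : rat, ratr q \in `](x ord0 i - e), (x ord0 i)[.
    by apply: rat_in_itvoo; rewrite ltrBlDr ltrDl.
  have h2 i : exists q : rat, ratr q \in `](x ord0 i), (x ord0 i + e)[.
    by apply: rat_in_itvoo; rewrite ltrDl.
  pose p := (\row_i projT1 (cid (h1 i)), \row_i projT1 (cid (h2 i))).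
  exists p => //; rewrite /F; case: asboolP => [_|]; last first.
    case=> y yp; apply: eU; split => // i j; rewrite (ord1 i) /ball/=.
    have := yp j; rewrite !mxE.
    case: (cid (h1 j)) => q1 /=; case: (cid (h2 j)) => q2 /=; rewrite !in_itv/=.
    by rewrite ltr_norml; lra.
  move=> i; rewrite !mxE.
  case: (cid (h1 i)) => q1 /=; case: (cid (h2 i)) => q2 /=; rewrite !in_itv/=; lra.
apply: countable_bigcupT_measurable; first exact: countableP.
by move=> p; rewrite /F; case: asboolP.
Qed.

Lemma continuous_rV_measurable (f : 'rV[R]_n -> R) :
  continuous f -> measurable_fun setT f.
Proof.
move=> cf.
suff : measurable_fun setT (f : 'rV[R]_n -> measurableTypeR R) by [].
apply: (measurability (RGenOInfty.G (R:=R)) (RGenOInfty.measurableE R)).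
move=> _ [_ [a ->] <-]; rewrite setTI; apply: open_rV_measurable.
by apply: open_comp => [x _|]; [exact: cf|exact: interval_open].
Qed.

Lemma cmeas_smooth (f : 'rV[R]_n -> R[i]) : smooth f -> cmeas f.
Proof.
by move=> [s1 s2]; split; apply: continuous_rV_measurable;
  [exact: (proj1 (s1 [::]))|exact: (proj1 (s2 [::]))].
Qed.

End continuous_rV.

Section line_derivative.
Context {R : realType} {n : nat}.
Implicit Types (x v : 'rV[R]_n) (f : 'rV[R]_n -> R).

Lemma is_derive_line f x v d :
  is_derive (0 : R) 1 (fun t => f (t *: v + x)) d -> is_derive x v f d.
Proof.
move=> [df dE].
have E : (fun h : R => h^-1 *: (f (h *: v + x) - f x)) =
    (fun h => h^-1 *: ((fun t => f (t *: v + x)) (h *: 1 + 0) - (fun t => f (t *: v + x)) 0)).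
  by apply/funext => h; rewrite [h *: 1]mulr1 addr0 scale0r add0r.
by split; [rewrite /derivable E|rewrite -dE /derive E].
Qed.

Lemma is_derive_line1 f x v (h : R) (d : R) :
  is_derive (h *: v + x) v f d -> is_derive h 1 (fun t => f (t *: v + x)) d.
Proof.
move=> [df dE].
have E : (fun k : R => k^-1 *: (f (k *: v + (h *: v + x)) - f (h *: v + x))) =
    (fun k => k^-1 *: ((fun t => f (t *: v + x)) (k *: 1 + h) - (fun t => f (t *: v + x)) h)).
  by apply/funext => k; rewrite [k *: 1]mulr1 scalerDl addrA.
by split; [rewrite /derivable -E|rewrite -dE /derive -E].
Qed.

End line_derivative.

(** * Packets are Schwartz functions *)

Section gaussian_class.
Context {R : realType} {n : nat}.
Implicit Types (x y xi : 'rV[R]_n).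

Definition osc_gaussian (a c : R) xi y x : R :=
  cos (dotp xi x + c) * gaussian a (x - y).

(** A class stable under partial derivatives and made of rapidly decreasing functions: one induction
    for each property gives the Schwartz bounds, without a formula for higher derivatives. The phase
    [c] admits sines, hence real and imaginary parts alike; multiplication by a coordinate comes
    from differentiating the exponent. *)
Inductive gaussian_class : ('rV[R]_n -> R) -> Prop :=
| gc_base a c xi y : 0 < a -> gaussian_class (osc_gaussian a c xi y)
| gc_scale k u : gaussian_class u -> gaussian_class (fun x => k * u x)
| gc_coord i u : gaussian_class u -> gaussian_class (fun x => x ord0 i * u x)
| gc_add u v : gaussian_class u -> gaussian_class v -> gaussian_class (fun x => u x + v x).

Lemma dotp_delta x i : dotp x (delta_mx ord0 i) = x ord0 i.
Proof.
rewrite /dotp (bigD1 i)//= mxE !eqxx mulr1 big1 ?addr0// => j ji.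
by rewrite mxE eqxx (negbTE ji) mulr0.
Qed.

Lemma is_derive_osc_gaussian a c xi y i x :
  is_derive x (delta_mx ord0 i) (osc_gaussian a c xi y)
    ((- 2 * a) * (x ord0 i * osc_gaussian a c xi y x) +
      ((2 * a * y ord0 i) * osc_gaussian a c xi y x +
       xi ord0 i * osc_gaussian a (c + pi / 2) xi y x)).
Proof.
apply: is_derive_line.
pose A := xi ord0 i; pose C := dotp xi x + c.
pose q := - (2 * a * (x ord0 i - y ord0 i)); pose r := - (a * dotp (x - y) (x - y)).
rewrite (_ : (fun t : R => osc_gaussian _ _ _ _ (t *: _ + x)) =
  fun t => cos (A * t + C) * expR (- a * t ^+ 2 + q * t + r)); last first.
  apply/funext => t; rewrite /osc_gaussian /gaussian; congr (cos _ * expR _).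
    by rewrite dotpDr dotpZr dotp_delta /A /C; ring.
  rewrite -addrA dotpDD !dotpZl !dotpZr dotp_delta (dotpC (delta_mx _ _)) dotp_delta.
  by rewrite !mxE !eqxx /= /q /r; ring.
apply: (is_derive_eq (is_derive_cosgauss A C (- a) q r 0)).
rewrite /osc_gaussian /gaussian mulr0 add0r expr0n/= !mulr0 !add0r.
rewrite (addrA (dotp xi x) c) cosDpihalf -/r -/C /A /q; ring.
Qed.

Lemma is_derive_coord i j x : is_derive x (delta_mx ord0 i) (fun x : 'rV[R]_n => x ord0 j)
  ((j == i)%:R).
Proof.
apply: is_derive_line.
rewrite (_ : (fun t : R => _) = fun t => (j == i)%:R * t + x ord0 j); last first.
  by apply/funext => t; rewrite !mxE eqxx/= mulrC.
exact: is_derive_affine.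
Qed.

Lemma continuous_coord (i : 'I_n) : continuous (fun x : 'rV[R]_n => x ord0 i).
Proof. exact: coord_continuous. Qed.

Lemma continuous_dotp (f g : 'rV[R]_n -> 'rV[R]_n) :
  (forall i, continuous (fun x => f x ord0 i)) ->
  (forall i, continuous (fun x => g x ord0 i)) -> continuous (fun x => dotp (f x) (g x)).
Proof.
move=> cf cg x; rewrite /dotp.
elim: (index_enum _) => [|i r ih].
  rewrite (_ : (fun x0 => _) = cst 0); first exact: cst_continuous.
  by apply/funext => z; rewrite big_nil.
rewrite (_ : (fun x0 => _) = fun z => f z ord0 i * g z ord0 i +
    \sum_(j <- r) f z ord0 j * g z ord0 j); last first.
  by apply/funext => z; rewrite big_cons.
exact: (continuousD (continuousM (cf i x) (cg i x)) ih).
Qed.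

Lemma gaussian_class_continuous u : gaussian_class u -> continuous u.
Proof.
elim=> {u} [a c xi y a0|k u _ cu|i u _ cu|u v _ cu _ cv] x.
- have c1 : continuous (fun x => dotp xi x).
    by apply: continuous_dotp => i; [exact: cst_continuous|exact: continuous_coord].
  have h i : continuous (fun x => (x - y) ord0 i).
    move=> z; rewrite (_ : (fun x => _) = fun x => x ord0 i - y ord0 i).
      exact: (continuousB (@continuous_coord i z) (@cst_continuous _ _ (y ord0 i) z)).
    by apply/funext => ?; rewrite !mxE.
  have c2 := continuous_dotp h h.
  have d1 := continuousD (c1 x) (@cst_continuous _ _ c x).
  have d2 := continuousN (continuousM (@cst_continuous _ _ a x) (c2 x)).
  exact: (continuousM (continuous_comp d1 (@continuous_cos R _))
    (continuous_comp d2 (@continuous_expR R _))).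
- exact: (continuousM (@cst_continuous _ _ k x) (cu x)).
- exact: (continuousM (@continuous_coord i x) (cu x)).
- exact: (continuousD (cu x) (cv x)).
Qed.

Lemma gaussian_class_derive u i : gaussian_class u ->
  exists2 v, gaussian_class v & forall x, is_derive x (delta_mx ord0 i) u (v x).
Proof.
elim=> {u} [a c xi y a0|k u gu [v gv uv]|j u gu [v gv uv]|u v _ [u' gu uu] _ [v' gv vv]].
- eexists; last by move=> x; exact: is_derive_osc_gaussian.
  apply: gc_add; first by apply: gc_scale; apply: gc_coord; exact: gc_base.
  by apply: gc_add; apply: gc_scale; exact: gc_base.
- exists (fun x => k * v x); first exact: gc_scale.
  by move=> x; exact: (is_deriveZ k (uv x)).
- exists (fun x => x ord0 j * v x + (j == i)%:R * u x).
    by apply: gc_add; [exact: gc_coord|exact: gc_scale].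
  move=> x; apply: (is_derive_eq (is_deriveM (is_derive_coord i j x) (uv x))).
  by rewrite /GRing.scale/= [u x * _]mulrC.
- exists (fun x => u' x + v' x); first exact: gc_add.
  by move=> x; exact: (is_deriveD (uu x) (vv x)).
Qed.

Lemma gaussian_class_partials s u : gaussian_class u -> gaussian_class (partials s u).
Proof.
move=> gu; elim: s => [//|i s ih] /=.
have [v gv uv] := gaussian_class_derive i ih.
rewrite (_ : (fun x => _) = v)//; apply/funext => x.
by have := uv x; move=> ?; rewrite derive_val.
Qed.

Lemma gaussian_class_smooth u : gaussian_class u -> smooth_real u.
Proof.
move=> gu s; have gs := gaussian_class_partials s gu; split.
  exact: gaussian_class_continuous.
move=> i x; have [v _ uv] := gaussian_class_derive i gs.
by have [] := uv x.
Qed.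

(** A single term of the exponential series, of degree [k.+1] in [t ^+ 2], suffices, because
    [t ^+ k <= 1 + (t ^+ 2) ^+ k.+1]. *)
Lemma pow_expR_bound k (a : R) : 0 < a ->
  exists C, forall t, 0 <= t -> t ^+ k * expR (- (a * t ^+ 2)) <= C.
Proof.
move=> a0; exists (1 + k.+1`!%:R / a ^+ k.+1) => t t0.
have E0 := expR_gt0 (a * t ^+ 2).
rewrite expRN ler_pdivrMr//.
have ak : 0 < a ^+ k.+1 by rewrite exprn_gt0.
have fk : 0 < k.+1`!%:R :> R by rewrite ltr0n fact_gt0.
have h : 1 + (a * t ^+ 2) ^+ k.+1 / k.+1`!%:R <= expR (a * t ^+ 2).
  by apply: expR_ge1Dxn; rewrite mulr_ge0 ?sqr_ge0// ltW.
have h1 : t ^+ k <= 1 + (t ^+ 2) ^+ k.+1.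
  have [t1|t1] := leP t 1.
    by rewrite (le_trans (exprn_ile1 k t0 t1))// lerDl exprn_ge0// sqr_ge0.
  rewrite -exprM (@le_trans _ _ (t ^+ (2 * k.+1)))//.
    apply: ler_weXn2l; first exact: ltW.
    by rewrite mul2n -addnn addSnnS -addSnnS leqW// leq_addr.
  by rewrite lerDr.
rewrite mulrDl mul1r (le_trans h1)// lerD//.
  by rewrite (le_trans _ h)// lerDl divr_ge0 ?exprn_ge0 ?mulr_ge0 ?sqr_ge0 ?(ltW a0) ?(ltW fk).
rewrite exprMn in h.
rewrite [leLHS](_ : _ = k.+1`!%:R / a ^+ k.+1 * (a ^+ k.+1 * (t ^+ 2) ^+ k.+1 / k.+1`!%:R)).
  apply: ler_wpM2l; first by rewrite divr_ge0// ltW.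
  by apply: le_trans h; rewrite lerDr.
move: (t ^+ 2 ^+ k.+1) (a ^+ k.+1) (k.+1`!%:R) ak fk => T A F A0 F0.
by field; rewrite !gt_eqF.
Qed.

Lemma gaussian_decay k (a : R) y : 0 < a ->
  exists C, forall x, (1 + enorm x) ^+ k * gaussian a (x - y) <= C.
Proof.
move=> a0; have [C hC] := pow_expR_bound k (divr_gt0 a0 (ltr0n R 2)).
exists ((1 + enorm y) ^+ k * (expR a * C)) => x.
have y0 := enorm_ge0 y; have xy0 := enorm_ge0 (x - y).
apply: (@le_trans _ _ (((1 + enorm y) * (1 + enorm (x - y))) ^+ k * gaussian a (x - y))).
  apply: ler_wpM2r; first exact: gaussian_ge0.
  rewrite lerXn2r ?nnegrE ?addr_ge0 ?mulr_ge0 ?addr_ge0 ?enorm_ge0//.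
  have := enormD (x - y) y; rewrite subrK; have := mulr_ge0 y0 xy0; lra.
rewrite exprMn -mulrA ler_wpM2l ?exprn_ge0 ?addr_ge0//.
rewrite /gaussian -enorm_sqr; set t := enorm (x - y).
have t1 : 0 <= 1 + t by rewrite addr_ge0.
(* [(1 + t)^2 <= 2 + 2 * t^2] trades [t] for [1 + t] in the exponent, with [a / 2] for [a], as in
   the choice of [C]. *)
apply: (@le_trans _ _ ((1 + t) ^+ k * (expR a * expR (- (a / 2 * (1 + t) ^+ 2))))).
  apply: ler_wpM2l; first by rewrite exprn_ge0.
  by rewrite -expRD ler_expR; have := sqr_ge0 (1 - t); rewrite sqrrB sqrrD; nra.
by rewrite mulrCA ler_wpM2l ?expR_ge0// hC.
Qed.

Lemma gaussian_class_decay u k : gaussian_class u ->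
  exists C, forall x, (1 + enorm x) ^+ k * `|u x| <= C.
Proof.
move=> gu; elim: gu k => {u} [a c xi y a0|b u _ ih|i u _ ih|u v _ ihu _ ihv] k.
- have [C hC] := gaussian_decay k y a0; exists C => x; apply: le_trans (hC x).
  apply: ler_wpM2l; first by rewrite exprn_ge0// addr_ge0// enorm_ge0.
  rewrite /osc_gaussian normrM (ger0_norm (gaussian_ge0 _ _)) ler_piMl ?gaussian_ge0//.
  by rewrite ler_norml cos_geN1 cos_le1.
- have [C hC] := ih k; exists (`|b| * C) => x.
  by rewrite normrM mulrCA ler_wpM2l.
- have [C hC] := ih k.+1; exists C => x; apply: le_trans (hC x).
  rewrite normrM mulrA exprSr ler_wpM2r// ler_wpM2l ?exprn_ge0 ?addr_ge0 ?enorm_ge0//.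
  by rewrite (le_trans (enorm_coord x i))// lerDr.
- have [C hC] := ihu k; have [D hD] := ihv k; exists (C + D) => x.
  apply: le_trans (lerD (hC x) (hD x)).
  by rewrite -mulrDr ler_wpM2l ?ler_normD// exprn_ge0// addr_ge0// enorm_ge0.
Qed.

Definition cgaussian_class (f : 'rV[R]_n -> R[i]) :=
  gaussian_class (fun x => complex.Re (f x)) /\ gaussian_class (fun x => complex.Im (f x)).

Lemma cgaussian_class_schwartz f : cgaussian_class f -> schwartz f.
Proof.
move=> [g1 g2]; split; first by split; exact: gaussian_class_smooth.
move=> k s.
have [C hC] := gaussian_class_decay k (gaussian_class_partials s g1).
have [D hD] := gaussian_class_decay k (gaussian_class_partials s g2).
exists (C + D) => x; apply: le_trans (lerD (hC x) (hD x)).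
rewrite -mulrDr ler_wpM2l ?exprn_ge0 ?addr_ge0 ?enorm_ge0//.
exact: normc_le_ReIm.
Qed.

Lemma cgaussian_classD f g : cgaussian_class f -> cgaussian_class g ->
  cgaussian_class (fun x => f x + g x).
Proof.
move=> [f1 f2] [g1 g2]; split.
- by under eq_fun do rewrite ReD; exact: gc_add.
- by under eq_fun do rewrite ImD; exact: gc_add.
Qed.

Lemma cgaussian_classZ (k : R) f : cgaussian_class f ->
  cgaussian_class (fun x => k%:C%C * f x).
Proof.
move=> [f1 f2]; split.
- by under eq_fun do rewrite ReM/= mul0r subr0; exact: gc_scale.
- by under eq_fun do rewrite ImM/= mul0r addr0; exact: gc_scale.
Qed.

Lemma cgaussian_class_packet mu xi0 y0 : 0 < mu -> cgaussian_class (packet mu xi0 y0).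
Proof.
move=> mu0; have a0 : 0 < mu ^+ 2 / 2 by rewrite divr_gt0// exprn_gt0.
split.
- rewrite (_ : (fun x => _) = osc_gaussian (mu ^+ 2 / 2) (- dotp xi0 y0) xi0 y0); first exact: gc_base.
  by apply/funext => x; rewrite ReM/= mulr0 subr0 dotpDr dotpNr.
- rewrite (_ : (fun x => _) = osc_gaussian (mu ^+ 2 / 2) (- dotp xi0 y0 - pi / 2) xi0 y0).
    exact: gc_base.
  by apply/funext => x; rewrite ImM/= mulr0 add0r dotpDr dotpNr /osc_gaussian addrA cosBpihalf.
Qed.

Lemma cgaussian_class0 : cgaussian_class (fun=> 0).
Proof.
have h : gaussian_class (fun _ : 'rV[R]_n => 0).
  have := gc_scale 0 (gc_base (a := 1 : R) 0 0 0 ltr01).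
  by under eq_fun do rewrite mul0r.
by split.
Qed.

Lemma cgaussian_class_sum I (r : seq I) (F : I -> 'rV[R]_n -> R[i]) :
  (forall i, cgaussian_class (F i)) -> cgaussian_class (fun x => \sum_(i <- r) F i x).
Proof.
move=> gF; elim: r => [|i r ih].
  by under eq_fun do rewrite big_nil; exact: cgaussian_class0.
by under eq_fun do rewrite big_cons; exact: cgaussian_classD.
Qed.

End gaussian_class.

(** * An integrable majorant for maximal functions *)

Section hardy.
Context {R : realType}.
Local Notation normc := (@Normc.normc R).

(** Spares a proof that the maximal function, a supremum over uncountably many [t], is measurable:
    the integral of a nonnegative function is a supremum over the simple functions below it, hence
    monotone in any case. *)
Lemma ge0_le_integral_nonmeasurable d (T : measurableType d)
    (mu : {measure set T -> \bar R}) (f g : T -> \bar R) :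
  (forall x, 0 <= f x)%E -> (forall x, f x <= g x)%E ->
  (\int[mu]_x f x <= \int[mu]_x g x)%E.
Proof.
move=> f0 fg; rewrite !ge0_integralTE//; last by move=> x; exact: le_trans (fg x).
apply: ereal_sup_le => _ [h hf <-]; exists h => // x.
exact: le_trans (hf x) (fg x).
Qed.

Lemma dyadic_bracket (t : R) : 1 <= t -> exists k, t <= 2 ^+ k <= 2 * t.
Proof.
move=> t1.
have ex : exists k, t <= 2 ^+ k.
  exists (Num.bound t); rewrite ltW// (lt_le_trans (archi_boundP _)) ?(le_trans _ t1)//.
  by rewrite -natrX ler_nat ltnW// ltn_expl.
exists (ex_minn ex); case: ex_minnP => k tk kmin; rewrite tk/=.
case: k tk kmin => [|k] tk kmin; first by rewrite expr0; lra.
rewrite exprS ler_pM2l//; have [tk'|/ltW//] := leP t (2 ^+ k).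
by have := kmin k tk'; rewrite ltnn.
Qed.

Context {n : nat}.
Implicit Types (x y z : 'rV[R]_n).

(** [n.+1] is the least integer exponent that makes the weight integrable. It is also the decay of
    the maximal function of an atom of mean zero: dilation contributes [t ^- n], cancellation one
    more power of [t]. *)
Definition hardy_weight x : R := (1 + enorm x) ^- n.+1.

Lemma hardy_weight_ge0 x : 0 <= hardy_weight x.
Proof. by rewrite invr_ge0 exprn_ge0// addr_ge0// enorm_ge0. Qed.

Lemma measurable_hardy_weight : measurable_fun setT hardy_weight.
Proof.
rewrite (_ : hardy_weight = fun x => (1 + enorm x)^-1 ^+ n.+1); last first.
  by apply/funext => x; rewrite /hardy_weight exprVn.
apply: measurable_funX.
rewrite (_ : (fun x => _) = fun x => expR (- ln (1 + enorm x))); last first.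
  by apply/funext => x; rewrite expRN lnK// posrE ltr_wpDr// enorm_ge0.
have me : measurable_fun setT (@expR R) by exact: measurable_expR.
have ml : measurable_fun setT (@ln R) by exact: measurable_ln.
have mx : measurable_fun setT (fun x : 'rV[R]_n => 1 + enorm x).
  by apply: measurable_funD => //; exact: measurable_enorm.
exact: (measurableT_comp me (measurable_funN (measurableT_comp ml mx))).
Qed.

(* Dyadic shells, with Gaussians at scale [2^k] in place of the indicator of a ball. *)
Lemma integrable_hardy_weight : lebesgue_rV.-integrable setT (EFin \o hardy_weight).
Proof.
apply/integrableP; split; first by apply/measurable_EFinP; exact: measurable_hardy_weight.
under eq_integral do rewrite /= ger0_norm ?hardy_weight_ge0//.
(* For [1 + enorm x <= 2 ^+ k <= 2 * (1 + enorm x)] the Gaussian at scale [2 ^+ k] is at least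
   [expR (-1)] at [x], and [2 ^+ n.+1] pays for the factor 2 in the bracket. *)
pose D : R := 2 ^+ n.+1 * expR 1.
have D0 : 0 <= D by rewrite mulr_ge0 ?expR_ge0.
pose u k x : R := D * 2 ^- (k * n.+1) * gaussian (2 ^- (k * 2)) x.
have u0 k x : 0 <= u k x.
  by apply: mulr_ge0; [apply: mulr_ge0 => //; rewrite invr_ge0 exprn_ge0|exact: gaussian_ge0].
apply: (@le_lt_trans _ _ (\int[lebesgue_rV]_x \sum_(k <oo) (u k x)%:E)%E).
  apply: ge0_le_integral_nonmeasurable => x; first by rewrite lee_fin hardy_weight_ge0.
  have x1 : 1 <= 1 + enorm x by rewrite lerDl enorm_ge0.
  have [k /andP[k1 k2]] := dyadic_bracket x1.
  apply: (@le_trans _ _ (u k x)%:E); last first.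
    apply: le_trans (nneseries_lim_ge k.+1 _); last by move=> i _ _; rewrite lee_fin.
    rewrite big_nat_recr//= leeDr// sume_ge0// => i _.
    by rewrite lee_fin.
  rewrite lee_fin /hardy_weight /u /D.
  have p0 : 0 < (2 : R) ^+ k by rewrite exprn_gt0.
  have e1 : expR (-1) <= gaussian (2 ^- (k * 2)) x.
    rewrite ler_expR lerN2 -enorm_sqr exprM -exprVn -exprMn expr_le1//.
      by rewrite ler_pdivrMl// mulr1; lra.
    by rewrite mulr_ge0 ?enorm_ge0// invr_ge0 ltW.
  have e2 : (1 + enorm x) ^- n.+1 <= 2 ^+ n.+1 * 2 ^- (k * n.+1).
    have h0 : 0 < 1 + enorm x by rewrite (lt_le_trans ltr01).
    have h1 : 0 <= (1 + enorm x)^-1 by rewrite invr_ge0 ltW.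
    have h2 : 0 <= 2 / 2 ^+ k :> R by rewrite divr_ge0// ltW.
    rewrite exprM -expr_div_n -exprVn lerXn2r ?nnegrE//.
    by rewrite ler_pdivlMr// mulrC ler_pdivrMr// mulrC.
  apply: (le_trans e2); rewrite -[leRHS]mulrA [leRHS]mulrACA ler_peMr//.
  by rewrite -ler_pdivrMl ?expR_gt0// mulr1 -expRN.
rewrite integral_nneseries//; last 2 first.
- move=> k; apply/measurable_EFinP; apply: measurable_funM => //.
  exact: measurable_gaussian.
- by move=> k x _; rewrite lee_fin.
pose C : R := D * Num.sqrt pi ^+ n * 2.
(* The summand 0 puts the geometric series in the form bounded by [epsilon_trick]. *)
apply: (@le_lt_trans _ _ (\sum_(k <oo) (0 + (C / (2 ^ k.+1)%:R)%:E))%E).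
  apply: lee_nneseries => k _.
    by move=> _; apply: integral_ge0 => x _; rewrite lee_fin.
  rewrite add0e /u; under eq_integral do rewrite EFinM.
  rewrite ge0_integralZl//; last 3 first.
  - by apply/measurable_EFinP; exact: measurable_gaussian.
  - by move=> x _; rewrite lee_fin gaussian_ge0.
  - by rewrite lee_fin mulr_ge0// invr_ge0.
  rewrite integral_gaussian ?invr_gt0 ?exprn_gt0// -EFinM lee_fin.
  have -> : Num.sqrt (2 ^- (k * 2) : R) = 2 ^- k.
    by rewrite exprM -exprVn sqrtr_sqr ger0_norm// invr_ge0 exprn_ge0.
  rewrite invrK exprMn natrX /C mulnS exprD exprS [2 ^+ (k * n)]exprM.
  have P0 : 2 ^+ k != 0 :> R by rewrite expf_neq0.
  have Q0 : 2 ^+ k ^+ n != 0 :> R by rewrite expf_neq0.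
  rewrite le_eqVlt; apply/orP; left; apply/eqP.
  by field; rewrite P0 Q0.
apply: (@le_lt_trans _ _ (\sum_(k <oo) 0 + C%:E)%E); last by rewrite eseries0// add0e ltry.
by apply: epsilon_trick => //; rewrite !mulr_ge0// exprn_ge0// sqrtr_ge0.
Qed.

End hardy.

Section cintB.
Context d (T : measurableType d) {R : realType}.
Variable mu : {measure set T -> \bar R}.
Implicit Types f g : T -> R[i].

Lemma cintegrableB f g : cintegrable mu f -> cintegrable mu g ->
  cintegrable mu (fun x => f x - g x).
Proof.
move=> cf cg; have := cintegrableD cf (cintegrableZ (-1) cg).
by under eq_fun do rewrite mulN1r.
Qed.

Lemma cintB f g : cintegrable mu f -> cintegrable mu g ->
  cint mu (fun x => f x - g x) = cint mu f - cint mu g.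
Proof.
move=> cf cg; have := cintD cf (cintegrableZ (-1) cg).
by under eq_fun do rewrite mulN1r; rewrite cintZ// mulN1r.
Qed.

End cintB.

(** * A dilated atom whose Hardy norm is bounded uniformly in the dilation *)

Section hardy_atom.
Context {R : realType} {n : nat}.
Variable i0 : 'I_n.
Variable Phi : 'rV[R]_n -> R[i].
Hypothesis Phi_schwartz : schwartz Phi.
Local Notation normc := (@Normc.normc R).
Implicit Types (x y z : 'rV[R]_n).

Let a : 'rV[R]_n := delta_mx ord0 i0.

Definition atom_half x : R := gaussian 2^-1 x - gaussian 2^-1 (x + a).

(** A second difference of a Gaussian along a coordinate axis. Its transform is a Gaussian times
    [2 - 2 * cos]: free of any phase of its own, and zero at the origin. Written as a difference of
    translates of [atom_half], it lets one difference be moved onto [Phi]. *)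
Definition atom x : R := atom_half x - atom_half (x - a).

Let enorm_a : enorm a = 1.
Proof. by rewrite /enorm dotp_delta mxE !eqxx sqrtr1. Qed.

Let one_enorm_gt0 x : 0 < 1 + enorm x.
Proof. by rewrite ltr_wpDr// enorm_ge0. Qed.

Lemma atom_half_decay k : exists C, forall x, (1 + enorm x) ^+ k * `|atom_half x| <= C.
Proof.
have [C hC] := @gaussian_decay R n k 2^-1 0 ltac:(by rewrite invr_gt0).
have [D hD] := @gaussian_decay R n k 2^-1 (- a) ltac:(by rewrite invr_gt0).
exists (C + D) => x; apply: le_trans (lerD (hC x) (hD x)).
rewrite -mulrDr ler_wpM2l ?exprn_ge0 ?(ltW (one_enorm_gt0 x))//.
rewrite (le_trans (ler_normB _ _))// subr0 opprK.
by rewrite !ger0_norm ?gaussian_ge0.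
Qed.

Lemma atom_decay k : exists C, forall x, (1 + enorm x) ^+ k * `|atom x| <= C.
Proof.
have [C hC] := atom_half_decay k; exists (C + 2 ^+ k * C) => x.
apply: le_trans (lerD (hC x) (ler_wpM2l _ (hC (x - a)))) => //.
rewrite mulrA -exprMn; apply: (@le_trans _ _ ((1 + enorm x) ^+ k * (`|atom_half x| + `|atom_half (x - a)|))).
  by rewrite ler_wpM2l ?exprn_ge0 ?(ltW (one_enorm_gt0 x))//; exact: ler_normB.
rewrite mulrDr lerD2l ler_wpM2r//.
rewrite lerXn2r ?nnegrE ?mulr_ge0 ?(ltW (one_enorm_gt0 _))//.
have := enormD (x - a) a; rewrite subrK enorm_a; have := enorm_ge0 (x - a); lra.
Qed.

Lemma measurable_atom_half : measurable_fun setT atom_half.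
Proof.
apply: measurable_funB; first exact: measurable_gaussian.
by apply: measurable_gaussian; exact: measurable_rVD.
Qed.

Lemma measurable_atom : measurable_fun setT atom.
Proof.
apply: measurable_funB; first exact: measurable_atom_half.
have m : measurable_fun setT (fun x : 'rV[R]_n => x - a) by exact: measurable_rVD.
exact: (measurableT_comp measurable_atom_half m).
Qed.

(** Mean value theorem along [a]. The segment has length at most 1, so the weight at [x] exceeds
    that at the intermediate point by a factor of at most [2 ^+ k]. *)
Lemma smooth_difference (u : 'rV[R]_n -> R) (K : R) (k : nat) : smooth_real u ->
  (forall x, (1 + enorm x) ^+ k * `|partials [:: i0] u x| <= K) ->
  forall s x, 0 < s -> s <= 1 ->
  (1 + enorm x) ^+ k * `|u x - u (x - s *: a)| <= s * (2 ^+ k * K).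
Proof.
move=> su hK s x s0 s1.
have du y : is_derive y a u (partials [:: i0] u y).
  by apply: DeriveDef => //; have [_ /(_ i0 y)] := su [::].
pose phi (r : R) := u (r *: a + (x - s *: a)).
have dphi r : r \in `]0, s[ -> is_derive r 1 phi (partials [:: i0] u (r *: a + (x - s *: a))).
  by move=> _; apply: is_derive_line1.
have cphi : {within `[0, s], continuous phi}.
  by apply: derivable_within_continuous => r _; have [] := is_derive_line1 (du (r *: a + (x - s *: a))).
have [r /[!in_itv]/= rs] := MVT s0 dphi cphi.
rewrite /phi scale0r add0r addrCA subrr addr0 subr0 => ->.
set y := r *: a + _.
have xy : 1 + enorm x <= 2 * (1 + enorm y).
  have -> : x = y + (s - r) *: a.
    by apply/rowP => j; rewrite !mxE; ring.
  have := enormD y ((s - r) *: a); rewrite enormZ enorm_a mulr1 ger0_norm; last lra.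
  have := enorm_ge0 y; lra.
rewrite normrM (ger0_norm (ltW s0)) mulrA mulrC ler_wpM2l ?(ltW s0)//.
apply: le_trans (ler_wpM2l _ (hK y)); last by rewrite exprn_ge0.
rewrite mulrA -exprMn ler_wpM2r// lerXn2r ?nnegrE ?(ltW (one_enorm_gt0 x))//.
by rewrite mulr_ge0// (ltW (one_enorm_gt0 _)).
Qed.

Let one_enormD x y : 1 + enorm x <= (1 + enorm (x - y)) * (1 + enorm y).
Proof.
have := enormD (x - y) y; rewrite subrK.
have := mulr_ge0 (enorm_ge0 (x - y)) (enorm_ge0 y); lra.
Qed.

Let weight_mul x y : hardy_weight (x - y) * hardy_weight y <= hardy_weight x.
Proof.
rewrite /hardy_weight -invfM -exprMn lef_pV2 ?posrE ?exprn_gt0 ?mulr_gt0 ?one_enorm_gt0//.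
by rewrite lerXn2r ?nnegrE ?mulr_ge0 ?(ltW (one_enorm_gt0 _)).
Qed.

Let dilE t x y : dilation t Phi (x - y) = (t ^- n)%:C%C * Phi (- t^-1 *: y + t^-1 *: x).
Proof. by rewrite /dilation scalerBr scaleNr addrC. Qed.

Let cmeas_dil t x : cmeas (fun y => dilation t Phi (x - y)).
Proof.
under eq_fun do rewrite dilE.
apply: cmeasM; first exact: cmeas_cst.
exact: (cmeas_comp (cmeas_smooth Phi_schwartz.1) (measurable_rV_affine (- t^-1) (t^-1 *: x))).
Qed.

Let bounded_le (u : 'rV[R]_n -> R) (C : R) (k : nat) : (forall x, (1 + enorm x) ^+ k * u x <= C) ->
  forall x, u x <= C / (1 + enorm x) ^+ k.
Proof. by move=> h x; rewrite ler_pdivlMr ?exprn_gt0 ?one_enorm_gt0// mulrC. Qed.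

(** For [t <= 1] no cancellation is used: the dilated [Phi] is at least as concentrated as [Phi],
    and the decay in [x] is that of [Phi] and of the atom together. *)
Lemma convolution_small : exists C, forall t x, 0 < t -> t <= 1 ->
  normc (convolution (dilation t Phi) (fun y => (atom y)%:C%C) x) <= C * hardy_weight x.
Proof.
(* Two weights are asked of [Phi]. One is integrated in [z y], where the Jacobian [t ^+ n] cancels
   [t ^- n]; the other becomes a weight in [x - y], since [t <= 1], and joins that of the atom in
   [weight_mul]. *)
have [K0 hK0'] := proj2 Phi_schwartz (n.+1 + n.+1)%N [::].
have hK0 x : (1 + enorm x) ^+ (n.+1 + n.+1) * normc (Phi x) <= K0.
  by rewrite [Phi x]complex_eta; exact: hK0'.
have [K2 hK2] := atom_decay n.+1.
have K0p : 0 <= K0.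
  by apply: le_trans (hK0 0); rewrite mulr_ge0 ?exprn_ge0 ?(ltW (one_enorm_gt0 _)) ?normc_ge0.
have K2p : 0 <= K2.
  by apply: le_trans (hK2 0); rewrite mulr_ge0 ?exprn_ge0 ?(ltW (one_enorm_gt0 _)).
exists (K0 * K2 * \int[lebesgue_rV]_x hardy_weight (x : 'rV[R]_n)) => t x t0 t1.
pose z y := - t^-1 *: y + t^-1 *: x.
pose g y := (K0 * K2 * hardy_weight x * t ^- n) * hardy_weight (z y).
have t'0 : - t^-1 != 0 by rewrite oppr_eq0 invr_eq0 gt_eqF.
have iw := integrable_affine (t^-1 *: x) t'0 (@integrable_hardy_weight R n).
have ig : lebesgue_rV.-integrable setT (EFin \o g).
  by have := integrableZl measurableT (K0 * K2 * hardy_weight x * t ^- n) iw; exact: eq_integrable.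
apply: (@le_trans _ _ (\int[lebesgue_rV]_y g y)).
  apply: normc_cint_le => //.
    by apply: cmeasM; [exact: cmeas_dil|apply: cmeas_real; exact: measurable_atom].
  move=> y; rewrite dilE !Normc.normcM !normc_real -/(z y).
  rewrite ger0_norm; last by rewrite invr_ge0 exprn_ge0// ltW.
  rewrite /g [leRHS]mulrAC [leRHS]mulrC -mulrA ler_wpM2l ?invr_ge0 ?exprn_ge0 ?(ltW t0)//.
  have h1 : normc (Phi (z y)) <= K0 * (hardy_weight (z y) * hardy_weight (z y)).
    rewrite /hardy_weight -invfM -exprD.
    exact: (bounded_le hK0).
  have h2 : `|atom y| <= K2 * hardy_weight y by exact: (bounded_le hK2).
  have h3 : hardy_weight (z y) <= hardy_weight (x - y).
    rewrite /hardy_weight lef_pV2 ?posrE ?exprn_gt0 ?one_enorm_gt0//.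
    rewrite lerXn2r ?nnegrE ?(ltW (one_enorm_gt0 _))// lerD2l.
    have -> : z y = t^-1 *: (x - y) by rewrite /z scaleNr addrC scalerBr.
    rewrite enormZ ger0_norm ?invr_ge0 ?(ltW t0)//.
    by rewrite ler_peMl ?enorm_ge0// invf_ge1.
  apply: (le_trans (ler_pM (normc_ge0 _) (normr_ge0 _) h1 h2)).
  rewrite mulrACA -[leRHS]mulrA ler_wpM2l ?mulr_ge0//.
  rewrite [leRHS]mulrC -mulrA ler_wpM2l ?hardy_weight_ge0//.
  by apply: le_trans (weight_mul x y); rewrite ler_wpM2r ?hardy_weight_ge0.
rewrite /g (@RintegralZl _ _ _ _ _ (fun y => hardy_weight (z y)))//.
rewrite (@Rintegral_comp_scaled _ _ _ lebesgue_rV z (t ^+ n))//.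
- rewrite -!mulrA [X in _ * (_ * X)]mulrCA mulrC -!mulrA [X in _ * (_ * X)]mulrA.
  rewrite le_eqVlt; apply/orP; left; apply/eqP.
  by field; rewrite expf_neq0// gt_eqF.
- move=> f mf f0; rewrite /z ge0_integral_affine// normrN gtr0_norm ?invr_gt0//.
  by rewrite exprVn invrK.
- exact: integrable_hardy_weight.
Qed.

(** For [t >= 1] the difference in the atom is moved onto the dilated [Phi], which varies at scale
    [t]. The mean value theorem gains [t^-1], and [t ^- n.+1] times the weight at [(x - y) / t] is
    at most the weight at [x - y]. *)
Lemma convolution_large : exists C, forall t x, 1 <= t ->
  normc (convolution (dilation t Phi) (fun y => (atom y)%:C%C) x) <= C * hardy_weight x.
Proof.
have [K0 hK0'] := proj2 Phi_schwartz 0%N [::].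
have hK0 x : normc (Phi x) <= K0.
  by rewrite [Phi x]complex_eta -[leLHS]mul1r -[1](expr0 (1 + enorm x)); exact: hK0'.
have [K1 hK1] := proj2 Phi_schwartz n.+1 [:: i0].
have [K3 hK3] := atom_half_decay (n.+1 + n.+1)%N.
have K0p : 0 <= K0 by apply: le_trans (hK0 0); exact: normc_ge0.
have K1p : 0 <= K1.
  by apply: le_trans (hK1 0); rewrite mulr_ge0 ?exprn_ge0 ?(ltW (one_enorm_gt0 _)) ?normc_ge0.
have K3p : 0 <= K3.
  by apply: le_trans (hK3 0); rewrite mulr_ge0 ?exprn_ge0 ?(ltW (one_enorm_gt0 _)).
have A3 y : `|atom_half y| <= K3 * (hardy_weight y * hardy_weight y).
  by rewrite /hardy_weight -invfM -exprD; exact: (bounded_le hK3).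
have w1 y : hardy_weight y <= 1.
  by rewrite invf_le1 ?exprn_gt0 ?one_enorm_gt0// exprn_ege1// lerDl enorm_ge0.
have [[s1 s2] _] := Phi_schwartz.
have diff s z : 0 < s -> s <= 1 ->
    normc (Phi z - Phi (z - s *: a)) <= s * (2 * (2 ^+ n.+1 * K1)) * hardy_weight z.
  move=> s0 sl1; rewrite (le_trans (normc_le_ReIm _))//.
  have p1 y : (1 + enorm y) ^+ n.+1 * `|partials [:: i0] (complex.Re (R:=R) \o Phi) y| <= K1.
    apply: le_trans (hK1 y); rewrite ler_wpM2l ?exprn_ge0 ?(ltW (one_enorm_gt0 _))//.
    exact: (le_Re_normc (cpartials [:: i0] Phi y)).
  have p2 y : (1 + enorm y) ^+ n.+1 * `|partials [:: i0] (complex.Im (R:=R) \o Phi) y| <= K1.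
    apply: le_trans (hK1 y); rewrite ler_wpM2l ?exprn_ge0 ?(ltW (one_enorm_gt0 _))//.
    exact: (le_Im_normc (cpartials [:: i0] Phi y)).
  have q1 := smooth_difference s1 p1 z s0 sl1.
  have q2 := smooth_difference s2 p2 z s0 sl1.
  rewrite -ler_pdivrMr ?invr_gt0 ?exprn_gt0 ?one_enorm_gt0// invrK mulrC.
  have rB (u v : R[i]) : complex.Re (u - v) = complex.Re u - complex.Re v by case: u; case: v.
  have iB (u v : R[i]) : complex.Im (u - v) = complex.Im u - complex.Im v by case: u; case: v.
  rewrite rB iB mulrDr; apply: (le_trans (lerD q1 q2)).
  by rewrite le_eqVlt; apply/orP; left; apply/eqP; ring.
exists (2 * (2 ^+ n.+1 * K1) * K3 * \int[lebesgue_rV]_x hardy_weight (x : 'rV[R]_n)) => t x t1.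
have t0 : 0 < t by rewrite (lt_le_trans ltr01).
pose D y := dilation t Phi (x - y).
have mA : cmeas (fun y => (atom_half y)%:C%C) by apply: cmeas_real; exact: measurable_atom_half.
have mDy : cmeas D by exact: cmeas_dil.
have mS : measurable_fun setT (fun y : 'rV[R]_n => y + a) by exact: measurable_rVD.
have mDa : cmeas (fun y => D (y + a)) by exact: (cmeas_comp mDy mS).
have Db y : normc (D y) <= t ^- n * K0.
  rewrite /D dilE Normc.normcM normc_real ger0_norm ?invr_ge0 ?exprn_ge0 ?(ltW t0)//.
  by rewrite ler_wpM2l ?invr_ge0 ?exprn_ge0 ?(ltW t0).
have iD (E : 'rV[R]_n -> R[i]) : cmeas E -> (forall y, normc (E y) <= t ^- n * K0) ->
    cintegrable lebesgue_rV (fun y => E y * (atom_half y)%:C%C).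
  move=> mE Eb; apply: (@cintegrable_le _ _ _ lebesgue_rV _
    (fun y => (t ^- n * K0 * K3) * hardy_weight y)).
  - exact: cmeasM.
  - move=> y; rewrite Normc.normcM normc_real -[leRHS]mulrA.
    apply: ler_pM => //; first exact: normc_ge0.
    apply: (le_trans (A3 y)); rewrite ler_wpM2l// ler_piMr//.
    exact: hardy_weight_ge0.
  - exact: (integrableZl measurableT _ (@integrable_hardy_weight R n)).
have iD1 := iD _ mDy Db.
have iD2 := iD _ mDa (fun y => Db (y + a)).
have E : convolution (dilation t Phi) (fun y => (atom y)%:C%C) x =
    cint lebesgue_rV (fun y => (D y - D (y + a)) * (atom_half y)%:C%C).
  (* Translation by [a] in the second term of the atom: the difference then falls on the kernel
     [D]. *)
  have := cint_affine (- a) (oner_neq0 R) iD2.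
  rewrite normr1 expr1n invr1 mul1r => e2.
  rewrite /convolution -[LHS]/(cint _ _).
  have i3 : cintegrable lebesgue_rV
      (fun y => D (1 *: y - a + a) * (atom_half (1 *: y - a))%:C%C).
    have [j1 j2] := iD2; split.
    - exact: (integrable_affine (- a) (oner_neq0 R) j1).
    - exact: (integrable_affine (- a) (oner_neq0 R) j2).
  have e3 := cintB iD1 i3; have e4 := cintB iD1 iD2.
  transitivity (cint lebesgue_rV (fun y => D y * (atom_half y)%:C%C) -
    cint lebesgue_rV (fun y => D (y + a) * (atom_half y)%:C%C)).
    rewrite -[X in _ - X]e2 -[X in _ - X]/(cint _ _) -e3.
    by congr cint; apply/funext => y; rewrite scale1r subrK /atom rmorphB/= mulrBr.
  by rewrite -e4; congr cint; apply/funext => y; rewrite mulrBl.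
rewrite E.
pose g y := (2 * (2 ^+ n.+1 * K1) * K3 * hardy_weight x) * hardy_weight y.
have ig : lebesgue_rV.-integrable setT (EFin \o g).
  exact: (integrableZl measurableT _ (@integrable_hardy_weight R n)).
apply: (@le_trans _ _ (\int[lebesgue_rV]_y g y)); last first.
  rewrite /g RintegralZl//; last exact: integrable_hardy_weight.
  by rewrite mulrAC.
apply: normc_cint_le => //.
  apply: cmeasM => //; apply: cmeasD => //.
  under eq_fun do rewrite -mulN1r.
  by apply: cmeasM => //; exact: cmeas_cst.
move=> y; rewrite Normc.normcM normc_real.
pose z := t^-1 *: (x - y).
have dE : D y - D (y + a) = (t ^- n)%:C%C * (Phi z - Phi (z - t^-1 *: a)).
  rewrite /D /dilation mulrBr; congr (_ * _ - _ * Phi _).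
  by apply/rowP => j; rewrite !mxE; ring.
have h1 : normc (D y - D (y + a)) <= (2 * (2 ^+ n.+1 * K1)) * hardy_weight (x - y).
  rewrite dE Normc.normcM normc_real ger0_norm ?invr_ge0 ?exprn_ge0 ?(ltW t0)//.
  have := diff t^-1 z; rewrite invr_gt0 invf_le1// => /(_ t0 t1) h.
  apply: le_trans (ler_wpM2l _ h) _; first by rewrite invr_ge0 exprn_ge0// ltW.
  have key : t ^- n.+1 * hardy_weight z <= hardy_weight (x - y).
    rewrite /hardy_weight -invfM -exprMn lef_pV2 ?posrE ?exprn_gt0 ?mulr_gt0 ?one_enorm_gt0//.
    rewrite lerXn2r ?nnegrE ?mulr_ge0 ?(ltW (one_enorm_gt0 _)) ?(ltW t0)//.
    rewrite mulrDr mulr1 /z enormZ ger0_norm ?invr_ge0 ?(ltW t0)// mulrA divff ?gt_eqF// mul1r.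
    by rewrite lerD2r.
  apply: le_trans (ler_wpM2l _ key); last by rewrite !mulr_ge0// exprn_ge0.
  rewrite le_eqVlt; apply/orP; left; apply/eqP.
  have -> : t ^- n.+1 = t^-1 * t ^- n by rewrite exprS invfM.
  ring.
apply: (le_trans (ler_pM (normc_ge0 _) (normr_ge0 _) h1 (A3 y))).
rewrite /g mulrACA -[leRHS]mulrA ler_wpM2l ?mulr_ge0 ?exprn_ge0//.
by rewrite mulrA ler_wpM2r ?hardy_weight_ge0.
Qed.

Definition scaled_atom (L : R) x : R[i] := (L ^+ n * atom (L *: x))%:C%C.

(** Dilating the atom by [L] amounts to replacing [t] by [L * t], which a supremum over all [t > 0]
    does not see; the factor [L ^+ n] is compensated when the maximal function is integrated. *)
Lemma convolution_scaled_atom (L t : R) x : 0 < L -> 0 < t ->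
  convolution (dilation t Phi) (scaled_atom L) x =
  (L ^+ n)%:C%C * convolution (dilation (L * t) Phi) (fun y => (atom y)%:C%C) (L *: x).
Proof.
move=> L0 t0.
have [K0 hK0'] := proj2 Phi_schwartz 0%N [::].
have hK0 z : normc (Phi z) <= K0.
  by rewrite [Phi z]complex_eta -[leLHS]mul1r -[1](expr0 (1 + enorm z)); exact: hK0'.
have [K2 hK2] := atom_decay n.+1.
have K0p : 0 <= K0 by apply: le_trans (hK0 0); exact: normc_ge0.
pose F z := dilation (L * t) Phi (L *: x - z) * (atom z)%:C%C.
have iF : cintegrable lebesgue_rV F.
  apply: (@cintegrable_le _ _ _ lebesgue_rV _
    (fun y => ((L * t) ^- n * K0 * K2) * hardy_weight y)).
  - by apply: cmeasM; [exact: cmeas_dil|apply: cmeas_real; exact: measurable_atom].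
  - move=> y; rewrite /F dilE !Normc.normcM !normc_real -[leRHS]mulrA.
    have Lt0 : 0 <= (L * t) ^- n by rewrite invr_ge0 exprn_ge0// mulr_ge0 ?ltW.
    rewrite (ger0_norm Lt0); apply: ler_pM => //; first by rewrite mulr_ge0 ?normc_ge0.
      by rewrite ler_wpM2l.
    exact: (bounded_le hK2).
  - exact: (integrableZl measurableT _ (@integrable_hardy_weight R n)).
have Ln0 : L ^+ n != 0 by rewrite expf_neq0// gt_eqF.
have Lneq0 : L != 0 by rewrite gt_eqF.
have e := cint_affine 0 Lneq0 iF.
have iFL : cintegrable lebesgue_rV (fun y => F (L *: y + 0)).
  have [j1 j2] := iF; split.
  - exact: (integrable_affine 0 Lneq0 j1).
  - exact: (integrable_affine 0 Lneq0 j2).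
rewrite [X in _ * X]/convolution -/F -[LHS]/(cint _ _).
transitivity (cint lebesgue_rV (fun y => (L ^+ n * L ^+ n)%:C%C * F (L *: y + 0))).
  congr cint; apply/funext => y; rewrite /F /scaled_atom /dilation addr0.
  rewrite -scalerBr scalerA (_ : (L * t)^-1 * L = t^-1); last by field; rewrite !gt_eqF.
  move: (Phi _) (atom _) => P q; rewrite [_ * P]mulrC mulrCA -!mulrA -!rmorphM/=.
  rewrite [RHS]mulrCA -rmorphM/=; congr (P * (_%:C)%C).
  by rewrite exprMn; field; rewrite !expf_neq0// gt_eqF.
apply: (etrans (cintZ _ iFL)).
have {}e : cint lebesgue_rV (fun y => F (L *: y + 0)) = (`|L| ^- n)%:C%C * cintegral F := e.
rewrite e.
move: (cintegral F) => z; rewrite mulrA -rmorphM/=; congr ((_)%:C%C * z).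
by rewrite gtr0_norm//; field; rewrite Ln0.
Qed.

Lemma hardy_norm_scaled_atom : exists2 C : R, 0 <= C & forall L, 0 < L ->
  (hardy_norm Phi (scaled_atom L) <= C%:E)%E.
Proof.
have [C1 h1] := convolution_small; have [C2 h2] := convolution_large.
pose C := Num.max 0 (Num.max C1 C2).
have C0 : 0 <= C by rewrite /C le_max lexx.
have hC t x : 0 < t ->
    normc (convolution (dilation t Phi) (fun y => (atom y)%:C%C) x) <= C * hardy_weight x.
  move=> t0; have [t1|t1] := leP t 1.
    by apply: (le_trans (h1 t x t0 t1)); rewrite ler_wpM2r ?hardy_weight_ge0// /C !le_max lexx !orbT.
  by apply: (le_trans (h2 t x (ltW t1))); rewrite ler_wpM2r ?hardy_weight_ge0// /C !le_max lexx !orbT.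
exists (C * \int[lebesgue_rV]_x hardy_weight (x : 'rV[R]_n)) => [|L L0].
  by rewrite mulr_ge0// Rintegral_ge0// => x _; exact: hardy_weight_ge0.
have M_le x : (maximal_function Phi (scaled_atom L) x <=
    (C * L ^+ n * hardy_weight (L *: x + 0))%:E)%E.
  apply: ge_ereal_sup => _ [t t0 <-]; rewrite lee_fin; have {}t0 : 0 < t := t0.
  rewrite convolution_scaled_atom// Normc.normcM normc_real ger0_norm ?exprn_ge0 ?(ltW L0)//.
  rewrite addr0 (mulrC C) -mulrA ler_wpM2l ?exprn_ge0 ?(ltW L0)//.
  by apply: hC; rewrite mulr_gt0.
have M_ge0 x : (0 <= maximal_function Phi (scaled_atom L) x)%E.
  apply: (@le_trans _ _ (normc (convolution (dilation 1 Phi) (scaled_atom L) x))%:E).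
    by rewrite lee_fin normc_ge0.
  by apply: ereal_sup_ubound; exists 1 => //=.
rewrite /hardy_norm Lnorm1.
apply: (@le_trans _ _ (\int[lebesgue_rV]_x (C * L ^+ n * hardy_weight (L *: x + 0))%:E)%E).
  apply: ge0_le_integral_nonmeasurable => x; first exact: abse_ge0.
  by rewrite gee0_abs.
rewrite (ge0_integral_affine 0 (f := fun x => (C * L ^+ n * hardy_weight x)%:E)) ?gt_eqF//.
- under eq_integral do rewrite EFinM.
  rewrite ge0_integralZl//.
  + rewrite muleA -EFinM gtr0_norm// mulrCA mulVf ?expf_neq0 ?gt_eqF// mulr1 EFinM.
    rewrite /Rintegral fineK//.
    by apply: integrable_fin_num => //; exact: integrable_hardy_weight.
  + by apply/measurable_EFinP; exact: measurable_hardy_weight.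
  + by move=> x _; rewrite lee_fin hardy_weight_ge0.
  + by rewrite lee_fin mulr_ge0// exprn_ge0// ltW.
- by apply/measurable_EFinP; apply: measurable_funM => //; exact: measurable_hardy_weight.
- by move=> x; rewrite lee_fin !mulr_ge0 ?exprn_ge0 ?(ltW L0) ?hardy_weight_ge0.
Qed.

End hardy_atom.

(** * Duality: from the integral of a product of waves to an integral over frequencies *)

Section extension.
Context {R : realType} {n : nat}.
Local Notation normc := (@Normc.normc R).
Local Notation leb := (@lebesgue_rV R n).
Implicit Types (a b c k : 'rV[R]_n -> R[i]) (x xi v : 'rV[R]_n).

Lemma dotp0r x : dotp x 0 = 0.
Proof. by rewrite /dotp big1// => i _; rewrite mxE mulr0. Qed.

Lemma dotp0l x : dotp 0 x = 0.
Proof. by rewrite dotpC dotp0r. Qed.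

(** The inverse Fourier transform without its constant, for an amplitude that need only be
    integrable. *)
Definition ext a x : R[i] := cint leb (fun xi => expi (dotp x xi) * a xi).

Lemma measurable_pair_dotp :
  measurable_fun setT (fun p : 'rV[R]_n * 'rV[R]_n => dotp p.1 p.2).
Proof. exact: measurable_dotp. Qed.

Lemma cintegrable_wave a x : cintegrable leb a ->
  cintegrable leb (fun xi => expi (dotp x xi) * a xi).
Proof.
move=> ia; apply: (cintegrable_le _ _ (cintegrable_normc ia)).
- apply: cmeasM; last exact: cintegrable_cmeas ia.
  by apply: cmeas_expi; exact: measurable_dotp.
- by move=> xi; rewrite Normc.normcM normc_expi mul1r.
Qed.

Lemma normc_ext a x : cintegrable leb a ->
  normc (ext a x) <= \int[leb]_xi normc (a xi).
Proof.
move=> ia; apply: normc_cint_le; last exact: cintegrable_normc.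
- exact: cintegrable_cmeas (cintegrable_wave x ia).
- by move=> xi; rewrite Normc.normcM normc_expi mul1r.
Qed.

Lemma cmeas_wave a : cmeas a ->
  cmeas (fun p : 'rV[R]_n * 'rV[R]_n => expi (dotp p.1 p.2) * a p.2).
Proof.
move=> ma; apply: cmeasM.
- by apply: cmeas_expi; exact: measurable_pair_dotp.
- exact: (cmeas_comp ma measurable_snd).
Qed.

(* Multiplying by an integrable weight makes the integrand dominated on the product. *)
Lemma cmeas_ext a : cintegrable leb a -> cmeas (ext a).
Proof.
move=> ia; have ma := cintegrable_cmeas ia.
pose f x xi := (gaussian 1 x)%:C%C * (expi (dotp x xi) * a xi).
have mg : cmeas (fun x : 'rV[R]_n => (gaussian 1 x)%:C%C).
  by apply: cmeas_real; exact: measurable_gaussian.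
have mf : cmeas (fun p : 'rV[R]_n * 'rV[R]_n => f p.1 p.2).
  by apply: cmeasM; [exact: (cmeas_comp mg measurable_fst)|exact: cmeas_wave].
have fb x xi : normc (f x xi) <= gaussian 1 x * normc (a xi).
  by rewrite !Normc.normcM normc_expi mul1r normc_real ger0_norm// gaussian_ge0.
have ig : leb.-integrable setT (EFin \o gaussian 1).
  by have := integrable_gaussian (0 : 'rV[R]_n) (@ltr01 R); under eq_fun do rewrite subr0.
have m := cmeas_cint mf fb ig (cintegrable_normc ia).
rewrite (_ : ext a = fun x => (expR (dotp x x))%:C%C * cint leb (f x)).
  apply: cmeasM => //; apply: cmeas_real.
  have me : measurable_fun setT (@expR R) by exact: measurable_expR.
  have md : measurable_fun setT (fun x : 'rV[R]_n => dotp x x) by exact: measurable_dotp.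
  exact: (measurableT_comp me md).
apply/funext => x; rewrite /f cintZ; last exact: cintegrable_wave.
by rewrite mulrA -rmorphM/= /gaussian mul1r -expRD subrr expR0 mul1r.
Qed.

Lemma cintegrable_bounded k (f : 'rV[R]_n -> R[i]) (C : R) : cintegrable leb k -> cmeas f ->
  (forall x, normc (f x) <= C) -> cintegrable leb (fun x => k x * f x).
Proof.
move=> ik mf fC; apply: (@cintegrable_le _ _ _ leb _ (fun x => C * normc (k x))).
- by apply: cmeasM => //; exact: cintegrable_cmeas ik.
- by move=> x; rewrite Normc.normcM mulrC ler_wpM2r// normc_ge0.
- exact: (integrableZl measurableT C (cintegrable_normc ik)).
Qed.

Lemma cintegrable_mul_ext k a : cintegrable leb k -> cintegrable leb a ->
  cintegrable leb (fun x => k x * ext a x).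
Proof.
move=> ik ia; apply: (cintegrable_bounded ik (cmeas_ext ia)) => x.
exact: normc_ext.
Qed.

Lemma ext_duality k a : cintegrable leb k -> cintegrable leb a ->
  cint leb (fun x => k x * ext a x) = cint leb (fun xi => a xi * ext k xi).
Proof.
move=> ik ia; have mk := cintegrable_cmeas ik; have ma := cintegrable_cmeas ia.
pose f x xi := k x * (expi (dotp x xi) * a xi).
have mf : cmeas (fun p : 'rV[R]_n * 'rV[R]_n => f p.1 p.2).
  by apply: cmeasM; [exact: (cmeas_comp mk measurable_fst)|exact: cmeas_wave].
have fb x xi : normc (f x xi) <= normc (k x) * normc (a xi).
  by rewrite !Normc.normcM normc_expi mul1r.
have := cint_fubini mf fb (cintegrable_normc ik) (cintegrable_normc ia).
have -> : (fun x => cint leb (f x)) = fun x => k x * ext a x.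
  by apply/funext => x; rewrite /f cintZ//; exact: cintegrable_wave.
move=> ->; congr cint; apply/funext => xi.
rewrite /f /ext -cintZ; last exact: cintegrable_wave.
by congr cint; apply/funext => x; rewrite (dotpC x); ring.
Qed.

Lemma ext_mul k b v : cintegrable leb k -> cintegrable leb b ->
  ext (fun x => k x * ext b x) v = cint leb (fun eta => b eta * ext k (v + eta)).
Proof.
move=> ik ib.
transitivity (cint leb (fun x => (expi (dotp v x) * k x) * ext b x)).
  by congr cint; apply/funext => x; rewrite mulrA.
rewrite (ext_duality (cintegrable_wave v ik) ib).
congr cint; apply/funext => eta; congr (_ * _); congr cint; apply/funext => x.
by rewrite mulrA -expiD dotpDl addrC.
Qed.

(** [ext_duality] once and [ext_mul] twice remove the three waves. What is left in their place is
    [ext k] at the total frequency, all phases being now in [a], [b] and [c]; when [k] is a wide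
    Gaussian, [xi + eta + zeta] is confined near 0. *)
Lemma triple_ext k a b c : cintegrable leb k ->
  cintegrable leb a -> cintegrable leb b -> cintegrable leb c ->
  cint leb (fun x => k x * ext c x * ext b x * ext a x) =
  cint leb (fun xi => a xi * cint leb (fun eta => b eta *
    cint leb (fun zeta => c zeta * ext k (xi + eta + zeta)))).
Proof.
move=> ik ia ib ic.
have ikc := cintegrable_mul_ext ik ic; have ikcb := cintegrable_mul_ext ikc ib.
rewrite (ext_duality ikcb ia); congr cint; apply/funext => xi; congr (_ * _).
rewrite (ext_mul xi ikc ib); congr cint; apply/funext => eta; congr (_ * _).
by rewrite (ext_mul _ ik ic).
Qed.

Lemma ext_gaussian (e : R) v : 0 < e ->
  ext (fun x => (gaussian (e ^+ 2 / 2) x)%:C%C) v =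
  ((Num.sqrt (2 * pi) / e) ^+ n * gaussian ((2 * e ^+ 2)^-1) v)%:C%C.
Proof.
move=> e0; have := cint_gaussian (- v) 0 e0.
rewrite dotp0r !oppr0 expi0 mul1r gaussianN.
by move=> <-; congr cint; apply/funext => x; rewrite dotpNl opprK addr0.
Qed.

End extension.

(** * Integrating a pointwise comparison with a product of three Gaussians *)

Section perturbed_gaussian.
Context {R : realType} {n : nat}.
Local Notation normc := (@Normc.normc R).
Local Notation leb := (@lebesgue_rV R n).
Implicit Types (x xi eta zeta v p q : 'rV[R]_n).

(* [ngauss m s] has integral [(2 pi)^n], whatever the width [s], for [m = 2]. *)
Definition ngauss (m s : R) x : R :=
  (Num.sqrt (2 * pi) / s) ^+ n * gaussian ((m * s ^+ 2)^-1) x.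

Lemma ngauss_ge0 m s x : 0 < s -> 0 <= ngauss m s x.
Proof.
move=> s0; rewrite mulr_ge0 ?gaussian_ge0// exprn_ge0// divr_ge0 ?sqrtr_ge0//.
exact: ltW.
Qed.

Lemma measurable_ngauss m s y : measurable_fun setT (fun x => ngauss m s (x - y)).
Proof.
by apply: measurable_funM => //; apply: measurable_gaussian; exact: measurable_rVD.
Qed.

Lemma integrable_ngauss m s y : 0 < m -> 0 < s ->
  leb.-integrable setT (EFin \o (fun x => ngauss m s (x - y))).
Proof.
move=> m0 s0; have ms : 0 < (m * s ^+ 2)^-1 by rewrite invr_gt0 mulr_gt0// exprn_gt0.
exact: (integrableZl measurableT _ (integrable_gaussian y ms)).
Qed.

Lemma Rintegral_ngauss m s y : 0 < m -> 0 < s ->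
  \int[leb]_x ngauss m s (x - y) = (Num.sqrt 2 * Num.sqrt m * pi) ^+ n.
Proof.
move=> m0 s0; have ms : 0 < (m * s ^+ 2)^-1 by rewrite invr_gt0 mulr_gt0// exprn_gt0.
rewrite RintegralZl//; last exact: integrable_gaussian.
rewrite Rintegral_gaussian// -exprMn; congr (_ ^+ n).
have -> : Num.sqrt (m * s ^+ 2)^-1 = (Num.sqrt m * s)^-1.
  rewrite sqrtrV; last by rewrite mulr_ge0 ?sqr_ge0 ?ltW.
  by rewrite sqrtrM ?ltW// sqrtr_sqr gtr0_norm.
rewrite invrK sqrtrM//.
have sp : Num.sqrt pi * Num.sqrt pi = pi :> R by rewrite -expr2 sqr_sqrtr// pi_ge0.
by rewrite -[X in _ = _ * X]sp; field; rewrite gt_eqF.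
Qed.

Lemma cint_real (f : 'rV[R]_n -> R) : cint leb (fun x => (f x)%:C%C) = (\int[leb]_x f x)%:C%C.
Proof.
rewrite /cint/=; congr (_ +i* _)%C.
by rewrite Rintegral_cst// mul0r.
Qed.

Variables (a b c : 'rV[R]_n -> R[i]) (xi0 eta0 : 'rV[R]_n) (mu e K : R) (k0 : R).
Hypotheses (mu0 : 0 < mu) (e0 : 0 < e) (K0 : 0 <= K).
Hypotheses (ia : cintegrable leb a) (ib : cintegrable leb b) (ic : cintegrable leb c).

(** [W] and [V] are the inner integrals of [triple_ext]. By [WE] and [VE] they are values of [ext],
    which is how they are seen to be measurable and bounded. *)
Let W v : R[i] := cint leb (fun zeta => c zeta * (ngauss 2 e (v + zeta))%:C%C).
Let V xi : R[i] := cint leb (fun eta => b eta * W (xi + eta)).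

Hypothesis pointwise : forall xi eta zeta,
  normc (a xi * b eta * c zeta * (ngauss 2 e (xi + eta + zeta))%:C%C -
    (k0 * ngauss 2 mu (xi - xi0) * ngauss 2 mu (eta - eta0) * ngauss 2 e (xi + eta + zeta))%:C%C)
  <= K * ngauss 4 mu (xi - xi0) * ngauss 4 mu (eta - eta0) * ngauss 4 e (xi + eta + zeta).

Let G2 : R := (Num.sqrt 2 * Num.sqrt 2 * pi) ^+ n.
Let G4 : R := (Num.sqrt 2 * Num.sqrt 4 * pi) ^+ n.

Let kx : 'rV[R]_n -> R[i] := fun x => (gaussian (e ^+ 2 / 2) x)%:C%C.

Let ikx : cintegrable leb kx.
Proof.
have h : 0 < e ^+ 2 / 2 by rewrite divr_gt0// exprn_gt0.
have := cintegrable_gaussian (0 : 'rV[R]_n) 0 h.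
by under eq_fun do rewrite dotp0l oppr0 expi0 mul1r subr0.
Qed.

Let extkx v : ext kx v = (ngauss 2 e v)%:C%C.
Proof. exact: ext_gaussian. Qed.

Let WE v : W v = ext (fun x => kx x * ext c x) v.
Proof.
by rewrite (ext_mul v ikx ic); congr cint; apply/funext => zeta; rewrite extkx.
Qed.

Let ikc := cintegrable_mul_ext ikx ic.

Let mW : cmeas W.
Proof.
have -> : W = ext (fun x => kx x * ext c x) by exact/funext/WE.
exact: (cmeas_ext ikc).
Qed.

Let VE xi : V xi = ext (fun x => kx x * ext c x * ext b x) xi.
Proof.
by rewrite (ext_mul xi ikc ib); congr cint; apply/funext => eta; rewrite WE.
Qed.

Let ikcb := cintegrable_mul_ext ikc ib.

Let mV : cmeas V.
Proof.
have -> : V = ext (fun x => kx x * ext c x * ext b x) by exact/funext/VE.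
exact: (cmeas_ext ikcb).
Qed.

Let mshift v : measurable_fun setT (fun eta : 'rV[R]_n => v + eta).
Proof. exact: measurable_rVD. Qed.

Let normW : exists C, forall v, normc (W v) <= C.
Proof. by exists (\int[leb]_x normc (kx x * ext c x)) => v; rewrite WE; exact: normc_ext. Qed.

Let normV : exists C, forall v, normc (V v) <= C.
Proof.
by exists (\int[leb]_x normc (kx x * ext c x * ext b x)) => v; rewrite VE; exact: normc_ext.
Qed.

Let igv m v : 0 < m -> leb.-integrable setT (EFin \o (fun zeta => ngauss m e (v + zeta))).
Proof.
move=> m0; have := integrable_ngauss (- v) m0 e0.
by under eq_fun do rewrite opprK addrC.
Qed.

Let Igv m v : 0 < m -> \int[leb]_zeta ngauss m e (v + zeta) = (Num.sqrt 2 * Num.sqrt m * pi) ^+ n.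
Proof.
move=> m0; rewrite -(Rintegral_ngauss (- v) m0 e0).
by apply: eq_Rintegral => x _; rewrite opprK addrC.
Qed.

Let ccr (f : 'rV[R]_n -> R) : leb.-integrable setT (EFin \o f) ->
  cintegrable leb (fun x => (f x)%:C%C).
Proof. by move=> i; split => //; exact: integrable0. Qed.

(** One integration of the comparison, with [z] and [r] the factors frozen meanwhile. It is applied
    from the inside out: to [zeta] in [level3], to [eta] in [level2], to [xi] in [triple_ngauss]. *)
Let cint_diff (F : 'rV[R]_n -> R[i]) (f g : 'rV[R]_n -> R) (z : R[i]) (r : R) :
  cintegrable leb F -> leb.-integrable setT (EFin \o f) -> leb.-integrable setT (EFin \o g) ->
  (forall x, normc (z * F x - (r * f x)%:C%C) <= g x) ->
  normc (z * cint leb F - (r * \int[leb]_x f x)%:C%C) <= \int[leb]_x g x.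
Proof.
move=> iF jf ig h.
have jr : leb.-integrable setT (EFin \o (fun x => r * f x)).
  exact: (integrableZl measurableT r jf).
have e1 := cintB (cintegrableZ z iF) (ccr jr).
have i1 := cintegrableB (cintegrableZ z iF) (ccr jr).
have := normc_cint_le (cintegrable_cmeas i1) h ig.
by rewrite e1 (cintZ z iF) cint_real RintegralZl.
Qed.

Let level3 xi eta : normc (a xi * b eta * W (xi + eta) -
    (k0 * ngauss 2 mu (xi - xi0) * ngauss 2 mu (eta - eta0) * G2)%:C%C)
  <= K * ngauss 4 mu (xi - xi0) * ngauss 4 mu (eta - eta0) * G4.
Proof.
have ig := igv (xi + eta) (ltr0n R 2); have ig4 := igv (xi + eta) (ltr0n R 4).
have mg : cmeas (fun zeta => (ngauss 2 e (xi + eta + zeta))%:C%C).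
  exact: cintegrable_cmeas (ccr ig).
have icg : cintegrable leb (fun zeta => c zeta * (ngauss 2 e (xi + eta + zeta))%:C%C).
  apply: (cintegrable_bounded (C := (Num.sqrt (2 * pi) / e) ^+ n) ic mg) => zeta.
  have h0 : 0 <= (Num.sqrt (2 * pi) / e) ^+ n by rewrite exprn_ge0// divr_ge0 ?sqrtr_ge0// ltW.
  rewrite normc_real ger0_norm ?ngauss_ge0// /ngauss ler_piMr//.
  rewrite /gaussian expR_le1 oppr_le0 mulr_ge0 ?dotp_ge0// invr_ge0 mulr_ge0//.
  exact: sqr_ge0.
rewrite /G2 -(Igv (xi + eta) (ltr0n R 2)) /G4 -(Igv (xi + eta) (ltr0n R 4)).
set B := K * _ * _.
rewrite -(@RintegralZl _ _ _ leb setT _ B measurableT ig4).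
apply: cint_diff => //; first exact: (integrableZl measurableT B ig4).
by move=> zeta; rewrite mulrA; exact: pointwise.
Qed.

Let level2 xi : normc (a xi * V xi - (k0 * ngauss 2 mu (xi - xi0) * G2 * G2)%:C%C)
  <= K * ngauss 4 mu (xi - xi0) * G4 * G4.
Proof.
have [C WC] := normW.
have iW : cintegrable leb (fun eta => b eta * W (xi + eta)).
  apply: (cintegrable_bounded ib _ (fun eta => WC (xi + eta))).
  exact: (cmeas_comp mW (mshift xi)).
have ig := integrable_ngauss eta0 (ltr0n R 2) mu0.
have ig4 := integrable_ngauss eta0 (ltr0n R 4) mu0.
have igB := integrableZl measurableT (K * ngauss 4 mu (xi - xi0) * G4) ig4.
have h := @cint_diff _ _ _ (a xi) (k0 * ngauss 2 mu (xi - xi0) * G2) iW ig igB.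
rewrite Rintegral_ngauss// in h.
rewrite (@RintegralZl _ _ _ leb setT _ _ measurableT ig4) Rintegral_ngauss// in h.
apply: h => eta; have := level3 xi eta.
rewrite mulrA [X in (X)%:C%C]mulrAC => /le_trans; apply.
by rewrite le_eqVlt; apply/orP; left; apply/eqP; rewrite mulrAC.
Qed.

(** Each integration produces one [G2] in the main term and one [G4] in the error. These do not
    depend on the widths, so the comparison is uniform in [mu] and [e]. *)
Lemma triple_ngauss :
  normc (cint leb (fun xi => a xi * V xi) - (k0 * G2 ^+ 3)%:C%C) <= K * G4 ^+ 3.
Proof.
have [C VC] := normV.
have iV : cintegrable leb (fun xi => a xi * V xi) by exact: (cintegrable_bounded ia mV VC).
have ig := integrable_ngauss xi0 (ltr0n R 2) mu0.
have ig4 := integrable_ngauss xi0 (ltr0n R 4) mu0.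
have igB := integrableZl measurableT (K * G4 * G4) ig4.
have h := @cint_diff _ _ _ 1 (k0 * G2 * G2) iV ig igB.
rewrite Rintegral_ngauss// mul1r in h.
rewrite (@RintegralZl _ _ _ leb setT _ _ measurableT ig4) Rintegral_ngauss// in h.
rewrite !(exprS _ 2) !expr2 !mulrA.
apply: h => xi; rewrite mul1r; have := level2 xi.
rewrite (_ : k0 * ngauss 2 mu (xi - xi0) * G2 * G2 = k0 * G2 * G2 * ngauss 2 mu (xi - xi0)); last by ring.
by rewrite (_ : K * ngauss 4 mu (xi - xi0) * G4 * G4 = K * G4 * G4 * ngauss 4 mu (xi - xi0)); last by ring.
Qed.

End perturbed_gaussian.

(** * Linearisation of the norm, and Lipschitz bounds *)

Section phase_bounds.
Context {R : realType} {n : nat}.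
Local Notation normc := (@Normc.normc R).
Implicit Types (x xi eta zeta v : 'rV[R]_n).

(** The norm is homogeneous of degree 1, so its linearisation at [xi0] has no constant term. The
    lower bound is Cauchy-Schwarz; the upper one is [(enorm xi - enorm xi0)^2 >= 0]. *)
Lemma phase_bounds xi xi0 : 0 < enorm xi0 ->
  0 <= enorm xi - dotp ((enorm xi0)^-1 *: xi0) xi
    <= dotp (xi - xi0) (xi - xi0) / (2 * enorm xi0).
Proof.
move=> x0; rewrite dotpZl; apply/andP; split.
  by rewrite subr_ge0 ler_pdivrMl// dotp_le.
rewrite ler_pdivlMr ?mulr_gt0// dotpBB -!enorm_sqr.
have -> : (enorm xi - (enorm xi0)^-1 * dotp xi0 xi) * (2 * enorm xi0) =
  2 * enorm xi * enorm xi0 - 2 * dotp xi0 xi.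
  by field; rewrite gt_eqF.
have := sqr_ge0 (enorm xi - enorm xi0); rewrite sqrrB (dotpC xi) => h.
by rewrite -subr_ge0; move: h; congr (0 <= _); ring.
Qed.

Lemma dotp_sub_sub_le v x y :
  dotp (v - x - y) (v - x - y) <= 3 * (dotp x x + dotp y y + dotp v v).
Proof.
have h2 := dotp_ge0 (v + x); have h3 := dotp_ge0 (v + y); have h4 := dotp_ge0 (x - y).
have e : dotp (v - x - y) (v - x - y) =
    3 * (dotp x x + dotp y y + dotp v v) - dotp (v + x) (v + x) -
    dotp (v + y) (v + y) - dotp (x - y) (x - y).
  rewrite !(dotpDl, dotpDr, dotpNl, dotpNr) (dotpC x v) (dotpC y v) (dotpC y x).
  ring.
rewrite e; lra.
Qed.

Lemma enorm_dist x xi : `|enorm x - enorm xi| <= enorm (x - xi).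
Proof.
have h1 := enormD (x - xi) xi; have h2 := enormD (xi - x) x.
rewrite !subrK in h1 h2; rewrite -(enormN (xi - x)) opprB in h2.
by rewrite ler_norml; lra.
Qed.

Lemma cos_lipschitz (s t : R) : `|cos s - cos t| <= 2 * `|s - t|.
Proof.
have -> : cos s = complex.Re (expi s) by [].
have -> : cos t = complex.Re (expi t) by [].
have -> : complex.Re (expi s) - complex.Re (expi t) =
    complex.Re (expi t * (expi (s - t) - 1)).
  rewrite mulrBr mulr1 -expiD (_ : t + (s - t) = s); last by ring.
  by case: (expi s) (expi t) => ? ? [? ?].
rewrite (le_trans (le_Re_normc _))// Normc.normcM normc_expi mul1r.
exact: expi_dist.
Qed.

Lemma gaussian_lipschitz a x xi : 0 <= a ->
  `|gaussian a x - gaussian a xi| <= a * `|dotp x x - dotp xi xi|.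
Proof.
move=> a0; wlog h : x xi / dotp x x <= dotp xi xi.
  move=> H; have [|/ltW] := leP (dotp x x) (dotp xi xi); first exact: H.
  by rewrite distrC (distrC (dotp x x)); exact: H.
rewrite ger0_norm ?subr_ge0; last by rewrite ler_expR lerN2 ler_wpM2l.
rewrite ler0_norm ?subr_le0// opprB mulrBr.
rewrite {1}/gaussian -[X in X <= _]mulr1.
have -> : gaussian a xi = gaussian a x * expR (- (a * dotp xi xi - a * dotp x x)).
  by rewrite /gaussian -expRD; congr expR; ring.
set A := a * _ - a * _; rewrite mulr1 -/(gaussian a x) -{1}[gaussian a x]mulr1 -mulrBr.
have A0 : 0 <= A by rewrite /A subr_ge0 ler_wpM2l.
have g1 : gaussian a x <= 1 by rewrite expR_le1 oppr_le0 mulr_ge0// dotp_ge0.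
have := expR_ge1Dx (- A) => e1; have e2 : expR (- A) <= 1 by rewrite expR_le1 oppr_le0.
apply: (@le_trans _ _ (1 * (1 - expR (- A)))); last by lra.
by rewrite ler_wpM2r// subr_ge0.
Qed.

End phase_bounds.

(** * The interaction of two packets with the wave of the atom *)

Section packet_interaction.
Context {R : realType} {n : nat}.
Local Notation normc := (@Normc.normc R).
Implicit Types (x xi eta zeta v : 'rV[R]_n).
Variable i0 : 'I_n.
Variables (psi theta : 'rV[R]_n -> R[i]) (M : R).
Hypotheses (M1 : 1 <= M) (psiM : forall xi, normc (psi xi) <= M)
  (thetaM : forall xi, normc (theta xi) <= M).
Hypothesis psi1 : forall xi, 2^-1 <= enorm xi <= 2 -> psi xi = 1.
Hypothesis theta1 : forall xi, enorm xi <= 6 -> theta xi = 1.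
Variables (L mu rho : R).
Hypotheses (L1 : 1 <= L) (mu1 : 1 <= mu) (rho0 : 0 < rho).

(** What [wave_multiplier] integrates against [expi (dotp x xi)] for a packet: symbol, cutoff, and
    the transform from [fourier_packet], whose Gaussian factor is exactly [ngauss 2 mu]. *)
Definition packet_amplitude (kap : 'rV[R]_n -> R[i]) xi0 y xi : R[i] :=
  expi (enorm xi) * kap (L^-1 *: xi) *
    (expi (- dotp xi y) * (ngauss 2 mu (xi - xi0))%:C%C).

(* The Fourier transform of [scaled_atom i0 L]: it is real and nonnegative. *)
Definition atom_hat xi : R :=
  Num.sqrt (2 * pi) ^+ n * (gaussian 2^-1 (L^-1 *: xi) * (2 - 2 * cos (L^-1 * xi ord0 i0))).

Definition atom_amplitude xi : R[i] :=
  expi (enorm xi) * theta (L^-1 *: xi) * (atom_hat xi)%:C%C.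

Let C1 : R := Num.sqrt (2 * pi) ^+ n.
Let C1_ge0 : 0 <= C1. Proof. by rewrite exprn_ge0// sqrtr_ge0. Qed.
Let L0 : 0 < L. Proof. exact: lt_le_trans L1. Qed.

(** The losses added up in [ratio]: [4 * C1] bounds [atom_hat] and [M ^+ 3] the cutoffs; [8 / rho]
    is due to the phase, [70 = 32 + 32 + 6] to the three cutoffs, 30 to the variation of [atom_hat],
    and one unit is spare. *)
Definition interaction_const : R := C1 * (4 * M ^+ 3 * (8 / rho + 70 * M) + 31).

Let gaussian_le1 (a : R) x : 0 <= a -> gaussian a x <= 1.
Proof. by move=> a0; rewrite expR_le1 oppr_le0 mulr_ge0// dotp_ge0. Qed.

Lemma atom_hat_ge0 xi : 0 <= atom_hat xi.
Proof.
apply: mulr_ge0 => //; apply: mulr_ge0; first exact: gaussian_ge0.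
by have := cos_le1 (L^-1 * xi ord0 i0); lra.
Qed.

Lemma atom_hat_le xi : atom_hat xi <= 4 * C1.
Proof.
rewrite mulrC ler_wpM2l// -[leRHS]mul1r ler_pM ?gaussian_ge0 ?gaussian_le1//.
by have := cos_geN1 (L^-1 * xi ord0 i0); lra.
Qed.

Let enorm_LV xi : enorm (L^-1 *: xi) = enorm xi / L.
Proof. by rewrite enormZ ger0_norm ?invr_ge0 ?(ltW L0)// mulrC. Qed.

(** The variation is of first order, [d / L] with [d] the distance; [2 * d <= 1 + d^2] gives it the
    shape of the quadratic errors. *)
Lemma atom_hat_lipschitz zeta zeta0 : enorm zeta0 <= L ->
  `|atom_hat zeta - atom_hat zeta0| <=
    C1 * (10 * (1 + dotp (zeta - zeta0) (zeta - zeta0)) / L).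
Proof.
move=> z0; rewrite /atom_hat -mulrBr normrM ger0_norm// ler_wpM2l//.
set z := L^-1 *: zeta; set w := L^-1 *: zeta0.
set cz := cos _; set cw := cos _.
set d := enorm (zeta - zeta0).
have d0 : 0 <= d by exact: enorm_ge0.
have w1 : enorm w <= 1 by rewrite enorm_LV ler_pdivrMr// mul1r.
have zw : enorm (z - w) = d / L by rewrite -scalerBr enorm_LV.
have hg : `|gaussian 2^-1 z - gaussian 2^-1 w| <= d / L + (d / L) ^+ 2 / 2.
  apply: (le_trans (gaussian_lipschitz _ _ _)); first by rewrite invr_ge0.
  have -> : dotp z z - dotp w w = dotp (z - w) (z - w) + 2 * dotp w (z - w).
    by rewrite dotpBB dotpDr dotpNr (dotpC w); ring.
  rewrite -enorm_sqr zw.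
  have : `|dotp w (z - w)| <= d / L.
    have b1 := dotp_le w (z - w); have b2 := dotp_le (- w) (z - w).
    rewrite dotpNl enormN in b2; rewrite zw in b1 b2.
    have : enorm w * (d / L) <= d / L by rewrite ler_piMl// divr_ge0// ltW.
    by rewrite ler_norml; lra.
  move: (dotp w (z - w)) => t ht.
  apply: (le_trans (ler_wpM2l _ (ler_normD _ _))); first by rewrite invr_ge0.
  rewrite (ger0_norm (sqr_ge0 (d / L))) normrM ger0_norm//.
  by move: ht; move: ((d / L) ^+ 2) (d / L) `|t| => u' v' w'; lra.
have hc : `|cz - cw| <= 2 * (d / L).
  apply: (le_trans (cos_lipschitz _ _)); rewrite ler_pM2l// -mulrBr normrM.
  rewrite ger0_norm ?invr_ge0 ?(ltW L0)// mulrC ler_wpM2r ?invr_ge0 ?(ltW L0)//.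
  by have := enorm_coord (zeta - zeta0) i0; rewrite !mxE.
have e : gaussian 2^-1 z * (2 - 2 * cz) - gaussian 2^-1 w * (2 - 2 * cw) =
  (gaussian 2^-1 z - gaussian 2^-1 w) * (2 - 2 * cz) + gaussian 2^-1 w * (2 * (cw - cz)) by ring.
have b1 : `|2 - 2 * cz| <= 4.
  by have := cos_le1 (L^-1 * zeta ord0 i0); have := cos_geN1 (L^-1 * zeta ord0 i0);
    rewrite -/cz ler_norml; lra.
have b2 : `|gaussian 2^-1 w| <= 1.
  by rewrite ger0_norm ?gaussian_ge0// gaussian_le1// invr_ge0.
have t1 : `|gaussian 2^-1 z * (2 - 2 * cz) - gaussian 2^-1 w * (2 - 2 * cw)| <=
    (d / L + (d / L) ^+ 2 / 2) * 4 + 1 * (2 * (2 * (d / L))).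
  rewrite e (le_trans (ler_normD _ _))// lerD// !normrM; first by rewrite ler_pM.
  by rewrite ler_pM// ger0_norm// ler_pM2l// distrC.
apply: (le_trans t1); rewrite -enorm_sqr -/d.
have u0 : 0 <= d / L by rewrite divr_ge0// ltW.
have u1 : (d / L) ^+ 2 <= d ^+ 2 / L.
  rewrite expr_div_n ler_wpM2l ?sqr_ge0// lef_pV2 ?posrE ?exprn_gt0//.
  by rewrite expr2 ler_peMr// ltW.
have u2 : d / L <= (1 + d ^+ 2) / 2 / L.
  rewrite ler_wpM2r ?invr_ge0 ?(ltW L0)//.
  by have := sqr_ge0 (d - 1); rewrite sqrrB; lra.
have := divr_ge0 (sqr_ge0 d) (ltW L0); have : 0 <= L^-1 by rewrite invr_ge0 ltW.
move: u1 u2; rewrite !mulrDl !mul1r !mulrDr !mulr1 !mulrDl; lra.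
Qed.

Variables (X xi0 eta0 : 'rV[R]_n) (r : R).
Hypotheses (X1 : enorm X = 1) (r_bounds : rho <= r <= 1).
Hypotheses (xi0_bounds : 3 / 4 * L <= enorm xi0 <= 3 / 2 * L)
  (eta0_bounds : 3 / 4 * L <= enorm eta0 <= 3 / 2 * L).
Hypothesis xi0_eta0 : xi0 + eta0 = (r * L) *: X.

Let zeta0 := - (xi0 + eta0).

(** Within [L / 4] of [w] the norm of [xi] lies between [L / 2] and [7 / 4 * L], where the cutoff is
    1. Farther away the squared distance is at least [L ^+ 2 / 16 >= L / 16], and [32 = 2 * 16]
    covers the trivial bound [2 * M]. *)
Lemma cutoff_psi xi w : 3 / 4 * L <= enorm w <= 3 / 2 * L ->
  normc (psi (L^-1 *: xi) - 1) <= 32 * M * dotp (xi - w) (xi - w) / L.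
Proof.
move=> hw; rewrite -enorm_sqr; set d := enorm (xi - w).
have d0 : 0 <= d by exact: enorm_ge0.
have [dL|dL] := leP d (L / 4).
  have -> : psi (L^-1 *: xi) = 1.
    apply: psi1; rewrite enorm_LV ler_pdivlMr// ler_pdivrMr//.
    by have := enorm_dist xi w; rewrite -/d ler_norml; lra.
  by rewrite subrr Normc.normc0 divr_ge0 ?(ltW L0)// !mulr_ge0 ?exprn_ge0// (le_trans ler01).
apply: (@le_trans _ _ (2 * M)).
  by apply: (le_trans (normcB _ _)); rewrite Normc.normc1 mulr_natl mulr2n lerD.
rewrite ler_pdivlMr//.
have LL : L <= L * L by rewrite ler_peMl// ltW.
have h : L / 4 * (L / 4) <= d * d.
  by apply: ler_pM => //; try exact: ltW; rewrite divr_ge0// ltW.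
rewrite -mulrA mulrA (mulrC 32) -!mulrA [leLHS]mulrCA ler_wpM2l ?(le_trans ler01)// expr2.
lra.
Qed.

Lemma cutoff_theta zeta :
  normc (theta (L^-1 *: zeta) - 1) <= 2 * M * dotp (zeta - zeta0) (zeta - zeta0) / L.
Proof.
have r1 : r <= 1 by case/andP: r_bounds.
have r0 : 0 < r by case/andP: r_bounds => /(lt_le_trans rho0).
have nz0 : enorm zeta0 <= L.
  rewrite /zeta0 enormN xi0_eta0 enormZ X1 mulr1 ger0_norm ?mulr_ge0 ?(ltW r0) ?(ltW L0)//.
  by rewrite ler_piMl// ltW.
rewrite -enorm_sqr; set d := enorm (zeta - zeta0).
have d0 : 0 <= d by exact: enorm_ge0.
have [dL|dL] := leP d L.
  have -> : theta (L^-1 *: zeta) = 1.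
    apply: theta1; rewrite enorm_LV ler_pdivrMr//.
    by have := enorm_dist zeta zeta0; rewrite -/d ler_norml; lra.
  by rewrite subrr Normc.normc0 divr_ge0 ?(ltW L0)// !mulr_ge0 ?exprn_ge0// (le_trans ler01).
apply: (@le_trans _ _ (2 * M)).
  by apply: (le_trans (normcB _ _)); rewrite Normc.normc1 mulr_natl mulr2n lerD.
rewrite ler_pdivlMr//.
have LL : L <= L * L by rewrite ler_peMl// ltW.
have h : L * L <= d * d by apply: ler_pM => //; exact: ltW.
rewrite -!mulrA ler_pM2l// ler_wpM2l ?(le_trans ler01)// expr2.
exact: le_trans h.
Qed.

Let w := (enorm xi0)^-1 *: xi0.
Let w' := (enorm eta0)^-1 *: eta0.

(** Normalised so that the three Gaussians of the comparison have the common exponent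
    [quad / mu ^+ 2], up to a constant; the weight [L ^+ 2] comes from the width [e = mu / L] in the
    total frequency. *)
Let quad xi eta zeta : R :=
  dotp (xi - xi0) (xi - xi0) + dotp (eta - eta0) (eta - eta0) +
  L ^+ 2 * dotp (xi + eta + zeta) (xi + eta + zeta).

(* The total phase of the three propagated waves once the frequencies are centred:
   each bracket is quadratically small, by [phase_bounds]. *)
Let phase xi eta zeta : R := (enorm xi - dotp w xi) + (enorm eta - dotp w' eta) +
  (enorm zeta + dotp X zeta) - dotp X (xi + eta + zeta).

Let rho1 : rho <= 1. Proof. by case/andP: r_bounds => /le_trans h /h. Qed.
Let r0 : 0 < r. Proof. by case/andP: r_bounds => /(lt_le_trans rho0). Qed.
Let zeta0E : enorm zeta0 = r * L.
Proof.
by rewrite /zeta0 enormN xi0_eta0 enormZ X1 mulr1 ger0_norm// mulr_ge0// ltW.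
Qed.

Let dist_zeta xi eta zeta :
  dotp (zeta - zeta0) (zeta - zeta0) <= 3 * quad xi eta zeta.
Proof.
set p := xi - xi0; set q := eta - eta0; set v := xi + eta + zeta.
have -> : zeta - zeta0 = v - p - q.
  by rewrite /v /p /q /zeta0; apply/rowP => j; rewrite !mxE; ring.
have h1 : dotp v v <= L ^+ 2 * dotp v v.
  by rewrite ler_peMl ?dotp_ge0// exprn_ege1.
by apply: (le_trans (dotp_sub_sub_le v p q)); rewrite /quad ler_pM2l// lerD2l.
Qed.

Let quad_ge0 xi eta zeta : 0 <= quad xi eta zeta.
Proof. by rewrite !addr_ge0 ?dotp_ge0// mulr_ge0 ?sqr_ge0 ?dotp_ge0. Qed.

Let phase_le xi eta zeta :
  `|phase xi eta zeta| <= 4 / rho * ((1 + quad xi eta zeta) / L).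
Proof.
set B := (_ / L).
have x0 : 0 < enorm xi0 by case/andP: xi0_bounds => + _; apply: lt_le_trans; rewrite mulr_gt0.
have y0 : 0 < enorm eta0 by case/andP: eta0_bounds => + _; apply: lt_le_trans; rewrite mulr_gt0.
have z0 : 0 < enorm zeta0 by rewrite zeta0E mulr_gt0.
have /andP[a1 a2] := phase_bounds xi x0.
have /andP[b1 b2] := phase_bounds eta y0.
have /andP[c1 c2] := phase_bounds zeta z0.
(* The frequency of the atom points to [- X], so its linearised phase is [- dotp X zeta]. *)
have zX : (enorm zeta0)^-1 *: zeta0 = - X.
  rewrite zeta0E /zeta0 xi0_eta0 -scalerN scalerA mulVf ?scale1r//.
  by rewrite mulf_neq0// gt_eqF.
rewrite zX dotpNl opprK in c1 c2.
rewrite -/w in a1 a2; rewrite -/w' in b1 b2.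
set p := dotp (xi - xi0) _ in a2; set q := dotp (eta - eta0) _ in b2.
set d := dotp (zeta - zeta0) _ in c2.
have Q0 := quad_ge0 xi eta zeta.
have p0 : 0 <= p by exact: dotp_ge0.
have q0 : 0 <= q by exact: dotp_ge0.
have d0 : 0 <= d by exact: dotp_ge0.
have hd : d <= 3 * quad xi eta zeta by exact: dist_zeta.
set v := xi + eta + zeta.
have v0 := dotp_ge0 v.
have hQ : p + q + L ^+ 2 * dotp v v = quad xi eta zeta by [].
have B0 : 0 <= B by apply: divr_ge0; [rewrite addr_ge0|exact: ltW].
have aux (s t : R) : 0 <= s -> 3 / 4 * L <= t -> s / (2 * t) <= s / L * (2 / 3).
  move=> s0 tL; have t0 : 0 < t by apply: lt_le_trans tL; rewrite mulr_gt0.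
  rewrite -mulrA ler_wpM2l// -[2 / 3]invf_div -invfM lef_pV2 ?posrE ?mulr_gt0//.
  by lra.
have k1 : p / (2 * enorm xi0) <= p / L * (2 / 3).
  by apply: aux => //; case/andP: xi0_bounds.
have k2 : q / (2 * enorm eta0) <= q / L * (2 / 3).
  by apply: aux => //; case/andP: eta0_bounds.
have k3 : d / (2 * enorm zeta0) <= (3 / 2) / rho * B.
  rewrite zeta0E.
  apply: (@le_trans _ _ (3 * quad xi eta zeta / (2 * (rho * L)))).
    apply: ler_pM => //; first by rewrite invr_ge0 !mulr_ge0 ?ltW.
    rewrite lef_pV2 ?posrE ?mulr_gt0// ler_pM2l// ler_wpM2r ?(ltW L0)//.
    by case/andP: r_bounds.
  rewrite /B (_ : _ / rho * _ = 3 * (1 + quad xi eta zeta) / (2 * (rho * L))); last first.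
    by field; rewrite !gt_eqF.
  rewrite ler_wpM2r ?invr_ge0 ?mulr_ge0 ?(ltW rho0) ?(ltW L0)//; lra.
(* The term [dotp X v] is linear, not quadratic, in the total frequency. From
   [2 * (L * enorm v) <= 1 + (L * enorm v)^2] it is nevertheless of order [(1 + quad) / L]; the wide
   Gaussian test function is what makes [L * enorm v] controllable. *)
have k4 : enorm v <= B / 2.
  rewrite /B -mulrA -invfM ler_pdivlMr ?mulr_gt0//.
  have := sqr_ge0 (L * enorm v - 1); rewrite sqrrB exprMn enorm_sqr; lra.
have k5 : `|dotp X v| <= enorm v.
  have g1 := dotp_le X v; have g2 := dotp_le (- X) v.
  by rewrite enormN dotpNl X1 mul1r in g2; rewrite X1 mul1r in g1; rewrite ler_norml; lra.
have k6 : (p + q) / L <= B.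
  rewrite /B ler_wpM2r ?invr_ge0 ?(ltW L0)// -hQ.
  have := mulr_ge0 (sqr_ge0 L) v0; lra.
have k7 : B <= B / rho by rewrite ler_pdivlMr// ler_piMr.
have -> : 4 / rho * B = 4 * (B / rho) by ring.
have k3' : d / (2 * enorm zeta0) <= (3 / 2) * (B / rho) by apply: (le_trans k3); rewrite le_eqVlt; apply/orP; left; apply/eqP; ring.
rewrite mulrDl in k6.
rewrite /phase -/v.
rewrite (le_trans (ler_normB _ _))//.
rewrite ger0_norm; last by apply: addr_ge0 => //; exact: addr_ge0.
move: k1 k2 k3' k4 k5 k6 k7 a2 b2 c2.
set B' := B / rho; set pL := p / L; set qL := q / L; clearbody B' pL qL; clearbody B.
move: (p / (2 * enorm xi0)) (q / (2 * enorm eta0)) (d / (2 * enorm zeta0)) => u1 u2 u3.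
move: (enorm xi - _) (enorm eta - _) (enorm zeta + _) `|dotp X v| (enorm v) => u4 u5 u6 u7 u8.
move: B0; lra.
Qed.

Let ratio xi eta zeta :
  normc (expi (phase xi eta zeta) * psi (L^-1 *: xi) * psi (L^-1 *: eta) *
    theta (L^-1 *: zeta) * (atom_hat zeta)%:C%C - (atom_hat zeta0)%:C%C)
  <= interaction_const * ((1 + quad xi eta zeta) / L).
Proof.
set B := (_ / L); set Z := expi _; set P1 := psi _; set P2 := psi _; set T := theta _.
set h := (atom_hat zeta)%:C%C; set k := (atom_hat zeta0)%:C%C.
have Q0 := quad_ge0 xi eta zeta.
have B0 : 0 <= B by apply: divr_ge0; [rewrite addr_ge0|exact: ltW].
have M0 : 0 <= M by rewrite (le_trans ler01).
have QB : quad xi eta zeta / L <= B.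
  by rewrite /B ler_wpM2r ?invr_ge0 ?(ltW L0)// lerDr.
have p0 := dotp_ge0 (xi - xi0); have q0 := dotp_ge0 (eta - eta0).
have v0 : 0 <= L ^+ 2 * dotp (xi + eta + zeta) (xi + eta + zeta).
  by rewrite mulr_ge0 ?sqr_ge0 ?dotp_ge0.
have hZ : normc (Z - 1) <= 8 / rho * B.
  apply: (le_trans (expi_dist _)); have := phase_le xi eta zeta; rewrite -/B.
  rewrite (_ : 8 / rho * B = 2 * (4 / rho * B)); last by ring.
  by rewrite ler_pM2l.
have h1 : normc (P1 - 1) <= 32 * M * B.
  apply: (le_trans (cutoff_psi xi xi0_bounds)).
  rewrite -[leLHS]mulrA ler_wpM2l ?mulr_ge0// (le_trans _ QB)// ler_wpM2r ?invr_ge0 ?(ltW L0)//.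
  by rewrite /quad; lra.
have h2 : normc (P2 - 1) <= 32 * M * B.
  apply: (le_trans (cutoff_psi eta eta0_bounds)).
  rewrite -[leLHS]mulrA ler_wpM2l ?mulr_ge0// (le_trans _ QB)// ler_wpM2r ?invr_ge0 ?(ltW L0)//.
  by rewrite /quad; lra.
have h3 : normc (T - 1) <= 6 * M * B.
  apply: (le_trans (cutoff_theta zeta)).
  rewrite (_ : 6 * M * B = 2 * M * (3 * B)); last by ring.
  rewrite -[leLHS]mulrA ler_wpM2l ?mulr_ge0//.
  apply: (@le_trans _ _ (3 * (quad xi eta zeta / L))); last by rewrite ler_pM2l.
  by rewrite mulrA ler_wpM2r ?invr_ge0 ?(ltW L0)// dist_zeta.
have h4 : normc (h - k) <= C1 * (30 * B).
  have -> : h - k = (atom_hat zeta - atom_hat zeta0)%:C%C by rewrite rmorphB.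
  rewrite normc_real.
  have nz : enorm zeta0 <= L by rewrite zeta0E ler_piMl ?(ltW L0)//; case/andP: r_bounds.
  apply: (le_trans (atom_hat_lipschitz zeta nz)); rewrite ler_wpM2l//.
  rewrite /B mulrA ler_wpM2r ?invr_ge0 ?(ltW L0)//.
  by have := dist_zeta xi eta zeta; lra.
have nh : normc h <= 4 * C1 by rewrite normc_real ger0_norm ?atom_hat_ge0// atom_hat_le.
have nP1 : normc P1 <= M by exact: psiM.
have nP2 : normc P2 <= M by exact: psiM.
have nT : normc T <= M by exact: thetaM.
(* Telescoping: the phase factor and the three cutoffs are replaced by 1 one after another, and at
   last [zeta] by [zeta0] in [atom_hat]. *)
have -> : Z * P1 * P2 * T * h - k = (Z - 1) * (P1 * P2 * T * h) + (P1 - 1) * (P2 * T * h) +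
   (P2 - 1) * (T * h) + (T - 1) * h + (h - k) by ring.
have M2 : M <= M ^+ 3 by rewrite -[leLHS]expr1 ler_weXn2l.
have M3 : M ^+ 2 <= M ^+ 3 by rewrite ler_weXn2l.
have M4 : 1 <= M ^+ 3 by rewrite exprn_ege1.
have H0 : 0 <= 4 * C1 by rewrite mulr_ge0.
have n1 : normc (P1 * P2 * T * h) <= M ^+ 3 * (4 * C1).
  by rewrite !Normc.normcM !exprS expr0 mulr1 -!mulrA; do 3!
    (apply: ler_pM; rewrite ?mulr_ge0 ?normc_ge0//).
have n2 : normc (P2 * T * h) <= M ^+ 3 * (4 * C1).
  apply: (@le_trans _ _ (M ^+ 2 * (4 * C1))); last by rewrite ler_wpM2r.
  by rewrite !Normc.normcM !exprS expr0 mulr1 -!mulrA; do 2!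
    (apply: ler_pM; rewrite ?mulr_ge0 ?normc_ge0//).
have n3 : normc (T * h) <= M ^+ 3 * (4 * C1).
  apply: (@le_trans _ _ (M * (4 * C1))); last by rewrite ler_wpM2r.
  by rewrite !Normc.normcM; apply: ler_pM; rewrite ?normc_ge0.
have n4 : normc h <= M ^+ 3 * (4 * C1) by apply: (le_trans nh); rewrite ler_peMl.
set H := M ^+ 3 * (4 * C1) in n1 n2 n3 n4.
have m1 (z u : R[i]) (s : R) : normc z <= s -> normc u <= H -> normc (z * u) <= s * H.
  by move=> zs uH; rewrite Normc.normcM ler_pM ?normc_ge0.
have g1 := m1 _ _ _ hZ n1; have g2 := m1 _ _ _ h1 n2.
have g3 := m1 _ _ _ h2 n3; have g4 := m1 _ _ _ h3 n4.
do 4! (apply: (le_trans (normcD _ _)); rewrite -lerBrDr).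
apply: (le_trans g1); rewrite !lerBrDr.
have s1 : 8 / rho * B * H + normc ((P1 - 1) * (P2 * T * h)) + normc ((P2 - 1) * (T * h)) +
    normc ((T - 1) * h) + normc (h - k) <=
    8 / rho * B * H + 32 * M * B * H + 32 * M * B * H + 6 * M * B * H + C1 * (30 * B).
  by rewrite !lerD.
apply: (le_trans s1); rewrite /interaction_const -/C1 /H.
rewrite -subr_ge0.
rewrite (_ : _ - _ = C1 * B); first by rewrite mulr_ge0.
by ring.
Qed.

Let e := mu / L.
Let mu0 : 0 < mu. Proof. exact: lt_le_trans mu1. Qed.
Let e0 : 0 < e. Proof. by rewrite divr_gt0. Qed.

(** Half of every exponent, [S] in total, is given up; [ngauss 4] keeps the other half. As [quad] is
    [4 * mu ^+ 2 * S] and [(1 + S) * expR (- S) <= 1], the price is a factor [4 * mu ^+ 2]. *)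
Let ngauss_quad xi eta zeta :
  ngauss 2 mu (xi - xi0) * ngauss 2 mu (eta - eta0) * ngauss 2 e (xi + eta + zeta) *
    (1 + quad xi eta zeta) <=
  4 * mu ^+ 2 * (ngauss 4 mu (xi - xi0) * ngauss 4 mu (eta - eta0) *
    ngauss 4 e (xi + eta + zeta)).
Proof.
have half s x : 0 < s -> ngauss 2 s x = ngauss 4 s x * gaussian ((4 * s ^+ 2)^-1) x.
  move=> s0; rewrite /ngauss -mulrA; congr (_ * _); rewrite /gaussian -expRD; congr expR.
  by field; rewrite gt_eqF.
rewrite !half//.
set g1 := ngauss 4 _ _; set g2 := ngauss 4 _ _; set g3 := ngauss 4 _ _.
set E1 := gaussian _ _; set E2 := gaussian _ _; set E3 := gaussian _ _.
have G0 : 0 <= g1 * g2 * g3.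
  apply: mulr_ge0; [apply: mulr_ge0|]; by apply: ngauss_ge0.
rewrite (_ : _ * (1 + _) = g1 * g2 * g3 * (E1 * E2 * E3 * (1 + quad xi eta zeta))); last by ring.
rewrite [leRHS]mulrC ler_wpM2l//.
set S := quad xi eta zeta / (4 * mu ^+ 2).
have -> : E1 * E2 * E3 = expR (- S).
  rewrite /E1 /E2 /E3 /gaussian -!expRD; congr expR; rewrite /S /quad /e.
  by field; rewrite !gt_eqF.
have S0 : 0 <= S by rewrite /S; apply: divr_ge0 => //; rewrite mulr_ge0 ?sqr_ge0.
have -> : quad xi eta zeta = 4 * mu ^+ 2 * S by rewrite /S; field; rewrite gt_eqF.
rewrite expRN ler_pdivrMl ?expR_gt0//.
have h1 := expR_ge1Dx S.
have m2 : 1 <= mu ^+ 2 by rewrite exprn_ege1.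
have m4 : 0 <= 4 * mu ^+ 2 by rewrite mulr_ge0 ?sqr_ge0.
apply: (@le_trans _ _ ((1 + S) * (4 * mu ^+ 2))); last by rewrite ler_wpM2r.
have := mulr_ge0 S0 (sqr_ge0 mu); lra.
Qed.

Let a := packet_amplitude psi xi0 (X + w).
Let b := packet_amplitude psi eta0 (X + w').

Lemma interaction_pointwise xi eta zeta :
  normc (a xi * b eta * atom_amplitude zeta * (ngauss 2 e (xi + eta + zeta))%:C%C -
    (atom_hat zeta0 * ngauss 2 mu (xi - xi0) * ngauss 2 mu (eta - eta0) *
     ngauss 2 e (xi + eta + zeta))%:C%C) <=
  4 * interaction_const * mu ^+ 2 / L * ngauss 4 mu (xi - xi0) * ngauss 4 mu (eta - eta0) *
     ngauss 4 e (xi + eta + zeta).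
Proof.
(* Here the centres enter: [X + w] and [X + w'] supply [- dotp w xi] and [- dotp w' eta], and their
   part [X] is accounted for by [dotp X zeta - dotp X (xi + eta + zeta) = - dotp X (xi + eta)]. *)
have eE : expi (phase xi eta zeta) = expi (enorm xi) * expi (- dotp xi (X + w)) *
    (expi (enorm eta) * expi (- dotp eta (X + w'))) * expi (enorm zeta).
  rewrite -!expiD; congr expi; rewrite /phase !dotpDr (dotpC xi) (dotpC eta) (dotpC xi w) (dotpC eta w').
  ring.
have nq := ngauss_quad xi eta zeta; have rr := ratio xi eta zeta.
rewrite eE in rr.
set g1 := ngauss 2 mu _ in nq *; set g2 := ngauss 2 mu _ in nq *; set g3 := ngauss 2 e _ in nq *.
have g0 : 0 <= g1 * g2 * g3.
  apply: mulr_ge0; [apply: mulr_ge0|]; by apply: ngauss_ge0.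
set LHS := (X in normc X <= _).
have -> : LHS = (g1 * g2 * g3)%:C%C * (expi (enorm xi) * expi (- dotp xi (X + w)) *
    (expi (enorm eta) * expi (- dotp eta (X + w'))) * expi (enorm zeta) * psi (L^-1 *: xi) *
    psi (L^-1 *: eta) * theta (L^-1 *: zeta) * (atom_hat zeta)%:C%C - (atom_hat zeta0)%:C%C).
  rewrite /LHS /a /b /packet_amplitude /atom_amplitude -/g1 -/g2 !rmorphM/=; ring.
rewrite Normc.normcM normc_real (ger0_norm g0).
apply: (le_trans (ler_wpM2l g0 rr)).
have IC0 : 0 <= interaction_const.
  rewrite /interaction_const; apply: mulr_ge0 => //.
  have M0 : 0 <= M by rewrite (le_trans ler01).
  by rewrite !(addr_ge0, mulr_ge0)// ?exprn_ge0// invr_ge0 ltW.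
rewrite (_ : g1 * g2 * g3 * _ = interaction_const / L * (g1 * g2 * g3 * (1 + quad xi eta zeta))); last by ring.
apply: (@le_trans _ _ (interaction_const / L * (4 * mu ^+ 2 * (ngauss 4 mu (xi - xi0) *
  ngauss 4 mu (eta - eta0) * ngauss 4 e (xi + eta + zeta))))).
  by rewrite ler_wpM2l// divr_ge0// ltW.
by rewrite le_eqVlt; apply/orP; left; apply/eqP; ring.
Qed.

Hypotheses (mpsi : cmeas psi) (mtheta : cmeas theta).

Let cmeas_enorm : cmeas (fun xi : 'rV[R]_n => expi (enorm xi)).
Proof. by apply: cmeas_expi; exact: measurable_enorm. Qed.

Let cmeas_LV (f : 'rV[R]_n -> R[i]) : cmeas f -> cmeas (fun xi => f (L^-1 *: xi)).
Proof. by move=> mf; apply: (cmeas_comp mf); exact: measurable_rVZ. Qed.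

Lemma cintegrable_packet_amplitude w0 y :
  cintegrable lebesgue_rV (packet_amplitude psi w0 y).
Proof.
apply: (@cintegrable_le _ _ _ lebesgue_rV _ (fun xi => M * ngauss 2 mu (xi - w0))).
- apply: cmeasM; first by apply: cmeasM => //; exact: cmeas_LV.
  apply: cmeasM; first by apply: cmeas_expi; apply: measurable_funN; exact: measurable_dotp.
  by apply: cmeas_real; exact: measurable_ngauss.
- move=> xi; rewrite !Normc.normcM !normc_expi !mul1r normc_real ger0_norm ?ngauss_ge0//.
  by rewrite ler_wpM2r ?ngauss_ge0.
- exact: (integrableZl measurableT M (integrable_ngauss w0 _ mu0)).
Qed.

Lemma cintegrable_atom_amplitude : cintegrable lebesgue_rV atom_amplitude.
Proof.
have a0 : 0 < 2^-1 / L ^+ 2 by rewrite divr_gt0 ?invr_gt0 ?exprn_gt0.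
have gE zeta : gaussian 2^-1 (L^-1 *: zeta) = gaussian (2^-1 / L ^+ 2) (zeta - 0).
  by rewrite subr0 /gaussian dotpZl dotpZr; congr (expR (- _)); field; rewrite gt_eqF.
apply: (@cintegrable_le _ _ _ lebesgue_rV _
  (fun xi => (4 * C1 * M) * gaussian (2^-1 / L ^+ 2) (xi - 0))).
- apply: cmeasM; first by apply: cmeasM => //; exact: cmeas_LV.
  apply: cmeas_real; apply: measurable_funM => //; apply: measurable_funM.
    by apply: measurable_gaussian; exact: measurable_rVZ.
  apply: measurable_funB => //; apply: measurable_funM => //.
  have mc : measurable_fun setT (@cos R) by apply: continuous_measurable_fun; exact: continuous_cos.
  have mx : measurable_fun setT (fun x : 'rV[R]_n => L^-1 * x ord0 i0).
    by apply: measurable_funM => //; exact: measurable_rV_coord.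
  exact: (measurableT_comp mc mx).
- move=> xi; rewrite !Normc.normcM !normc_expi !mul1r normc_real ger0_norm ?atom_hat_ge0//.
  rewrite /atom_hat gE.
  have g0 : 0 <= gaussian (2^-1 / L ^+ 2) (xi - 0) by exact: gaussian_ge0.
  rewrite (_ : 4 * C1 * M * _ = M * (C1 * (gaussian (2^-1 / L ^+ 2) (xi - 0) * 4))); last by ring.
  have c0 : 0 <= 2 - 2 * cos (L^-1 * xi ord0 i0).
    by have := cos_le1 (L^-1 * xi ord0 i0); lra.
  apply: ler_pM => //; rewrite ?normc_ge0//; try by do 2!apply: mulr_ge0 => //.
  apply: ler_wpM2l => //; apply: ler_wpM2l => //.
  by have := cos_geN1 (L^-1 * xi ord0 i0); lra.
- exact: (integrableZl measurableT _ (integrable_gaussian 0 a0)).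
Qed.

(** The main term sees [L] only through [zeta0 / L], and [mu] not at all, whereas the error is of
    order [mu ^+ 2 / L]: this is what allows [mu] to be a small multiple of L^(1/2). *)
Lemma packet_interaction : normc (cint lebesgue_rV (fun x =>
      (gaussian (e ^+ 2 / 2) x)%:C%C * ext atom_amplitude x * ext b x * ext a x) -
    (atom_hat zeta0 * (Num.sqrt 2 * Num.sqrt 2 * pi) ^+ n ^+ 3)%:C%C) <=
  4 * interaction_const * mu ^+ 2 / L * (Num.sqrt 2 * Num.sqrt 4 * pi) ^+ n ^+ 3.
Proof.
have ia := cintegrable_packet_amplitude xi0 (X + w).
have ib := cintegrable_packet_amplitude eta0 (X + w').
have ic := cintegrable_atom_amplitude.
have ik : cintegrable lebesgue_rV (fun x : 'rV[R]_n => (gaussian (e ^+ 2 / 2) x)%:C%C).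
  have h : 0 < e ^+ 2 / 2 by rewrite divr_gt0// exprn_gt0.
  have := cintegrable_gaussian (0 : 'rV[R]_n) 0 h.
  by under eq_fun do rewrite dotp0l oppr0 expi0 mul1r subr0.
have T := triple_ngauss mu0 e0 ia ib ic interaction_pointwise.
rewrite (triple_ext ik ia ib ic).
under [X in cint _ X]eq_fun do under [X in cint _ X]eq_fun do
  under [X in cint _ X]eq_fun do rewrite ext_gaussian//.
exact: T.
Qed.

End packet_interaction.

(** * Sums of Gaussians with separated centres *)

Section big_separated.
Context {R : realType}.

(** An integer [d >= 0] satisfies [d <= d ^+ 2], so the terms on each side of [k0] lie below a
    geometric series of ratio [expR (- beta)]. *)
Lemma le_sum_expR_sqr (beta : R) N (k0 : 'I_N) : 0 < beta ->
  \sum_(k < N) expR (- (beta * (k%:R - k0%:R) ^+ 2)) <= 2 / (1 - expR (- beta)).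
Proof.
move=> b0; set q := expR (- beta).
have q0 : 0 <= q by exact: expR_ge0.
have q1 : q < 1 by rewrite expR_lt1 oppr_lt0.
have geo M : \sum_(0 <= i < M) q ^+ i <= (1 - q)^-1.
  rewrite big_mkord; have := subrX1 q M; set S := \sum_(i < M) _ => e.
  rewrite -[leRHS]mul1r ler_pdivlMr ?subr_gt0//.
  have : 0 <= q ^+ M by rewrite exprn_ge0.
  by rewrite mulrBr mulr1; move: e; rewrite mulrBl mul1r; lra.
have le1 (d : nat) : expR (- (beta * d%:R ^+ 2)) <= q ^+ d.
  rewrite /q -expRM_natl ler_expR mulrN lerN2 [leRHS]mulrC ler_wpM2r ?(ltW b0)//.
  by rewrite -natrX ler_nat; case: d => // d; rewrite expnS leq_pmulr// expn_gt0.
rewrite -(big_mkord xpredT (fun k => expR (- (beta * (k%:R - k0%:R) ^+ 2)))).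
rewrite (@big_cat_nat _ _ _ k0.+1)//= [leRHS]mulr_natl mulr2n; apply: lerD.
  rewrite big_nat_rev/= add0n; apply: le_trans (geo k0.+1).
  rewrite !big_nat; apply: ler_sum => k /andP[_ kk].
  rewrite subSS natrB; last exact: kk.
  by rewrite (_ : _ - _ - _ = - k%:R); [rewrite sqrrN|ring].
rewrite -{1}[k0.+1]add0n big_addn; apply: le_trans (geo (N - k0.+1)%N).
apply: ler_sum => k _; rewrite natrD (_ : k%:R + _ - _ = k.+1%:R); last first.
  by rewrite -[k.+1]addn1 -[k0.+1]addn1 !natrD; ring.
by apply: (le_trans (le1 _)); rewrite exprS ler_piMl ?exprn_ge0// ltW.
Qed.


(** If [Y i0] is the centre nearest to [x], the squared distance from [x] to [Y i] is at least a
    quarter of that from [Y i0] to [Y i]. The Gaussians are thus dominated by products over the grid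
    coordinates, and the sum factors into one-dimensional ones. The 8 is this 4 times the 2 in the
    exponent. *)
Lemma le_sum_gaussian_separated p N n (Y : {ffun 'I_p -> 'I_N} * 'I_N -> 'rV[R]_n)
    (mu kap : R) x : 0 < kap ->
  (forall i i' : {ffun 'I_p -> 'I_N} * 'I_N, kap * (\sum_j ((i.1 j)%:R - (i'.1 j)%:R) ^+ 2 + (i.2%:R - i'.2%:R) ^+ 2) <=
     mu ^+ 2 * dotp (Y i - Y i') (Y i - Y i')) ->
  \sum_i gaussian (mu ^+ 2 / 2) (x - Y i) <= (2 / (1 - expR (- (kap / 8)))) ^+ p.+1.
Proof.
move=> kap0 sep.
have k0 : 0 < kap / 8 by rewrite divr_gt0.
set G := 2 / _.
have G0 : 0 <= G.
  by rewrite divr_ge0// subr_ge0 expR_le1 oppr_le0 ltW.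
case: (pickP (fun _ : {ffun 'I_p -> 'I_N} * 'I_N => true)) => [i1 _|no]; last first.
  by rewrite big_pred0// exprn_ge0.
pose i0 := [arg min_(i < i1) dotp (x - Y i) (x - Y i)]%O.
have min0 i : dotp (x - Y i0) (x - Y i0) <= dotp (x - Y i) (x - Y i).
  by rewrite /i0; case: arg_minP => // j _ h; exact: h.
pose E (k k' : 'I_N) : R := expR (- (kap / 8 * (k%:R - k'%:R) ^+ 2)).
have le1 i : gaussian (mu ^+ 2 / 2) (x - Y i) <=
    (\prod_j E (i.1 j) (i0.1 j)) * E i.2 i0.2.
  rewrite /E -expR_sum -expRD ler_expR sumrN -mulr_sumr -opprD -mulrDr lerN2.
  have := sep i i0; have := min0 i.
  have := dotp_ge0 ((x - Y i) + (x - Y i0)).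
  have -> : Y i - Y i0 = (x - Y i0) - (x - Y i).
    by apply/rowP => j; rewrite !mxE; ring.
  move: (x - Y i) (x - Y i0) => a b; rewrite !(dotpDl, dotpDr, dotpNl, dotpNr) (dotpC b a).
  set S := _ + (_ - _) ^+ 2 => h1 h2 h3.
  have h4 : mu ^+ 2 * (dotp b b - dotp a b - (dotp a b - dotp a a)) <= mu ^+ 2 * (4 * dotp a a).
    by rewrite ler_wpM2l ?sqr_ge0//; lra.
  lra.
apply: (le_trans (ler_sum _ (fun i _ => le1 i))).
rewrite -(pair_bigA _ (fun (u : {ffun 'I_p -> 'I_N}) s => (\prod_j E (u j) (i0.1 j)) * E s i0.2))/=.
rewrite -big_distrlr/= -(bigA_distr_bigA (fun j k => E k (i0.1 j)))/= exprSr.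
apply: ler_pM; first by apply: prodr_ge0 => j _; apply: sumr_ge0 => k _; exact: expR_ge0.
- by apply: sumr_ge0 => k _; exact: expR_ge0.
- rewrite -[X in _ ^+ X](card_ord p) -prodr_const; apply: ler_prod => j _.
  by rewrite sumr_ge0/= => [|k _]; [exact: le_sum_expR_sqr|exact: expR_ge0].
- exact: le_sum_expR_sqr.
Qed.

End big_separated.

(** * Geometry of the frequencies and of the initial centres *)

Section focal_points.
Context {R : realType} {p : nat}.
Implicit Types (u : 'rV[R]_p.+1) (s : R) (x : 'rV[R]_p.+2).

(** The sphere near its pole, the first basis vector, as a graph over the other [p.+1]
    coordinates. *)
Definition direction u : 'rV[R]_p.+2 :=
  \row_i oapp (fun j => u ord0 j) (Num.sqrt (1 - dotp u u)) (unlift ord0 i).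

(** Tangent to the sphere at the pole, so transverse to the directions of the cap: varying [s] then
    turns the frequency instead of merely stretching it. A second coordinate is needed for this,
    whence the dimension [p.+2]. *)
Definition axis : 'rV[R]_p.+2 := delta_mx ord0 (lift ord0 ord0).

(* The frequencies [L *: frequency 1 u s] and [L *: frequency (-1) u s'] add up to
   [L * (s + s')] times [direction u]; the half-wave flow moves a packet by minus
   the direction of its frequency, hence from [focus sg u s] to [direction u]. *)
Definition frequency (sg : R) u s : 'rV[R]_p.+2 := sg *: axis + s *: direction u.

Definition focus sg u s : 'rV[R]_p.+2 :=
  direction u + (enorm (frequency sg u s))^-1 *: frequency sg u s.

Lemma direction0 u : direction u ord0 ord0 = Num.sqrt (1 - dotp u u).
Proof. by rewrite mxE unlift_none. Qed.

Lemma direction_lift u j : direction u ord0 (lift ord0 j) = u ord0 j.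
Proof. by rewrite mxE liftK. Qed.

Lemma dotp_recl x y : dotp x y = x ord0 ord0 * y ord0 ord0 +
  \sum_j x ord0 (lift ord0 j) * y ord0 (lift ord0 j).
Proof. exact: big_ord_recl. Qed.

Lemma enorm_direction u : dotp u u <= 1 -> enorm (direction u) = 1.
Proof.
move=> u1; rewrite /enorm dotp_recl direction0.
rewrite -expr2 sqr_sqrtr ?subr_ge0//.
under eq_bigr do rewrite direction_lift.
by rewrite -/(dotp u u) subrK sqrtr1.
Qed.

Lemma dotp_axis : dotp axis axis = 1.
Proof. by rewrite dotp_delta mxE eqxx. Qed.

Lemma dotp_frequency sg u s : dotp u u <= 1 ->
  dotp (frequency sg u s) (frequency sg u s) = sg ^+ 2 + 2 * sg * s * u ord0 ord0 + s ^+ 2.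
Proof.
move=> u1; rewrite !(dotpDl, dotpDr, dotpZl, dotpZr) dotp_axis -enorm_sqr enorm_direction//.
rewrite (dotpC axis (direction u)) /axis dotp_delta direction_lift; ring.
Qed.

Section separation.
Variables (c0 sg : R).
Hypotheses (c0_gt0 : 0 < c0) (c0_small : p.+2%:R * c0 <= 30^-1) (sg1 : sg ^+ 2 = 1).

(** The lower bound on [s] keeps the sum of the two frequencies of a pair comparable to [L]; the
    upper bounds make the focus map a small perturbation of a simple one. *)
Let grid u s := (forall j, 0 <= u ord0 j <= c0) /\ c0 <= s <= 2 * c0.

Lemma cap_size_le : c0 <= 60^-1.
Proof.
have h2 : (2 : R) <= p.+2%:R by rewrite ler_nat.
by have := ler_wpM2r (ltW c0_gt0) h2; move: c0_small; move: (p.+2%:R * c0) => t; lra.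
Qed.

Lemma grid_dotp u s : grid u s -> dotp u u <= c0.
Proof.
move=> [hu _]; apply: (@le_trans _ _ (\sum_(j < p.+1) c0 ^+ 2)).
  apply: ler_sum => j _; have /andP[h1 h2] := hu j; rewrite expr2; exact: ler_pM.
rewrite sumr_const card_ord -mulr_natl.
have h : p.+1%:R * c0 <= 1.
  have h1 : (p.+1%:R : R) <= p.+2%:R by rewrite ler_nat.
  by have := ler_wpM2r (ltW c0_gt0) h1; move: c0_small; move: (p.+2%:R * c0) (p.+1%:R * c0) => t t'; lra.
by rewrite expr2 mulrA ler_piMl// ltW.
Qed.

Let sg_bounds : -1 <= sg <= 1.
Proof. by rewrite -ler_norml -(@expr_le1 _ 2)// real_normK ?num_real// sg1. Qed.

Let Qd u s := dotp (frequency sg u s) (frequency sg u s).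

Lemma grid_frequency u s : grid u s -> 9 / 10 <= Qd u s <= 11 / 10.
Proof.
move=> g; have [hu /andP[s1 s2]] := g; have := cap_size_le.
rewrite /Qd dotp_frequency; last by rewrite (le_trans (grid_dotp g))//; have := cap_size_le; lra.
rewrite sg1; have /andP[u1 u2] := hu ord0; have /andP[g1 g2] := sg_bounds => c1.
have s0 : 0 <= s by lra.
have su : 0 <= s * u ord0 ord0 <= 30^-1 * 1.
  by rewrite mulr_ge0//=; apply: ler_pM => //; lra.
have ss : 0 <= s ^+ 2 <= 30^-1 * 1.
  by rewrite sqr_ge0/= expr2; apply: ler_pM => //; lra.
rewrite -mulrA -mulrA; move: su ss; set t := s * _; set t2 := s ^+ 2 => /andP[t0 t1] /andP[s3 s4].
have h1 : 0 <= (1 - sg) * t by rewrite mulr_ge0//; lra.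
have h2 : 0 <= (1 + sg) * t by rewrite mulr_ge0//; lra.
move: h1 h2; rewrite mulrBl mulrDl mul1r; move: (sg * t) => st; lra.
Qed.

Let inv_bounds u s : grid u s -> 9 / 10 <= (enorm (frequency sg u s))^-1 <= 11 / 10.
Proof.
move=> /grid_frequency; rewrite /Qd -enorm_sqr; have := enorm_ge0 (frequency sg u s).
move: (enorm _) => r r0 /andP[h1 h2].
have rl : 10 / 11 <= r.
  rewrite leNgt; apply/negP => rr; have : r ^+ 2 <= (10 / 11) ^+ 2 by rewrite lerXn2r ?nnegrE//; lra.
  lra.
have ru : r <= 10 / 9.
  rewrite leNgt; apply/negP => rr; have : (10 / 9) ^+ 2 <= r ^+ 2 by rewrite lerXn2r ?nnegrE//; lra.
  lra.
have rp : 0 < r by lra.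
by rewrite -[r^-1]mul1r ler_pdivlMr// ler_pdivrMr//; lra.
Qed.

(** By [dotp_frequency] the squared length varies only through [2 * sg * s * u ord0 ord0 + s ^+ 2],
    whose increments carry a factor [c0]: the normalising factor is almost constant on the grid. *)
Let inv_dist u s u' s' D : grid u s -> grid u' s' -> 0 <= D -> `|s - s'| <= D ->
  (forall j, `|u ord0 j - u' ord0 j| <= D) ->
  `|(enorm (frequency sg u s))^-1 - (enorm (frequency sg u' s'))^-1| <= 12 * c0 * D.
Proof.
move=> g g' D0 sD uD; have b := inv_bounds g; have b' := inv_bounds g'.
have e : (enorm (frequency sg u s))^-1 ^- 2 = Qd u s by rewrite -exprVn invrK enorm_sqr.
have e' : (enorm (frequency sg u' s'))^-1 ^- 2 = Qd u' s' by rewrite -exprVn invrK enorm_sqr.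
move: (enorm (frequency sg u s))^-1 (enorm (frequency sg u' s'))^-1 b b' e e' => r r'.
move=> /andP[b1 b2] /andP[b1' b2'] e e'.
have Qe : `|Qd u s - Qd u' s'| <= 10 * c0 * D.
  have u1 : dotp u u <= 1 by rewrite (le_trans (grid_dotp g))//; have := cap_size_le; lra.
  have u1' : dotp u' u' <= 1 by rewrite (le_trans (grid_dotp g'))//; have := cap_size_le; lra.
  rewrite /Qd !dotp_frequency//.
  have [/(_ ord0)/andP[v1 v2] /andP[s1 s2]] := g.
  have [/(_ ord0)/andP[v1' v2'] /andP[s1' s2']] := g'.
  have uD0 := uD ord0; move: (u ord0 ord0) (u' ord0 ord0) v1 v2 v1' v2' uD0 => v v' v1 v2 v1' v2' uD0.
  have -> : sg ^+ 2 + 2 * sg * s * v + s ^+ 2 - (sg ^+ 2 + 2 * sg * s' * v' + s' ^+ 2) =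
    2 * sg * ((s - s') * v + s' * (v - v')) + (s - s') * (s + s') by ring.
  have a1 : `|(s - s') * v| <= D * c0 by rewrite normrM ler_pM// ger0_norm.
  have a2 : `|s' * (v - v')| <= 2 * c0 * D by rewrite normrM ler_pM// ger0_norm//; lra.
  have a3 : `|(s - s') * (s + s')| <= D * (4 * c0) by rewrite normrM ler_pM// ger0_norm; lra.
  have a4 : `|2 * sg * ((s - s') * v + s' * (v - v'))| <= 2 * (D * c0 + 2 * c0 * D).
    rewrite normrM ler_pM//; first by rewrite normrM ger0_norm// ler_piMr// ler_norml.
    by rewrite (le_trans (ler_normD _ _))// lerD.
  by rewrite (le_trans (ler_normD _ _))//; lra.
have r0 : 0 < r by lra.
have r0' : 0 < r' by lra.
have k : `|r - r'| * (r + r') = r ^+ 2 * r' ^+ 2 * `|Qd u s - Qd u' s'|.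
  have n1 : `|r + r'| = r + r' by rewrite ger0_norm// addr_ge0// ltW.
  have n2 : `|r ^+ 2 * r' ^+ 2| = r ^+ 2 * r' ^+ 2 by rewrite ger0_norm// mulr_ge0// sqr_ge0.
  rewrite -[X in _ * X]n1 -[X in _ = X * _]n2 -!normrM -e -e' -normrN; congr `|_|.
  by field; rewrite !gt_eqF.
have k1 : `|r - r'| * (9 / 5) <= `|r - r'| * (r + r') by rewrite ler_wpM2l//; lra.
have k2 : r ^+ 2 * r' ^+ 2 <= (11 / 10) ^+ 2 * (11 / 10) ^+ 2.
  by apply: ler_pM; rewrite ?sqr_ge0// lerXn2r// nnegrE ?(ltW r0) ?(ltW r0')//; lra.
have k3 : r ^+ 2 * r' ^+ 2 * `|Qd u s - Qd u' s'| <= (11 / 10) ^+ 2 * (11 / 10) ^+ 2 * (10 * c0 * D).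
  by rewrite ler_pM// mulr_ge0// sqr_ge0.
have cD : 0 <= c0 * D by rewrite mulr_ge0// ltW.
rewrite -k in k3; rewrite -(mulrA 10) in k3; rewrite -(mulrA 12).
move: k1 k3 cD; move: (c0 * D) `|r - r'| (_ * (r + r')) => t1 t2 t3; lra.
Qed.
Let focus_lift u s j : focus sg u s ord0 (lift ord0 j) =
  u ord0 j * (1 + s * (enorm (frequency sg u s))^-1) +
  sg * (j == ord0)%:R * (enorm (frequency sg u s))^-1.
Proof. by rewrite /focus mxE direction_lift !mxE eqxx (inj_eq lift_inj) liftK/=; ring. Qed.

Let focus0 u s : focus sg u s ord0 ord0 =
  Num.sqrt (1 - dotp u u) * (1 + s * (enorm (frequency sg u s))^-1).
Proof. by rewrite /focus mxE direction0 !mxE unlift_none/=; ring. Qed.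

Let sqrt_bounds v t : grid v t -> 9 / 10 <= Num.sqrt (1 - dotp v v) <= 1.
Proof.
move=> gv; have c1 := cap_size_le.
have h1 := grid_dotp gv; have h0 := dotp_ge0 v.
have := sqrtr_ge0 (1 - dotp v v).
have : Num.sqrt (1 - dotp v v) ^+ 2 = 1 - dotp v v by rewrite sqr_sqrtr//; lra.
move: (Num.sqrt _) => q q2 q0; apply/andP; split; rewrite leNgt; apply/negP => ql.
  have : q ^+ 2 <= (9 / 10) ^+ 2 by rewrite lerXn2r ?nnegrE//; lra.
  lra.
have : 1 < q ^+ 2 by rewrite exprn_egt1.
lra.
Qed.

Let sqrt_dist u s u' s' D : grid u s -> grid u' s' -> 0 <= D ->
  (forall j, `|u ord0 j - u' ord0 j| <= D) ->
  `|Num.sqrt (1 - dotp u u) - Num.sqrt (1 - dotp u' u')| * (9 / 5) <= 15^-1 * D.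
Proof.
move=> g g' D0 uD; have [hu _] := g; have [hu' _] := g'.
have c1 := cap_size_le; have c0D0 : 0 <= c0 * D by rewrite mulr_ge0// ltW.
have /andP[q1 q2] := sqrt_bounds g; have /andP[q1' q2'] := sqrt_bounds g'.
apply: (@le_trans _ _ (`|dotp u u - dotp u' u'|)).
  have e : (Num.sqrt (1 - dotp u u) - Num.sqrt (1 - dotp u' u')) *
      (Num.sqrt (1 - dotp u u) + Num.sqrt (1 - dotp u' u')) = dotp u' u' - dotp u u.
    rewrite mulrDr !mulrBl -!expr2 !sqr_sqrtr ?subr_ge0; first by ring.
      by rewrite (le_trans (grid_dotp g'))//; lra.
    by rewrite (le_trans (grid_dotp g))//; lra.
  by rewrite (distrC (dotp u u)) -e normrM ler_wpM2l// ger0_norm; lra.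
rewrite /dotp -sumrB (le_trans (ler_norm_sum _ _ _))//.
apply: (@le_trans _ _ (\sum_(i < p.+1) D * (2 * c0))).
  apply: ler_sum => i _; rewrite -!expr2 subr_sqr normrM ler_pM//.
  have /andP[v1 v2] := hu i; have /andP[v1' v2'] := hu' i.
  by rewrite ger0_norm; lra.
rewrite sumr_const card_ord (_ : D * _ *+ p.+1 = 2 * (p.+1%:R * (c0 * D))); last first.
  by rewrite -[LHS]mulr_natr; ring.
have h1 : (p.+1%:R : R) <= p.+2%:R by rewrite ler_nat.
have h2 := ler_wpM2r c0D0 h1; have h3 := ler_wpM2r D0 c0_small.
rewrite -(mulrA p.+2%:R) in h3; move: h2 h3.
by move: (p.+2%:R * _) (p.+1%:R * _) => t t'; lra.
Qed.

Let bound1 (t : R) : 0 <= t <= 30^-1 * (11 / 10) -> `|1 + t| <= 11 / 10.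
Proof. by move=> /andP[t0 t1]; rewrite ger0_norm; lra. Qed.

(** The closing arithmetic of [focus_dist], on abstract reals: [a] is the displacement of the
    coordinate considered, [b] its main part, the other letters are error terms and the small
    quantities that bound them. *)
Let combine0 (a b c d e f g D : R) : b <= a + e -> 9 / 10 * (9 / 10) * D <= b ->
  c <= 24 / 60 * g -> d <= f * (11 / 10) -> e <= c + d -> f * (9 / 5) <= 15^-1 * D ->
  g <= 60^-1 * D -> 0 <= D -> D / 2 <= a.
Proof. lra. Qed.

Let combine_lift (a b c d e f g D : R) : D <= a + b -> c <= D * (30^-1 * (11 / 10)) ->
  d <= 2 * g -> e <= 1 * (12 * g) -> b <= f + e -> f <= c + d ->
  g <= 60^-1 * D -> 0 <= D -> D / 2 <= a.
Proof. lra. Qed.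

(** [D] is the largest difference of parameters, and one coordinate of the focus shows it. If it
    comes from [s], this is coordinate 0, where the direction is close to 1 and nearly stationary in
    [u]. If it comes from some coordinate of [u], it is the corresponding one, where [s] occurs
    multiplied by a small number. The normalising factor is harmless by [inv_dist]. *)
Let focus_dist u s u' s' D : grid u s -> grid u' s' -> 0 <= D -> `|s - s'| <= D ->
  (forall j, `|u ord0 j - u' ord0 j| <= D) ->
  D = `|s - s'| \/ (exists j, D = `|u ord0 j - u' ord0 j|) ->
  D <= 2 * enorm (focus sg u s - focus sg u' s').
Proof.
move=> g g' D0 sD uD De.
have bb := inv_dist g g' D0 sD uD; have b := inv_bounds g; have b' := inv_bounds g'.
have [hu hs] := g; have [hu' hs'] := g'.
set Y := focus sg u s - _.
have YE i : Y ord0 i = focus sg u s ord0 i - focus sg u' s' ord0 i by rewrite !mxE.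
have c1 := cap_size_le.
have k (i : 'I_p.+2) : D / 2 <= `|focus sg u s ord0 i - focus sg u' s' ord0 i| -> D <= 2 * enorm Y.
  by have := enorm_coord Y i; rewrite YE; lra.
have lift_rE := focus_lift u s; have lift_rE' := focus_lift u' s'.
have zeroE := focus0 u s; have zeroE' := focus0 u' s'.
move: (enorm (frequency sg u s))^-1 (enorm (frequency sg u' s'))^-1 b b' bb lift_rE lift_rE' zeroE zeroE'.
move=> r r' /andP[b1 b2] /andP[b1' b2'] bb lift_rE lift_rE' zeroE zeroE'.
have AA : s' * `|r - r'| <= 2 * c0 * (12 * 60^-1 * D).
  apply: ler_pM => //; [lra|lra|].
  by apply: (le_trans bb); rewrite ler_wpM2r//; lra.
have c0D : c0 * D <= 60^-1 * D by rewrite ler_wpM2r.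
have c0D0 : 0 <= c0 * D by rewrite mulr_ge0// ltW.
have sr : `|s * r - s' * r'| <= 2 * D.
  rewrite (_ : s * r - s' * r' = (s - s') * r + s' * (r - r')); last by ring.
  rewrite (le_trans (ler_normD _ _))//.
  have a1 : `|(s - s') * r| <= D * (11 / 10) by rewrite normrM ler_pM// ger0_norm//; lra.
  have a2 : `|s' * (r - r')| <= D * (1 / 10).
    rewrite normrM (ger0_norm (_ : 0 <= s')); last by lra.
    by apply: (le_trans AA); lra.
  lra.
have r_ge0 : 0 <= r by lra.
have r_ge0' : 0 <= r' by lra.
have s_ge0' : 0 <= s' by lra.
have s_ge0 : 0 <= s by lra.
have s_le : s <= 30^-1 by lra.
have s_le' : s' <= 30^-1 by lra.
case: De => [De|[j De]].
  apply: (k ord0); rewrite zeroE zeroE'.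
  have /andP[q1 q2] := sqrt_bounds g; have /andP[q1' q2'] := sqrt_bounds g'.
  have dq := sqrt_dist g g' D0 uD.
  move: (Num.sqrt _) (Num.sqrt (1 - dotp u' u')) q1 q2 q1' q2' dq => q q' q1 q2 q1' q2' dq.
  set T := _ - _.
  have Te : q * r * (s - s') = T - (q * (s' * (r - r')) + (q - q') * (1 + s' * r')).
    by rewrite /T; ring.
  have t1 : `|q * r * (s - s')| <= `|T| + `|q * (s' * (r - r')) + (q - q') * (1 + s' * r')|.
    by rewrite Te ler_normB.
  have t2 : 9 / 10 * (9 / 10) * D <= `|q * r * (s - s')|.
    have q0 : 0 <= q by lra.
    by rewrite normrM -De ler_wpM2r// ger0_norm ?mulr_ge0// ler_pM.
  have t3 : `|q * (s' * (r - r'))| <= 1 * (2 * c0 * (12 * 60^-1 * D)).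
    have q0 : 0 <= q by lra.
    by rewrite normrM (ger0_norm q0) ler_pM// normrM (ger0_norm s_ge0').
  have t4 : `|(q - q') * (1 + s' * r')| <= `|q - q'| * (11 / 10).
    rewrite normrM ler_wpM2l//.
    have s'r' : 0 <= s' * r' <= 30^-1 * (11 / 10).
      by rewrite mulr_ge0//= ler_pM.
    exact: bound1 s'r'.
  have t5 := ler_normD (q * (s' * (r - r'))) ((q - q') * (1 + s' * r')).
  move: t1 t2 t3 t4 t5 dq c0D D0; rewrite (_ : 1 * _ = 24 / 60 * (c0 * D)); last by ring.
  exact: combine0.
apply: (k (lift ord0 j)); rewrite lift_rE lift_rE'.
set d : R := (j == ord0)%:R.
have d1 : `|sg * d| <= 1.
  rewrite normrM -[leRHS]mulr1 ler_pM//; first by rewrite ler_norml.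
  by rewrite /d; case: (j == ord0); rewrite /= ?normr1 ?normr0.
have hv := hu' j; move: (u ord0 j) (u' ord0 j) De hv => v v' De /andP[v1 v2]; set T := _ - _.
have Te : v - v' = T - ((v - v') * (s * r) + v' * (s * r - s' * r') + sg * d * (r - r')).
  by rewrite /T; ring.
have t1 : D <= `|T| + `|(v - v') * (s * r) + v' * (s * r - s' * r') + sg * d * (r - r')|.
  by rewrite [X in X <= _]De [X in `|X| <= _]Te ler_normB.
have t2 : `|(v - v') * (s * r)| <= D * (30^-1 * (11 / 10)).
  by rewrite normrM -De ler_wpM2l// ger0_norm ?mulr_ge0// ler_pM.
have t3 : `|v' * (s * r - s' * r')| <= c0 * (2 * D).
  by rewrite normrM ler_pM// ger0_norm.
have t4 : `|sg * d * (r - r')| <= 1 * (12 * c0 * D) by rewrite normrM ler_pM.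
have t5 := ler_normD ((v - v') * (s * r) + v' * (s * r - s' * r')) (sg * d * (r - r')).
have t6 := ler_normD ((v - v') * (s * r)) (v' * (s * r - s' * r')).
rewrite -(mulrA 12) in t4; rewrite [leRHS]mulrCA in t3.
move: t1 t2 t3 t4 t5 t6 c0D D0.
exact: combine_lift.
Qed.
Let focus_separated u s u' s' : grid u s -> grid u' s' ->
  \sum_j (u ord0 j - u' ord0 j) ^+ 2 + (s - s') ^+ 2 <= 4 * p.+2%:R *
    dotp (focus sg u s - focus sg u' s') (focus sg u s - focus sg u' s').
Proof.
move=> g g'.
pose j := [arg max_(j > ord0) `|u ord0 j - u' ord0 j|]%O.
have jmax i : `|u ord0 i - u' ord0 i| <= `|u ord0 j - u' ord0 j|.
  by rewrite /j; case: arg_maxP => // k _; exact.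
have [D D0 [sD uD De]] : exists2 D, 0 <= D & [/\ `|s - s'| <= D,
    forall j, `|u ord0 j - u' ord0 j| <= D &
    D = `|s - s'| \/ (exists j, D = `|u ord0 j - u' ord0 j|)].
  have [h|/ltW h] := leP `|s - s'| `|u ord0 j - u' ord0 j|.
    by exists `|u ord0 j - u' ord0 j| => //; split => //; right; exists j.
  exists `|s - s'| => //; split => //; last by left.
  by move=> i; rewrite (le_trans (jmax i)).
have sq (t : R) : `|t| <= D -> t ^+ 2 <= D ^+ 2.
  by move=> tD; rewrite -real_normK ?num_real// lerXn2r// nnegrE.
have DY := focus_dist g g' D0 sD uD De.
apply: (@le_trans _ _ (p.+2%:R * D ^+ 2)).
  rewrite -[p.+2]addn1 natrD mulrDl mul1r lerD ?sq// mulr_natl.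
  rewrite -[X in _ *+ X](card_ord p.+1) -sumr_const ler_sum// => i _; exact: sq.
rewrite mulrAC [leRHS]mulrC ler_wpM2l// -enorm_sqr.
rewrite (_ : 4 * _ = (2 * enorm (focus sg u s - focus sg u' s')) ^+ 2); last by ring.
by rewrite lerXn2r// nnegrE// mulr_ge0// enorm_ge0.
Qed.

Variables (mu : R) (N : nat).
Hypotheses (mu_gt0 : 0 < mu) (N_le : N%:R <= c0 * mu).

(** The spacing [mu^-1] of nodes and levels is the spatial width of the packets, and [N <= c0 * mu]
    keeps them inside [grid]. *)
Definition node (k : {ffun 'I_p.+1 -> 'I_N}) : 'rV[R]_p.+1 := \row_j ((k j)%:R / mu).
Definition level (l : 'I_N) : R := c0 + l%:R / mu.

Let le_ord (l : 'I_N) : 0 <= l%:R / mu <= c0.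
Proof.
apply/andP; split; first by rewrite divr_ge0// ltW.
by rewrite ler_pdivrMr//; apply: le_trans N_le; rewrite ler_nat ltnW.
Qed.

Let grid_node k l : grid (node k) (level l).
Proof.
split=> [j|]; first by rewrite mxE; exact: le_ord.
by rewrite /level; have /andP[h1 h2] := le_ord l; apply/andP; split; lra.
Qed.

Lemma node_dotp k : dotp (node k) (node k) <= c0.
Proof.
have [l _|no] := pickP (fun _ : 'I_N => true); first exact: (grid_dotp (grid_node k l)).
by have := no (k ord0).
Qed.

Lemma level_bounds l : c0 <= level l <= 2 * c0.
Proof. by have := le_ord l; rewrite /level lerDl [2 * c0]mulr_natl mulr2n lerD2l. Qed.

Lemma enorm_frequency_node k l : 3 / 4 <= enorm (frequency sg (node k) (level l)) <= 3 / 2.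
Proof.
have := grid_frequency (grid_node k l); rewrite /Qd -enorm_sqr.
have := enorm_ge0 (frequency sg (node k) (level l)).
move: (enorm _) => r r0 /andP[h1 h2]; apply/andP; split; rewrite leNgt; apply/negP => rr.
  have : r ^+ 2 <= (3 / 4) ^+ 2 by rewrite lerXn2r ?nnegrE//; lra.
  lra.
have : (3 / 2) ^+ 2 <= r ^+ 2 by rewrite lerXn2r ?nnegrE//; lra.
lra.
Qed.

(** By [focus_separated] the focus map contracts distances by at most a constant depending on the
    dimension, so this bound on the packets does not involve [mu] or [N]. *)
Lemma le_sum_gaussian_focus x :
  \sum_(i : {ffun 'I_p.+1 -> 'I_N} * 'I_N)
    gaussian (mu ^+ 2 / 2) (x - focus sg (node i.1) (level i.2)) <=
  (2 / (1 - expR (- ((4 * p.+2%:R)^-1 / 8)))) ^+ p.+2.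
Proof.
have n0 : 0 < (4 * p.+2%:R : R) by rewrite mulr_gt0.
apply: (le_sum_gaussian_separated (Y := fun i => focus sg (node i.1) (level i.2))).
  by rewrite invr_gt0.
move=> i i'; rewrite ler_pdivrMl// mulrCA.
have := focus_separated (grid_node i.1 i.2) (grid_node i'.1 i'.2).
move=> /(ler_wpM2l (sqr_ge0 mu)); apply: le_trans.
rewrite mulrDr le_eqVlt; apply/orP; left; apply/eqP; congr (_ + _).
  rewrite mulr_sumr; apply: eq_bigr => j _; rewrite !mxE.
  by field; rewrite gt_eqF.
by rewrite /level; field; rewrite gt_eqF.
Qed.

End separation.
End focal_points.

(** * Bounds for cutoffs and for L^1 and L^oo norms *)

Section test_functions.
Context {R : realType} {n : nat}.
Local Notation normc := (@Normc.normc R).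
Local Notation leb := (@lebesgue_rV R n).

Lemma test_function_bounded (f : 'rV[R]_n -> R[i]) : test_function f ->
  exists2 M, 1 <= M & forall x, normc (f x) <= M.
Proof.
move=> [[s1 s2] cK].
have bnd (u : 'rV[R]_n -> R) : continuous u -> (forall x, u x != 0 -> supp f x) ->
    exists M, forall x, `|u x| <= M.
  move=> cu uK.
  have [M [_ hM]] := compact_bounded (continuous_compact (continuous_subspaceT cu) cK).
  exists (`|M| + 1) => x; have [->|ux] := eqVneq (u x) 0; first by rewrite normr0 addr_ge0.
  apply: (hM (`|M| + 1)); first by rewrite (le_lt_trans (ler_norm _))// ltrDl.
  by exists x => //; exact: uK.
have K0 x : f x != 0 -> supp f x by move=> fx; exact: subset_closure.
have [M1 h1] : exists M, forall x, `|complex.Re (f x)| <= M.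
  apply: bnd; first exact: (proj1 (s1 [::])).
  by move=> x hx; apply: K0; apply: contra hx => /eqP ->.
have [M2 h2] : exists M, forall x, `|complex.Im (f x)| <= M.
  apply: bnd; first exact: (proj1 (s2 [::])).
  by move=> x hx; apply: K0; apply: contra hx => /eqP ->.
exists (Num.max 1 (M1 + M2)) => [|x]; first by rewrite le_max lexx.
apply: (le_trans (normc_le_ReIm _)); rewrite le_max; apply/orP; right; exact: lerD.
Qed.

Lemma cnorm_Loo_le (f : 'rV[R]_n -> R[i]) (C : R) : 0 <= C ->
  (forall x, normc (f x) <= C) -> (cnorm_Lp +oo%E f <= C%:E)%E.
Proof.
(* The L^oo norm is an essential supremum when the whole space has positive measure, and 0
   otherwise. *)
move=> C0 fC; rewrite /cnorm_Lp unlock; case: ifPn => _; last by rewrite lee_fin.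
by apply/ess_supP; apply: nearW => x /=; rewrite lee_fin ger0_norm ?normc_ge0.
Qed.

Lemma le_cnorm_L1 (f : 'rV[R]_n -> R[i]) (k : 'rV[R]_n -> R) : cmeas f ->
  (forall x, 0 <= k x <= 1) -> cintegrable leb (fun x => (k x)%:C%C * f x) ->
  ((normc (cint leb (fun x => (k x)%:C%C * f x)))%:E <= cnorm_Lp 1%E f)%E.
Proof.
move=> mf k01 ikf; have inkf := cintegrable_normc ikf.
have := normc_cint_le (cintegrable_cmeas ikf) (fun=> lexx _) inkf.
rewrite -lee_fin => /le_trans; apply.
rewrite /Rintegral fineK; last exact: integrable_fin_num.
rewrite /cnorm_Lp Lnorm1; apply: ge0_le_integral => //.
- by move=> x _; rewrite lee_fin normc_ge0.
- by case/integrableP: inkf.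
- by apply: measurableT_comp => //; apply/measurable_EFinP; exact: cmeas_normc.
- move=> x _; rewrite /= lee_fin Normc.normcM normc_real (ger0_norm (normc_ge0 (f x))).
  by have /andP[k0 k1] := k01 x; rewrite ger0_norm// ler_piMl// normc_ge0.
Qed.

End test_functions.

(* The signs are chosen one at a time, so that the cross terms of the new index
   with the previous ones are nonnegative. *)
Lemma exists_signs {R : realFieldType} (I : finType) (J : I -> I -> R) :
  exists2 eps : I -> R, (forall u, `|eps u| = 1) &
    \sum_u J u u <= \sum_u \sum_v eps u * eps v * J u v.
Proof.
suff H (r : seq I) : uniq r -> exists2 eps : I -> R, (forall u, `|eps u| = 1) &
    \sum_(u <- r) J u u <= \sum_(u <- r) \sum_(v <- r) eps u * eps v * J u v.
  by apply: H; exact: index_enum_uniq.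
elim: r => [_|a r ih /= /andP[ar /ih[eps eps1 h]]].
  by exists (fun=> 1) => [u|]; rewrite ?normr1// !big_nil.
pose T := \sum_(u <- r) eps u * (J u a + J a u).
pose t : R := if 0 <= T then 1 else -1.
have t1 : `|t| = 1 by rewrite /t; case: ifP; rewrite ?normrN normr1.
have tT : 0 <= t * T.
  by rewrite /t; case: (leP 0 T) => T0; rewrite ?mul1r// mulN1r oppr_ge0 ltW.
exists (fun u => if u == a then t else eps u) => [u|]; first by case: ifP.
have e u : u \in r -> (if u == a then t else eps u) = eps u.
  by move=> ur; case: eqP => // ua; move: ar; rewrite -ua ur.
have tt : t * t = 1 by rewrite /t; case: ifP => _; rewrite ?mulrNN mulr1.
rewrite !big_cons eqxx tt mul1r.
have -> : \sum_(u <- r) \sum_(v <- a :: r) (if u == a then t else eps u) *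
    (if v == a then t else eps v) * J u v =
    \sum_(u <- r) t * (eps u * J u a) + \sum_(u <- r) \sum_(v <- r) eps u * eps v * J u v.
  rewrite -big_split/= [LHS]big_seq [RHS]big_seq; apply: eq_bigr => u ur.
  rewrite big_cons eqxx e// [X in _ + X = _]big_seq [X in _ = _ + X]big_seq; congr (_ + _).
    by ring.
  by apply: eq_bigr => v vr; rewrite e.
have -> : \sum_(v <- r) t * (if v == a then t else eps v) * J a v =
    \sum_(v <- r) t * (eps v * J a v).
  by rewrite [LHS]big_seq [RHS]big_seq; apply: eq_bigr => v vr; rewrite e// mulrA.
rewrite -addrA lerD2l addrA -big_split/=.
have -> : \sum_(v <- r) (t * (eps v * J a v) + t * (eps v * J v a)) = t * T.
  by rewrite mulr_sumr; apply: eq_bigr => v _; ring.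
by rewrite (le_trans h)// lerDr.
Qed.

(** * The half-wave evolution of sums of packets and of the atom *)

Section wave_packets.
Context {R : realType} {n : nat}.
Local Notation normc := (@Normc.normc R).
Local Notation leb := (@lebesgue_rV R n).

Lemma wave_multiplier_sum (I : finType) (kap : 'rV[R]_n -> R[i]) (j : nat)
    (z : I -> R) (f A : I -> 'rV[R]_n -> R[i]) x :
  (forall i xi, cintegrable leb (fun y => expi (- dotp xi y) * f i y)) ->
  (forall i, cintegrable leb (A i)) ->
  (forall i xi, expi (enorm xi) * kap (2 ^- j *: xi) * fourier (f i) xi = A i xi) ->
  wave_multiplier kap j (fun y => \sum_i (z i)%:C%C * f i y) x =
  ((2 * pi) ^- n)%:C%C * \sum_i (z i)%:C%C * ext (A i) x.
Proof.
move=> fi Ai fA; rewrite /wave_multiplier /multiplier; congr (_ * _).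
have fE xi : fourier (fun y => \sum_i (z i)%:C%C * f i y) xi = \sum_i (z i)%:C%C * fourier (f i) xi.
  rewrite /fourier -[LHS]/(cint _ _).
  under [X in cint _ X]eq_fun do rewrite mulr_sumr.
  under [X in cint _ X]eq_fun do under eq_bigr do rewrite mulrCA.
  have h i : cintegrable leb (fun y => (z i)%:C%C * (expi (- dotp xi y) * f i y)).
    by apply: cintegrableZ; exact: fi.
  rewrite (cint_sum _ h); apply: eq_bigr => i _; rewrite cintZ//; exact: fi.
rewrite -[LHS]/(cint _ _).
under [X in cint _ X]eq_fun do rewrite fE mulr_sumr.
under [X in cint _ X]eq_fun => xi do under eq_bigr => i _ do
  rewrite mulrCA -[expi (dotp _ _) * _ * _]mulrA fA.
have h i : cintegrable leb (fun xi => (z i)%:C%C * (expi (dotp x xi) * A i xi)).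
  by apply: cintegrableZ; exact: cintegrable_wave.
rewrite (cint_sum _ h); apply: eq_bigr => i _; rewrite cintZ//.
exact: cintegrable_wave.
Qed.

Variable i0 : 'I_n.

(** The scaled atom is a combination of three packets of frequency 0, with weights 2, -1, -1 and
    centres 0 and plus or minus [d / L]; its regularity and its transform come from those of
    packets. *)
Let atom_weight (b : 'I_3) : R := if b == ord0 then 2 else -1.
Let atom_offset (b : 'I_3) : R := if b == ord0 then 0 else if b == ord_max then 1 else -1.
Let d : 'rV[R]_n := delta_mx ord0 i0.

Let scaled_atomE (L : R) : 0 < L -> scaled_atom i0 L =
  fun x => \sum_b (L ^+ n * atom_weight b)%:C%C * packet L 0 ((atom_offset b / L) *: d) x.
Proof.
move=> L0; apply/funext => x.
have pE c : packet L 0 ((c / L) *: d) x = (gaussian 2^-1 (L *: x - c *: d))%:C%C.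
  rewrite /packet dotp0l expi0 mul1r /gaussian; congr (expR (- _))%:C%C.
  have -> : L *: x - c *: d = L *: (x - (c / L) *: d).
    by rewrite scalerBr scalerA mulrCA mulfV ?mulr1// gt_eqF.
  by rewrite dotpZl dotpZr; ring.
under eq_bigr do rewrite pE -rmorphM/=.
rewrite -rmorph_sum/= /scaled_atom; congr (_%:C)%C.
rewrite !big_ord_recl big_ord0 /atom_weight /atom_offset/=.
rewrite /atom /atom_half scale0r subr0 scale1r scaleN1r opprK subrK -/d.
ring.
Qed.

Lemma schwartz_scaled_atom (L : R) : 0 < L -> schwartz (scaled_atom i0 L).
Proof.
move=> L0; rewrite scaled_atomE//; apply: cgaussian_class_schwartz.
apply: cgaussian_class_sum => b; apply: cgaussian_classZ; exact: cgaussian_class_packet.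
Qed.

Lemma fourier_scaled_atom (L : R) xi : 0 < L ->
  fourier (scaled_atom i0 L) xi = (atom_hat i0 L xi)%:C%C.
Proof.
move=> L0; rewrite scaled_atomE// /fourier -[LHS]/(cint _ _).
under [X in cint _ X]eq_fun do rewrite mulr_sumr.
under [X in cint _ X]eq_fun do under eq_bigr do rewrite mulrCA.
have h b : cintegrable leb (fun y => (L ^+ n * atom_weight b)%:C%C *
    (expi (- dotp xi y) * packet L 0 ((atom_offset b / L) *: d) y)).
  by apply: cintegrableZ; exact: cintegrable_packet.
have hf b : cint leb (fun y => (L ^+ n * atom_weight b)%:C%C *
    (expi (- dotp xi y) * packet L 0 ((atom_offset b / L) *: d) y)) =
    (Num.sqrt (2 * pi) ^+ n * gaussian 2^-1 (L^-1 *: xi) * atom_weight b)%:C%C *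
    expi (- (atom_offset b * (L^-1 * xi ord0 i0))).
  rewrite cintZ; last exact: cintegrable_packet.
  rewrite -[X in _ * X]/(fourier _ _) fourier_packet// dotpZr dotp_delta subr0.
  have -> : gaussian (2 * L ^+ 2)^-1 xi = gaussian 2^-1 (L^-1 *: xi).
    by rewrite /gaussian dotpZl dotpZr; congr (expR (- _)); field; rewrite gt_eqF.
  rewrite mulrCA -rmorphM/= [LHS]mulrC mulrA; congr ((_%:C)%C * expi (- _)).
    by rewrite expr_div_n; field; rewrite expf_neq0// gt_eqF.
  by ring.
rewrite (cint_sum _ h); under eq_bigr do rewrite hf.
rewrite !big_ord_recl big_ord0 /atom_weight /atom_offset/=.
rewrite mul0r oppr0 expi0 mul1r mulN1r opprK /atom_hat /expi cosN sinN.
set K := Num.sqrt _ ^+ n; set G := gaussian _ _; set t := _ * xi _ _.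
by rewrite addr0; congr (_ +i* _)%C; ring.
Qed.

Lemma wave_multiplier_atom (theta : 'rV[R]_n -> R[i]) (j : nat) x :
  wave_multiplier theta j (scaled_atom i0 (2 ^+ j)) x =
  ((2 * pi) ^- n)%:C%C * ext (atom_amplitude i0 theta (2 ^+ j)) x.
Proof.
rewrite /wave_multiplier /multiplier; congr (_ * _); rewrite /ext -[LHS]/(cint _ _).
congr cint; apply/funext => xi.
by rewrite fourier_scaled_atom ?exprn_gt0// /atom_amplitude !mulrA.
Qed.

Lemma wave_multiplier_packets (I : finType) (psi : 'rV[R]_n -> R[i]) (M mu : R) (j : nat)
    (z : I -> R) (w y : I -> 'rV[R]_n) x : 1 <= mu -> cmeas psi ->
  (forall xi, normc (psi xi) <= M) ->
  wave_multiplier psi j (fun v => \sum_i (z i)%:C%C * packet mu (w i) (y i) v) x =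
  ((2 * pi) ^- n)%:C%C * \sum_i (z i)%:C%C * ext (packet_amplitude (2 ^+ j) mu psi (w i) (y i)) x.
Proof.
move=> mu1 mpsi psiM; have mu0 : 0 < mu by exact: lt_le_trans mu1.
apply: wave_multiplier_sum => [i xi|i|i xi]; first exact: cintegrable_packet.
- exact: (cintegrable_packet_amplitude psiM _ mu1 mpsi).
- by rewrite fourier_packet.
Qed.

End wave_packets.

Lemma le_Re_of_dist {R : realType} (z : R[i]) (r d : R) :
  Normc.normc (z - r%:C%C) <= d -> r - d <= complex.Re z.
Proof.
move=> /(le_trans (le_Re_normc _)); case: z => a b /=.
by rewrite ler_norml => /andP[h _]; lra.
Qed.

(** * The test family and the lower bound that it gives *)

Section knapp_family.
Context {R : realType} {p : nat}.
Local Notation n := p.+2.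
Local Notation normc := (@Normc.normc R).
Local Notation leb := (@lebesgue_rV R n).
Variables (psi theta : 'rV[R]_n -> R[i]) (M : R).
Hypotheses (M1 : 1 <= M) (psiM : forall xi, normc (psi xi) <= M)
  (thetaM : forall xi, normc (theta xi) <= M).
Hypotheses (mpsi : cmeas psi) (mtheta : cmeas theta).
Hypothesis psi1 : forall xi, 2^-1 <= enorm xi <= 2 -> psi xi = 1.
Hypothesis theta1 : forall xi, enorm xi <= 6 -> theta xi = 1.
Variables (c0 : R).
Hypotheses (c0_gt0 : 0 < c0) (c0_small : p.+2%:R * c0 <= 30^-1).

Definition sup_const : R := (2 / (1 - expR (- ((4 * p.+2%:R)^-1 / 8)))) ^+ p.+2.

(** Half of a lower bound for the main term of [packet_interaction]; [mu_small] reserves the other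
    half for the error. A pair has total frequency [s * L] in length with [2 * c0 <= s <= 4 * c0]:
    there the Gaussian of [atom_hat] is at least [expR (- 1)] and its cosine at most [cos c0]. *)
Definition interaction_lower : R :=
  Num.sqrt (2 * pi) ^+ n * (expR (- 1) * (2 - 2 * cos c0)) *
  (Num.sqrt 2 * Num.sqrt 2 * pi) ^+ n ^+ 3 / 2.

Let c0_le : c0 <= 60^-1. Proof. exact: cap_size_le c0_gt0 c0_small. Qed.

Let cos_c0 : cos c0 < 1.
Proof.
rewrite -(@cos0 R); have := @pi_ge2 R => pi2.
have c1 := c0_le.
have h0 : (0 : R) \in `[0, pi] by rewrite in_itv/= lexx; lra.
have h1 : c0 \in `[0, pi].
  by rewrite in_itv/=; apply/andP; split; [exact: ltW|move: c1 pi2; lra].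
by rewrite ltr_cos.
Qed.

Lemma interaction_lower_gt0 : 0 < interaction_lower.
Proof.
have p2 : 0 < Num.sqrt (2 : R) by rewrite sqrtr_gt0.
rewrite divr_gt0// mulr_gt0//; last by rewrite !exprn_gt0// !mulr_gt0// pi_gt0.
rewrite mulr_gt0//; first by rewrite exprn_gt0// sqrtr_gt0 mulr_gt0// pi_gt0.
by rewrite mulr_gt0 ?expR_gt0//; have := cos_c0; lra.
Qed.

Variables (mu : R) (N j : nat).
Local Notation L := (2 ^+ j : R).
Hypotheses (mu1 : 1 <= mu) (N_le : N%:R <= c0 * mu).
Hypothesis mu_small : 4 * interaction_const (n := n) M (2 * c0) * mu ^+ 2 / L *
  (Num.sqrt 2 * Num.sqrt 4 * pi) ^+ n ^+ 3 <= interaction_lower.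

Let mu0 : 0 < mu. Proof. exact: lt_le_trans mu1. Qed.
Let L1 : 1 <= L. Proof. by rewrite exprn_ege1// ler1n. Qed.
Let L0 : 0 < L. Proof. exact: lt_le_trans L1. Qed.

Local Notation node := (@node R p mu N).
Local Notation level := (@level R c0 mu N).
Local Notation index := ({ffun 'I_p.+1 -> 'I_N} * 'I_N)%type.

Let center (sg : R) (i : index) : 'rV[R]_n := L *: frequency sg (node i.1) (level i.2).
Let amplitude (sg : R) (i : index) :=
  packet_amplitude L mu psi (center sg i) (focus sg (node i.1) (level i.2)).
Let chi (x : 'rV[R]_n) : R := gaussian ((mu / L) ^+ 2 / 2) x.

Let interaction (i i' : index) : R[i] := cint leb (fun x => (chi x)%:C%C *
  ext (atom_amplitude ord0 theta L) x * ext (amplitude (-1) i') x * ext (amplitude 1 i) x).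

Let node_dotp1 k : dotp (node k) (node k) <= 1.
Proof.
have h := node_dotp c0_gt0 c0_small mu0 N_le k; apply: (le_trans h); have := c0_le; lra.
Qed.

Let atom_hat_lower k s : 2 * c0 <= s <= 4 * c0 ->
  Num.sqrt (2 * pi) ^+ n * (expR (- 1) * (2 - 2 * cos c0)) <=
  atom_hat ord0 L (- ((s * L) *: direction (node k))).
Proof.
move=> /andP[s1 s2]; have c1 := c0_le; rewrite /atom_hat ler_wpM2l ?exprn_ge0 ?sqrtr_ge0//.
have e : L^-1 *: - ((s * L) *: direction (node k)) = - (s *: direction (node k)).
  by rewrite scalerN scalerA mulrCA mulVf ?mulr1// gt_eqF.
apply: ler_pM.
- exact: expR_ge0.
- by have := cos_c0; lra.
- rewrite e gaussianN /gaussian ler_expR lerN2 -enorm_sqr enormZ enorm_direction// mulr1.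
  have -> : `|s| = s by rewrite ger0_norm; lra.
  have : s ^+ 2 <= 1 ^+ 2 by rewrite lerXn2r ?nnegrE//; lra.
  by rewrite expr1n; lra.
have -> : L^-1 * (- ((s * L) *: direction (node k))) ord0 ord0 = - (s * direction (node k) ord0 ord0).
  by rewrite !mxE; field; rewrite gt_eqF.
rewrite cosN direction0.
have h := node_dotp c0_gt0 c0_small mu0 N_le k; have h0 := dotp_ge0 (node k).
have := sqrtr_ge0 (1 - dotp (node k) (node k)).
have : Num.sqrt (1 - dotp (node k) (node k)) ^+ 2 = 1 - dotp (node k) (node k).
  by rewrite sqr_sqrtr//; lra.
move: (Num.sqrt _) => q q2 q0.
(* The pole coordinate [q] of a cap point is between 1/2 and 1, so [s * q] is between [c0] and 1,
   where the cosine decreases. *)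
have ql : 1 / 2 <= q.
  rewrite leNgt; apply/negP => ql.
  have : q ^+ 2 <= (1 / 2) ^+ 2 by rewrite lerXn2r ?nnegrE//; lra.
  lra.
have qu : q <= 1.
  rewrite leNgt; apply/negP => qu; have : 1 < q ^+ 2 by rewrite exprn_egt1.
  lra.
have s0 : 0 <= s by lra.
have sq1 : c0 <= s * q by have := ler_wpM2l s0 ql; lra.
have sq2 : s * q <= 1 by have := ler_wpM2l s0 qu; lra.
have := @pi_ge2 R => pi2.
have h2 : s * q \in `[0, pi] by rewrite in_itv/=; apply/andP; split; lra.
have h1 : c0 \in `[0, pi].
  by rewrite in_itv/=; apply/andP; split; [exact: ltW|move: c1 pi2; lra].
have : cos (s * q) <= cos c0 by rewrite leNgt ltr_cos// -leNgt.
lra.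
Qed.
Let center_bounds sg i : sg ^+ 2 = 1 -> 3 / 4 * L <= enorm (center sg i) <= 3 / 2 * L.
Proof.
move=> sg1; rewrite /center enormZ (ger0_norm (ltW L0)) (mulrC L).
have /andP[h1 h2] := enorm_frequency_node c0_gt0 c0_small sg1 mu0 N_le i.1 i.2.
by rewrite !ler_wpM2r// ltW.
Qed.

Let focus_center sg i : sg ^+ 2 = 1 ->
  direction (node i.1) + (enorm (center sg i))^-1 *: center sg i = focus sg (node i.1) (level i.2).
Proof.
move=> sg1; rewrite /focus /center enormZ (ger0_norm (ltW L0)) scalerA; congr (_ + _ *: _).
by rewrite invfM mulrC mulrA mulfV ?mul1r// gt_eqF.
Qed.

Let interaction_ge k l l' : interaction_lower <= complex.Re (interaction (k, l) (k, l')).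
Proof.
have one : (1 : R) ^+ 2 = 1 by rewrite expr1n.
have mone : (- 1 : R) ^+ 2 = 1 by rewrite sqrrN expr1n.
have X1 : enorm (direction (node k)) = 1 by exact: enorm_direction.
have /andP[a1 a2] := level_bounds mu0 N_le l.
have /andP[b1 b2] := level_bounds mu0 N_le l'.
have c1 := c0_le.
have rb : 2 * c0 <= level l + level l' <= 1 by apply/andP; split; lra.
have cc0 : 0 < 2 * c0 by rewrite mulr_gt0.
have e : center 1 (k, l) + center (-1) (k, l') = ((level l + level l') * L) *: direction (node k).
  rewrite /center -scalerDr mulrC -scalerA; congr (_ *: _).
  rewrite /frequency /= scale1r scaleN1r addrACA subrr add0r.
  exact: (esym (scalerDl _ _ _)).
have := packet_interaction ord0 M1 psiM thetaM psi1 theta1 L1 mu1 cc0 X1 rb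
  (center_bounds (k, l) one) (center_bounds (k, l') mone) e mpsi mtheta.
rewrite (focus_center (k, l) one) (focus_center (k, l') mone) -/(interaction (k, l) (k, l')).
move=> /le_trans /(_ mu_small) h.
apply: le_trans (le_Re_of_dist h).
have h2 : 2 * interaction_lower <= atom_hat ord0 L (- (center 1 (k, l) + center (-1) (k, l'))) *
    (Num.sqrt 2 * Num.sqrt 2 * pi) ^+ n ^+ 3.
  rewrite e /interaction_lower mulrCA mulfV ?mulr1// ler_wpM2r//.
    by rewrite !exprn_ge0// !mulr_ge0 ?sqrtr_ge0// pi_ge0.
  by apply: atom_hat_lower; apply/andP; split; lra.
by move: h2; move: (_ * _ ^+ 3) interaction_lower => t t'; lra.
Qed.

(** The sign depends on the cap point and not on the level. As it is common to both families, it
    squares to 1 on all pairs of packets attached to the same point. *)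
Let wave_packets (sg : R) (eps : {ffun 'I_p.+1 -> 'I_N} -> R) (x : 'rV[R]_n) : R[i] :=
  \sum_i (eps i.1)%:C%C * packet mu (center sg i) (focus sg (node i.1) (level i.2)) x.

Let schwartz_wave_packets sg eps : schwartz (wave_packets sg eps).
Proof.
apply: cgaussian_class_schwartz; apply: cgaussian_class_sum => i.
by apply: cgaussian_classZ; exact: cgaussian_class_packet.
Qed.

Let wave_packets_le sg eps : sg ^+ 2 = 1 -> (forall k, `|eps k| = 1) ->
  (cnorm_Lp +oo%E (wave_packets sg eps) <= sup_const%:E)%E.
Proof.
move=> sg1 eps1; apply: cnorm_Loo_le.
  by rewrite exprn_ge0// divr_ge0// subr_ge0 expR_le1 oppr_le0 divr_ge0.
move=> x; rewrite /wave_packets; apply: (le_trans (normc_sum _ _ _)).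
apply: le_trans (le_sum_gaussian_focus c0_gt0 c0_small sg1 mu0 N_le x).
by apply: ler_sum => i _; rewrite Normc.normcM normc_real eps1 mul1r normc_packet.
Qed.

Lemma knapp_family : exists f g : 'rV[R]_n -> R[i],
  [/\ schwartz f, schwartz g, (cnorm_Lp +oo%E f <= sup_const%:E)%E,
      (cnorm_Lp +oo%E g <= sup_const%:E)%E &
      ((((2 * pi) ^- n) ^+ 3 * (N%:R ^+ p.+3 * interaction_lower))%:E <=
       cnorm_Lp 1%E (fun x => (wave_multiplier psi j f x * wave_multiplier psi j g x *
         wave_multiplier theta j (scaled_atom ord0 L) x)%R))%E].
Proof.
have one : (1 : R) ^+ 2 = 1 by rewrite expr1n.
have mone : (- 1 : R) ^+ 2 = 1 by rewrite sqrrN expr1n.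
(* All pairs of levels are collected, since the signs ignore levels; a lower bound is known on the
   diagonal of [J] only. *)
pose J k k' := \sum_l \sum_l' complex.Re (interaction (k, l) (k', l')).
have [eps eps1 epsJ] := exists_signs J.
exists (wave_packets 1 eps), (wave_packets (-1) eps).
split; [exact: schwartz_wave_packets|exact: schwartz_wave_packets|
  exact: wave_packets_le|exact: wave_packets_le|].
set K : R := (2 * pi) ^- n.
have K0 : 0 <= K by rewrite invr_ge0 exprn_ge0// mulr_ge0// pi_ge0.
pose T (i i' : index) x := (chi x)%:C%C * ext (atom_amplitude ord0 theta L) x *
  ext (amplitude (-1) i') x * ext (amplitude 1 i) x.
have ia sg i : cintegrable leb (amplitude sg i).
  exact: (cintegrable_packet_amplitude psiM _ mu1 mpsi).
have ic : cintegrable leb (atom_amplitude ord0 theta L).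
  exact: (cintegrable_atom_amplitude ord0 thetaM L1 mtheta).
have e0 : 0 < (mu / L) ^+ 2 / 2 by rewrite divr_gt0// exprn_gt0// divr_gt0.
have ichi : cintegrable leb (fun x => (chi x)%:C%C).
  have := cintegrable_gaussian (0 : 'rV[R]_n) 0 e0.
  by under eq_fun do rewrite dotp0l oppr0 expi0 mul1r subr0.
have iT i i' : cintegrable leb (T i i').
  by apply: cintegrable_mul_ext => //; apply: cintegrable_mul_ext => //; exact: cintegrable_mul_ext.
have FE sg x : wave_multiplier psi j (wave_packets sg eps) x =
    K%:C%C * \sum_i (eps i.1)%:C%C * ext (amplitude sg i) x.
  exact: (wave_multiplier_packets _ _ _ _ _ mu1 mpsi psiM).
have HE x := wave_multiplier_atom ord0 theta j x.
rewrite -/K in HE.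
pose E (i i' : index) : R := K ^+ 3 * (eps i.1 * eps i'.1).
have mul3 (k A B C A' B' C' : R[i]) : A = A' -> B = B' -> C = C' ->
    k * (A * B * C) = k * (A' * B' * C') by move=> -> -> ->.
have alg1 (k A B C z : R[i]) : k * (z * A * (z * B) * (z * C)) = z ^+ 3 * k * C * (A * B) by ring.
have alg2 (k A B C z y y' : R[i]) : z ^+ 3 * k * C * (y * A * (y' * B)) =
    z ^+ 3 * (y * y') * (k * C * B * A) by ring.
have sumE : (fun x => (chi x)%:C%C * (wave_multiplier psi j (wave_packets 1 eps) x *
    wave_multiplier psi j (wave_packets (-1) eps) x *
    wave_multiplier theta j (scaled_atom ord0 L) x)) =
    fun x => \sum_i \sum_i' (E i i')%:C%C * T i i' x.
  apply/funext => x; apply: (etrans (mul3 _ _ _ _ _ _ _ (FE 1 x) (FE (- 1) x) (HE x))).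
  rewrite alg1.
  rewrite big_distrlr mulr_sumr; apply: eq_bigr => i _.
  rewrite mulr_sumr; apply: eq_bigr => i' _.
  by rewrite /E /T rmorphM rmorphXn rmorphM; exact: alg2.
have FGHE : cint leb (fun x => (chi x)%:C%C * (wave_multiplier psi j (wave_packets 1 eps) x *
    wave_multiplier psi j (wave_packets (-1) eps) x *
    wave_multiplier theta j (scaled_atom ord0 L) x)) =
    \sum_i \sum_i' (E i i')%:C%C * interaction i i'.
  rewrite sumE.
  have h i i' : cintegrable leb (fun x => (E i i')%:C%C * T i i' x) by exact: cintegrableZ.
  have h1 i : cintegrable leb (fun x => \sum_i' (E i i')%:C%C * T i i' x).
    by apply: cintegrable_sum => i'; exact: h.
  rewrite (cint_sum _ h1); apply: eq_bigr => i _.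
  rewrite (cint_sum _ (h i)); apply: eq_bigr => i' _.
  exact: cintZ.
have ikf : cintegrable leb (fun x => (chi x)%:C%C * (wave_multiplier psi j (wave_packets 1 eps) x *
    wave_multiplier psi j (wave_packets (-1) eps) x *
    wave_multiplier theta j (scaled_atom ord0 L) x)).
  rewrite sumE; apply: cintegrable_sum => i; apply: cintegrable_sum => i'.
  exact: cintegrableZ.
have mF sg : cmeas (wave_multiplier psi j (wave_packets sg eps)).
  rewrite (funext (FE sg)); apply: cmeasM; first exact: cmeas_cst.
  by apply: cmeas_sum => i; apply: cmeasM; [exact: cmeas_cst|exact: cmeas_ext].
have mH : cmeas (wave_multiplier theta j (scaled_atom ord0 L)).
  by rewrite (funext HE); apply: cmeasM; [exact: cmeas_cst|exact: cmeas_ext].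
have chi01 x : 0 <= chi x <= 1.
  by rewrite gaussian_ge0/= expR_le1 oppr_le0 mulr_ge0 ?dotp_ge0// ltW.
(* As [0 <= chi <= 1], the L^1 norm is at least the modulus of the integral against [chi]. *)
apply: le_trans (le_cnorm_L1 (cmeasM (cmeasM (mF 1) (mF (- 1))) mH) chi01 ikf).
rewrite lee_fin FGHE; apply: le_trans (le_trans (ler_norm _) (le_Re_normc _)).
have ReZ (r : R) (z : R[i]) : complex.Re (r%:C%C * z) = r * complex.Re z.
  by case: z => a b /=; rewrite mul0r subr0.
rewrite Re_sum; under eq_bigr do rewrite Re_sum.
under eq_bigr do under eq_bigr do rewrite ReZ /E -mulrA.
under eq_bigr do rewrite -mulr_sumr.
rewrite -mulr_sumr ler_wpM2l ?exprn_ge0//.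
have pairE (G : index -> R) : \sum_i G i = \sum_k \sum_l G (k, l).
  by rewrite pair_bigA; apply: eq_bigr => -[].
have -> : \sum_i \sum_i' eps i.1 * eps i'.1 * complex.Re (interaction i i') =
    \sum_k \sum_k' eps k * eps k' * J k k'.
  rewrite pairE; apply: eq_bigr => k _.
  under eq_bigr do rewrite pairE.
  rewrite exchange_big; apply: eq_bigr => k' _; rewrite mulr_sumr; apply: eq_bigr => l _.
  by rewrite mulr_sumr.
apply: le_trans epsJ.
(* The count: [N ^+ p.+1] cap points and [N ^+ 2] pairs of levels, hence the exponent [p.+3], which
   is the dimension plus one. *)
apply: (@le_trans _ _ (\sum_(k : {ffun 'I_p.+1 -> 'I_N}) \sum_(l : 'I_N) \sum_(l' : 'I_N) interaction_lower)).
  rewrite !sumr_const card_ffun !card_ord -!mulrnA -[leRHS]mulr_natl -natrX.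
  by rewrite le_eqVlt; apply/orP; left; apply/eqP; congr (_%:R * _); rewrite !expnS; ring.
by do 3!apply: ler_sum => ? _; exact: interaction_ge.
Qed.

End knapp_family.

(** * Choice of the parameters and conclusion *)

Lemma exp_bounded_le1 {R : realType} (x k C : R) : 0 <= x -> 0 < k ->
  (forall t : nat, x ^+ t * k <= C) -> x <= 1.
Proof.
move=> x0 k0 h; rewrite leNgt; apply/negP => x1.
(* Bernoulli: the powers of a number above 1 grow at least linearly. *)
have bern (t : nat) : t%:R * (x - 1) <= x ^+ t.
  elim: t => [|t ih]; first by rewrite mul0r.
  have x1t : 1 <= x ^+ t by rewrite exprn_ege1// ltW.
  have := ler_wpM2r (_ : 0 <= x - 1) x1t; rewrite subr_ge0 (ltW x1) => /(_ isT).
  by rewrite exprS -[t.+1]addn1 natrD; lra.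
have d0 : 0 < (x - 1) * k by rewrite mulr_gt0// subr_gt0.
have C0 : 0 <= C / ((x - 1) * k).
  by rewrite divr_ge0 ?(ltW d0)//; have := h 0%N; rewrite expr0 mul1r; apply: le_trans; exact: ltW.
have := archi_boundP C0; rewrite ltr_pdivrMr// ltNge => /negP; apply.
by rewrite mulrA (le_trans (ler_wpM2r (ltW k0) (bern _))).
Qed.

(** All parameters are taken to be powers of 2, so that the tested inequality is an exact geometric
    progression in [t], to which [exp_bounded_le1] applies. *)
Lemma proposition5p1_succ {R : realType} (p : nat)
    (psi theta : 'rV[R]_p.+2 -> R[i])
    (psi_test : test_function psi) (theta_test : test_function theta)
    (psi1 : forall xi, 2^-1 <= enorm xi <= 2 -> psi xi = 1)
    (theta1 : forall xi, enorm xi <= 6 -> theta xi = 1)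
    (Phi : 'rV[R]_p.+2 -> R[i]) (Phi_schwartz : schwartz Phi)
    (m c : R) (c_gt0 : 0 < c)
    (bound : forall j : nat, (0 < j)%N ->
      forall f g h : 'rV[R]_p.+2 -> R[i], schwartz f -> schwartz g -> schwartz h ->
      (hardy_norm Phi h < +oo)%E ->
      ((2 `^ (j%:R * m))%:E *
         cnorm_Lp 1%E (fun x => (wave_multiplier psi j f x * wave_multiplier psi j g x *
                               wave_multiplier theta j h x)%R)
       <= c%:E * cnorm_Lp +oo f * cnorm_Lp +oo g * hardy_norm Phi h)%E) :
  2 * m + p.+3%:R <= 0.
Proof.
have [M1 M1_ge psiM1] := test_function_bounded psi_test.
have [M2 M2_ge thetaM2] := test_function_bounded theta_test.
pose M := Num.max M1 M2.
have M_ge : 1 <= M by rewrite le_max M1_ge.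
have psiM xi : Normc.normc (psi xi) <= M by rewrite le_max psiM1.
have thetaM xi : Normc.normc (theta xi) <= M by rewrite le_max thetaM2 orbT.
have [CH CH0 hardy] := hardy_norm_scaled_atom ord0 Phi_schwartz.
(* Chosen for [30 * p.+2 <= 2 ^+ q'], the smallness of [c0 = 2 ^- q'] that the cap requires. *)
pose q' := (30 * p.+2)%N.
have two0 (k : nat) : 0 < 2 ^+ k :> R by rewrite exprn_gt0.
pose c0 : R := 2 ^- q'.
have c0_gt0 : 0 < c0 by rewrite invr_gt0.
have nat_le_exp (k : nat) : k%:R <= 2 ^+ k :> R.
  by rewrite -natrX ler_nat ltnW// ltn_expl.
have c0_small : p.+2%:R * c0 <= 30^-1.
  rewrite /c0 ler_pdivrMr// mulrC ler_pdivlMr// mulrC -natrM; exact: nat_le_exp.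
pose kap := interaction_lower (p := p) c0.
have kap0 : 0 < kap by exact: interaction_lower_gt0.
pose B := 4 * interaction_const (n := p.+2) M (2 * c0) *
  (Num.sqrt 2 * Num.sqrt 4 * pi) ^+ p.+2 ^+ 3.
(* [mu ^+ 2 / L] will be the square of [2 ^- q]; a single factor [2 ^- q] already brings the error
   below [kap]. *)
pose q := Num.bound (`|B| / kap).
have Bq : `|B| <= kap * 2 ^+ q.
  rewrite mulrC -ler_pdivrMr// (le_trans _ (nat_le_exp q))// ltW// archi_boundP//.
  by rewrite divr_ge0// ltW.
pose S := sup_const (R := R) (p := p).
pose K : R := (2 * pi) ^- p.+2.
have K0 : 0 < K by rewrite invr_gt0 exprn_gt0// mulr_gt0// pi_gt0.
have fld (a b : R) : 0 < a -> 0 < b -> a ^+ 2 / (a * b) ^+ 2 = b^-1 * b^-1.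
  by move=> a0 b0; field; rewrite !gt_eqF.
have alg (y k z : R) (t a b : nat) : (y ^+ 2 * 2 ^+ b) ^+ t * (y ^+ (2 * a) * k ^+ 3 * z) =
    y ^+ (2 * (t + a)) * (k ^+ 3 * ((2 ^ t)%N%:R ^+ b * z)).
  rewrite mulnDr exprD exprMn natrX -!exprM [(t * b)%N]mulnC.
  by move: (y ^+ (2 * t)) (y ^+ (2 * a)) (2 ^+ (b * t)) (k ^+ 3) => *; ring.
have main (t : nat) : 2 `^ ((2 * (t + (q + q')))%N%:R * m) *
    (K ^+ 3 * ((2 ^ t)%N%:R ^+ p.+3 * kap)) <= c * S * S * CH.
  (* Even, so that [L = 2 ^+ j] is the square of [mu * 2 ^+ q] with [mu = 2 ^+ (t + q')]. The
     summand [q'] gives [N = 2 ^ t = c0 * mu] exactly, and makes [j] positive also for [t = 0]. *)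
  set j := (2 * _)%N.
  have j0 : (0 < j)%N by rewrite /j muln_gt0/= !addn_gt0 /q' muln_gt0/= !orbT.
  pose mu : R := 2 ^+ (t + q').
  have mu1 : 1 <= mu by rewrite exprn_ege1// ler1n.
  have N_le : (2 ^ t)%N%:R <= c0 * mu.
    by rewrite /c0 /mu exprD natrX mulrCA mulVf ?mulr1// gt_eqF.
  have mu_small : 4 * interaction_const (n := p.+2) M (2 * c0) * mu ^+ 2 / 2 ^+ j *
      (Num.sqrt 2 * Num.sqrt 4 * pi) ^+ p.+2 ^+ 3 <= kap.
    rewrite (_ : _ * _ = B * (mu ^+ 2 / 2 ^+ j)); last by rewrite /B; ring.
    have -> : mu ^+ 2 / 2 ^+ j = (2 ^+ q)^-1 * (2 ^+ q)^-1.
      have -> : 2 ^+ j = (mu * 2 ^+ q) ^+ 2 :> R.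
        by rewrite /mu /j mulnC exprM -exprD addnAC -addnA.
      by apply: fld => //; exact: lt_le_trans mu1.
    apply: (@le_trans _ _ (`|B| * (2 ^+ q)^-1)).
      rewrite (le_trans (ler_norm _))// normrM ler_wpM2l// ger0_norm ?mulr_ge0 ?invr_ge0 ?(ltW (two0 _))//.
      by rewrite ler_piMl ?invr_ge0 ?(ltW (two0 _))// invf_le1// exprn_ege1// ler1n.
    by rewrite ler_pdivrMr.
  have mpsi := cmeas_smooth psi_test.1; have mtheta := cmeas_smooth theta_test.1.
  have [f [g [sf sg fS gS low]]] := knapp_family M_ge psiM thetaM mpsi mtheta psi1 theta1
    c0_gt0 c0_small mu1 N_le mu_small.
  have L0 := two0 j.
  have hH := hardy _ L0.
  have := bound j j0 f g _ sf sg (schwartz_scaled_atom ord0 L0) (le_lt_trans hH (ltry _)).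
  move=> up; rewrite -lee_fin EFinM.
  apply: (le_trans (lee_wpmul2l _ low)); first by rewrite lee_fin powR_ge0.
  apply: (le_trans up).
  have S0 : 0 <= S by rewrite -lee_fin (le_trans _ fS)// Lnorm_ge0.
  rewrite !EFinM; apply: lee_pmul => //; rewrite ?mule_ge0 ?Lnorm_ge0 ?lee_fin ?(ltW c_gt0)//.
  apply: lee_pmul => //; rewrite ?mule_ge0 ?Lnorm_ge0 ?lee_fin ?(ltW c_gt0)//.
  by apply: lee_pmul => //; rewrite ?Lnorm_ge0 ?lee_fin ?(ltW c_gt0).
pose Y : R := 2 `^ m.
have Y0 : 0 < Y by rewrite powR_gt0.
(* The ratio of the progression: from [t] to [t + 1] the exponent [j] grows by 2 and [N] doubles. *)
have X1 : Y ^+ 2 * 2 ^+ p.+3 <= 1.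
  apply: (@exp_bounded_le1 _ _ (Y ^+ (2 * (q + q')) * K ^+ 3 * kap) (c * S * S * CH)).
  - by rewrite mulr_ge0// exprn_ge0// ltW.
  - by apply: mulr_gt0 => //; apply: mulr_gt0; apply: exprn_gt0.
  move=> t; apply: le_trans (main t); rewrite le_eqVlt; apply/orP; left; apply/eqP.
  (* The identity reached is [alg] for [Y], with [a] equal to [q + q'] and [b] to [p.+3]. *)
  rewrite [_%:R * m]mulrC powRrM -/Y powR_mulrn ?(ltW Y0)//.

have XE : Y ^+ 2 * 2 ^+ p.+3 = 2 `^ (2 * m + p.+3%:R).
  rewrite powRD ?pnatr_eq0 ?implybT// powR_mulrn// [2 * m]mulrC powRrM.
  by rewrite -/Y powR_mulrn// ltW.
rewrite leNgt; apply/negP => m0; move: X1; apply/negP; rewrite -ltNge XE.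
by rewrite /powR pnatr_eq0/= expR_gt1 mulr_gt0// ln_gt0// ltr1n.
Qed.

Theorem proposition5p1 (R : realType) (n : nat) (n_ge2 : (2 <= n)%N)
    (psi theta : 'rV[R]_n -> R[i])
    (psi_test : test_function psi) (theta_test : test_function theta)
    (psi_supp : supp psi `<=` [set xi | 3^-1 <= enorm xi <= 3])
    (psi1 : forall xi, 2^-1 <= enorm xi <= 2 -> psi xi = 1)
    (theta_supp : supp theta `<=` [set xi | enorm xi <= 10])
    (theta1 : forall xi, enorm xi <= 6 -> theta xi = 1)
    (Phi : 'rV[R]_n -> R[i])
    (Phi_schwartz : schwartz Phi) (Phi_neq0 : cintegral Phi != 0)
    (m c : R) (c_gt0 : 0 < c)
    (bound : forall j : nat, (0 < j)%N ->
      forall f g h : 'rV[R]_n -> R[i], schwartz f -> schwartz g -> schwartz h ->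
      (hardy_norm Phi h < +oo)%E ->
      ((2 `^ (j%:R * m))%:E *
         cnorm_Lp 1%E (fun x => (wave_multiplier psi j f x * wave_multiplier psi j g x *
                               wave_multiplier theta j h x)%R)
       <= c%:E * cnorm_Lp +oo f * cnorm_Lp +oo g * hardy_norm Phi h)%E) :
  m <= - (n.+1%:R / 2).
Proof.
case: n n_ge2 psi theta psi_test theta_test psi_supp psi1 theta_supp theta1 Phi
  Phi_schwartz Phi_neq0 bound => [//|[//|p]] _ psi theta psi_test theta_test _ psi1 _ theta1
  Phi Phi_schwartz _ bound.
have := proposition5p1_succ psi_test theta_test psi1 theta1 Phi_schwartz c_gt0 bound.
by lra.
Qed.
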